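(* Assume that $A$, $F$, $q$, $\phi$ satisfy conditions (a), (b), (c) of the Hypothesis in the context. Then the value functional $V$ is a viscosity solution of the PHJB equation $$\begin{cases}\partial_tV(\gamma_t)+(A^*\partial_xV(\gamma_t),\gamma_t(t))_H+\mathbf{H}(\gamma_t,\partial_xV(\gamma_t))=0, & t\in[0,T),\ \gamma_t\in\Lambda_t,\\ V(\gamma_T)=\phi(\gamma_T), & \gamma_T\in\Lambda_T.\end{cases}$$
   Context: **Path spaces.** $H$ is a real separable Hilbert space with inner product $(\cdot,\cdot)_H$ and norm $|\cdot|$; $T>0$ is fixed; $A$ generates a $C_0$-semigroup $\{e^{tA}\}_{t\ge0}$ of bounded linear operators on $H$, and $A^*$ is its adjoint. For $t\in[0,T]$, $\hat\Lambda_t=D([0,t];H)$ is the set of càdlàg functions $[0,t]\to H$ and $\Lambda_t=C([0,t];H)$. Put $\hat\Lambda^t=\bigcup_{s\in[t,T]}\hat\Lambda_s$, $\hat\Lambda=\hat\Lambda^0$, $\Lambda^t=\bigcup_{s\in[t,T]}\Lambda_s$, $\Lambda=\Lambda^0$. An element with subscript $t$, such as $\gamma_t$, is a path on $[0,t]$; $\gamma_t(s)$ is its value at $s$. For $x\in H$ and $t\le\bar t\le T$: $\gamma_t^x$ is the path on $[0,t]$ equal to $\gamma_t$ on $[0,t)$ with $\gamma_t^x(t)=\gamma_t(t)+x$; $\gamma_{t,\bar t}$ is the path on $[0,\bar t]$ equal to $\gamma_t$ on $[0,t)$ and to $\gamma_t(t)$ on $[t,\bar t]$; $\gamma_{t,\bar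 t,A}$ is the path on $[0,\bar t]$ equal to $\gamma_t$ on $[0,t)$ and to $e^{(s-t)A}\gamma_t(t)$ at $s\in[t,\bar t]$. Set $\|\gamma_t\|_0=\sup_{0\le s\le t}|\gamma_t(s)|$ and $d_\infty(\gamma_t,\eta_s)=|t-s|+\|\gamma_{t,T,A}-\eta_{s,T,A}\|_0$. **Derivatives.** For $f$ on paths in $\hat\Lambda$: $\partial_xf(\gamma_t)=B\in H$ if $\lim_{|h|\to0}|f(\gamma_t^h)-f(\gamma_t)-(B,h)_H|/|h|=0$; $\partial_tf(\gamma_t)=\lim_{l\downarrow0}\frac1l[f(\gamma_{t,t+l})-f(\gamma_t)]$ for $t<T$. $C^0(\hat\Lambda^t)$, $C^0(\Lambda^t)$ denote functionals continuous under $d_\infty$. $f\in C^1(\hat\Lambda^t)$ if $f\in C^0(\hat\Lambda^t)$ and $\partial_tf,\partial_xf$ exist and are continuous. $f\in C^1(\Lambda^t)$ if $f$ is the restriction to $\Lambda^t$ of some $\hat f\in C^1(\hat\Lambda^t)$; then $\partial_tf,\partial_xf$ on $\Lambda^t$ denote the restrictions of $\partial_t\hat f,\partial_x\hat f$. ''$A^*\partial_xf\in C^0(\Lambda^t)$'' means that $\partial_xf$ takes values in the domain of $A^*$ and $\gamma\mapsto A^*\partial_xf(\gamma)$ is $d_\infty$-continuous on $\Lambda^t$. **Hypothesis.** $(U,d)$ is a metric space; $F:\Lambda\times U\to H$, $q:\Lambda\times U\to\mathbb R$, $\phi:\Lambda_T\to\mathbb R$. (a) $\{e^{tA}\}$ is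 a $C_0$ contraction semigroup. (b) For every $\gamma_t\in\Lambda$, $F(\gamma_t,\cdot)$ and $q(\gamma_t,\cdot)$ are continuous in $u$. (c) There is $L>0$ such that for all $\gamma_t,\eta_s\in\Lambda$, $\zeta_T,\zeta_T'\in\Lambda_T$, $u\in U$: $|F(\gamma_t,u)|^2\le L^2(1+\|\gamma_t\|_0^2)$, $|F(\gamma_t,u)-F(\eta_s,u)|\le Ld_\infty(\gamma_t,\eta_s)$, $|q(\gamma_t,u)-q(\eta_s,u)|\le Ld_\infty(\gamma_t,\eta_s)$, $|q(\gamma_t,u)|\le L(1+\|\gamma_t\|_0)$, $|\phi(\zeta_T)-\phi(\zeta'_T)|\le L\|\zeta_T-\zeta_T'\|_0$, $|\phi(\zeta_T)|\le L(1+\|\zeta_T\|_0)$. **Control problem.** $\mathcal U[t,T]$ is the set of measurable $u:[t,T]\to U$. For $\gamma_t\in\Lambda_t$, $u\in\mathcal U[t,T]$, $X^{\gamma_t,u}:[0,T]\to H$ is the unique continuous function (mild solution) with $X(s)=\gamma_t(s)$ for $s\in[0,t)$ and $X(s)=e^{(s-t)A}\gamma_t(t)+\int_t^se^{(s-\sigma)A}F(X_\sigma,u(\sigma))\,d\sigma$ for $s\in[t,T]$, where $X_\sigma=X|_{[0,\sigma]}$. The cost is $J(\gamma_t,u)=\int_t^Tq(X^{\gamma_t,u}_\sigma,u(\sigma))d\sigma+\phi(X_T^{\gamma_t,u})$ and the value functional is $V(\gamma_t)=\inf_{u\in\mathcal U[t,T]}J(\gamma_t,u)$, $\gamma_t\in\Lambda$.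 **Hamiltonian.** $\mathbf H(\gamma_t,p)=\inf_{u\in U}[(p,F(\gamma_t,u))_H+q(\gamma_t,u)]$, $(\gamma_t,p)\in\Lambda\times H$. **Test functionals.** $S(\gamma_t)=(\|\gamma_t\|_0^2-|\gamma_t(t)|^2)^2/\|\gamma_t\|_0^2$ if $\|\gamma_t\|_0\ne0$ and $S(\gamma_t)=0$ otherwise; $\Upsilon^2(\gamma_t)=S(\gamma_t)+2|\gamma_t(t)|^2$ (the superscript $2$ is an index; $\partial_x\Upsilon^2$ is computed on $\hat\Lambda$ with the same formula). $\Phi=\{\varphi\in C^1(\Lambda): A^*\partial_x\varphi\in C^0(\Lambda)\}$. $\mathcal G_t$ is the set of $g\in C^0(\Lambda^t)$ for which there are $h\in C^1([0,T]\times\mathbb R)$ with $\nabla_xh\ge0$ (derivative in the second variable), $N>0$, $\delta_i>0$, $t_i\le t$, $\gamma^i_{t_i}\in\Lambda_{t_i}$ ($i=0,1,2,\dots$) with $\|\gamma^i_{t_i}\|_0\le N$, $\sum_i\delta_i\le N$, such that for all $\gamma_s\in\Lambda^t$ $$g(\gamma_s)=h(s,\Upsilon^2(\gamma_s))+\sum_{i=0}^\infty\delta_i\big[\Upsilon^2(\gamma_s-\gamma^i_{t_i,s,A})+|s-t_i|^2\big].$$ For such $g$ (with this representation) one writes $\partial_tg(\gamma_s):=h_t(s,\Upsilon^2(\gamma_s))+2\sum_i\delta_i(s-t_i)$ and $\partial_xg(\gamma_s):=\nabla_xh(s,\Upsilon^2(\gamma_s))\partial_x\Upsilon^2(\gamma_s)+\sum_i\delta_i\partial_x\Upsilon^2(\gamma_s-\gamma^i_{t_i,s,A})$.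 **Viscosity solutions.** $w\in C^0(\Lambda)$ is a viscosity subsolution (resp. supersolution) of the PHJB equation if $w(\gamma_T)\le\phi(\gamma_T)$ (resp. $\ge$) for all $\gamma_T\in\Lambda_T$ and, for all $t\in[0,T)$, $\varphi\in\Phi$, $g\in\mathcal G_t$ and $\gamma_t\in\Lambda_t$, whenever $0=(w-\varphi-g)(\gamma_t)=\sup_{\eta_s\in\Lambda^t}(w-\varphi-g)(\eta_s)$ (resp. $0=(w+\varphi+g)(\gamma_t)=\inf_{\eta_s\in\Lambda^t}(w+\varphi+g)(\eta_s)$), one has $$\partial_t\varphi(\gamma_t)+\partial_tg(\gamma_t)+(A^*\partial_x\varphi(\gamma_t),\gamma_t(t))_H+\mathbf H(\gamma_t,\partial_x\varphi(\gamma_t)+\partial_xg(\gamma_t))\ge0$$ (resp. $-\partial_t\varphi(\gamma_t)-\partial_tg(\gamma_t)-(A^*\partial_x\varphi(\gamma_t),\gamma_t(t))_H+\mathbf H(\gamma_t,-\partial_x\varphi(\gamma_t)-\partial_xg(\gamma_t))\le0$). A viscosity solution is both a sub- and a supersolution. *)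

(* Defs.v *)
From HB Require Import structures.
From mathcomp Require Import all_boot all_order all_algebra.
From mathcomp Require Import all_classical all_reals all_analysis.

Set Implicit Arguments.
Unset Strict Implicit.
Unset Printing Implicit Defensive.

Import Order.TTheory GRing.Theory Num.Theory.
Import numFieldNormedType.Exports.

Local Open Scope classical_set_scope.
Local Open Scope ring_scope.

(* A real Hilbert space is a complete normed module over R together with a
   positive definite symmetric bilinear form inducing its norm. *)
Definition inner_product_of_norm (R : realType) (H : completeNormedModType R)
    (ip : {dot H for idfun}) : Prop :=
  forall x : H, ip x x = `|x| ^+ 2.

Definition separable_space (H : topologicalType) : Prop :=
  exists2 D : set H, countable D & dense D.

(** * Bochner integral with respect to Lebesgue measure *)

Section Bochner.
Context (R : realType) (H : completeNormedModType R).

Definition step (n : nat) (E : nat -> set R) (c : nat -> H) (x : R) : H :=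
  \sum_(k < n) \1_(E k) x *: c k.

Definition step_integral (n : nat) (E : nat -> set R) (c : nat -> H) : H :=
  \sum_(k < n) fine (lebesgue_measure (E k)) *: c k.

(* The a.e. convergence is strong measurability of f on D. *)
Definition is_bochner (D : set R) (f : R -> H) (v : H) : Prop :=
  exists (n : nat -> nat) (E : nat -> nat -> set R) (c : nat -> nat -> H),
    [/\ forall m k, [/\ measurable (E m k), E m k `<=` D
                      & (lebesgue_measure (E m k) < +oo)%E],
        {ae lebesgue_measure, forall x, D x ->
           step (n m) (E m) (c m) x @[m --> \oo] --> f x},
        (\int[lebesgue_measure]_(x in D)
           (`|f x - step (n m) (E m) (c m) x|%:E))%E @[m --> \oo] --> 0%E
      & step_integral (n m) (E m) (c m) @[m --> \oo] --> v].

End Bochner.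

(** * Unbounded operators and semigroups *)

Section Operators.
Context (R : realType) (H : completeNormedModType R).

(* The values of oval outside odom are irrelevant. *)
Record operator := Operator { odom : set H ; oval : H -> H }.

Definition adjoint_value (ip : {dot H for idfun}) (A : operator) (p y : H) :=
  forall x, odom A x -> ip (oval A x) p = ip x y.

Definition adjoint (ip : {dot H for idfun}) (A : operator) : operator :=
  Operator [set p | exists y, adjoint_value ip A p y]
           (fun p => xget 0 [set y | adjoint_value ip A p y]).

(* Only the operators e t with 0 <= t are relevant. *)
Definition C0_semigroup (e : R -> {linear H -> H}) : Prop :=
  [/\ forall t, 0 <= t -> continuous (e t),
      forall x, e 0 x = x,
      forall s t x, 0 <= s -> 0 <= t -> e (s + t) x = e s (e t x)
    & forall x, e t x @[t --> 0^'+] --> x].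

Definition contraction_semigroup (e : R -> {linear H -> H}) : Prop :=
  forall t x, 0 <= t -> `|e t x| <= `|x|.

Definition generates (A : operator) (e : R -> {linear H -> H}) : Prop :=
  forall x y, (odom A x /\ oval A x = y) <->
              h^-1 *: (e h x - x) @[h --> 0^'+] --> y.

End Operators.

(** * Path spaces *)

Section Paths.
Context (R : realType) (H : completeNormedModType R).

(* A path on [0, ptime] is encoded by a total function; membership in the path
   spaces below imposes that it vanishes outside [0, ptime], so that two paths
   of a path space are equal iff they have the same final time and agree
   there.  Functionals on paths are total and are only constrained, and only
   used, on the path spaces. *)
Record hpath := Path { ptime : R ; pfun :> R -> H }.

Definition restrict_path (t : R) (f : R -> H) : hpath :=
  Path t (fun s => if (0 <= s) && (s <= t) then f s else 0).

Definition normal_path (g : hpath) : Prop :=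
  forall s, ~~ ((0 <= s) && (s <= ptime g)) -> g s = 0.

Definition cadlag (t : R) (f : R -> H) : Prop :=
  (forall s, 0 <= s < t -> f r @[r --> s^'+] --> f s) /\
  (forall s, 0 < s <= t -> cvg (f r @[r --> s^'-])).

(* \hat\Lambda^t and \Lambda^t *)
Definition hatLambda (T t : R) : set hpath :=
  [set g | [/\ t <= ptime g <= T, normal_path g & cadlag (ptime g) g]].

Definition Lambda (T t : R) : set hpath :=
  [set g | [/\ t <= ptime g <= T, normal_path g
             & {within `[0, ptime g], continuous g}]].

(* \gamma_t^x *)
Definition bump_path (g : hpath) (x : H) : hpath :=
  restrict_path (ptime g) (fun s => if s < ptime g then g s else g (ptime g) + x).

(* \gamma_{t,t'} *)
Definition stop_path (g : hpath) (t' : R) : hpath :=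
  restrict_path t' (fun s => if s < ptime g then g s else g (ptime g)).

(* \gamma_{t,t',A} *)
Definition flow_path (e : R -> {linear H -> H}) (g : hpath) (t' : R) : hpath :=
  restrict_path t'
    (fun s => if s < ptime g then g s else e (s - ptime g) (g (ptime g))).

Definition sub_path (g k : hpath) : hpath :=
  Path (ptime g) (fun s => g s - k s).

Definition pnorm (g : hpath) : R := sup [set `|g s| | s in `[0, ptime g]].

Definition dinf (T : R) (e : R -> {linear H -> H}) (g k : hpath) : R :=
  `|ptime g - ptime k| + pnorm (sub_path (flow_path e g T) (flow_path e k T)).

Definition pcont (T : R) (e : R -> {linear H -> H}) (V : normedModType R)
    (D : set hpath) (f : hpath -> V) : Prop :=
  forall g, D g -> forall eps, 0 < eps -> exists2 del, 0 < del &
    forall k, D k -> dinf T e g k < del -> `|f g - f k| < eps.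

(** ** Functional derivatives *)

Definition is_dx (ip : {dot H for idfun}) (f : hpath -> R) (g : hpath) (B : H) :=
  `|f (bump_path g h) - f g - ip B h| / `|h| @[h --> (0 : H)^'] --> (0 : R).

Definition dx (ip : {dot H for idfun}) (f : hpath -> R) (g : hpath) : H :=
  xget 0 [set B | is_dx ip f g B].

Definition dt_quotient (f : hpath -> R) (g : hpath) (l : R) : R :=
  l^-1 * (f (stop_path g (ptime g + l)) - f g).

Definition dt (f : hpath -> R) (g : hpath) : R :=
  lim (dt_quotient f g l @[l --> 0^'+]).

(* C^1(\hat\Lambda); the horizontal derivative lives on final times < T. *)
Definition C1 (ip : {dot H for idfun}) (T : R) (e : R -> {linear H -> H})
    (f : hpath -> R) : Prop :=
  let D := hatLambda T 0 in
  let D' := D `&` [set g | ptime g < T] in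
  [/\ pcont T e D f,
      forall g, D g -> exists B, is_dx ip f g B,
      forall g, D' g -> cvg (dt_quotient f g l @[l --> 0^'+]),
      pcont T e D (dx ip f)
    & pcont T e D' (dt f)].

(** ** Test functionals *)

(* An element of Phi is given by an extension to \hat\Lambda: the functional
   and its derivatives on \Lambda are the restrictions of those of the
   extension. *)
Definition Phi (ip : {dot H for idfun}) (A : operator H) (T : R)
    (e : R -> {linear H -> H}) : set (hpath -> R) :=
  [set f | [/\ C1 ip T e f,
               forall g, Lambda T 0 g -> odom (adjoint ip A) (dx ip f g)
             & pcont T e (Lambda T 0)
                 (fun g => oval (adjoint ip A) (dx ip f g))]].

Definition Sfun (g : hpath) : R :=
  if pnorm g != 0
  then (pnorm g ^+ 2 - `|g (ptime g)| ^+ 2) ^+ 2 / pnorm g ^+ 2 else 0.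

Definition Upsilon2 (g : hpath) : R := Sfun g + 2 * `|g (ptime g)| ^+ 2.

(* Partial derivatives of h on [0, T] x R, the first one being one-sided at
   the end points of [0, T]. *)
Definition partial1_quotient (h : R -> R -> R) (s x s' : R) : R :=
  (h s' x - h s x) / (s' - s).

Definition partial1 (T : R) (h : R -> R -> R) (s x : R) : R :=
  lim (partial1_quotient h s x s' @[s' --> within `[0, T] s^']).

Definition partial2 (h : R -> R -> R) (s x : R) : R := derive1 (h s) x.

Definition C1_strip (T : R) (h : R -> R -> R) : Prop :=
  let D := [set p : R * R | 0 <= p.1 <= T] in
  [/\ {within D, continuous (fun p : R * R => h p.1 p.2)},
      forall s x, 0 <= s <= T ->
        cvg (partial1_quotient h s x s' @[s' --> within `[0, T] s^']),
      forall s x, 0 <= s <= T -> derivable (h s) x 1,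
      {within D, continuous (fun p : R * R => partial1 T h p.1 p.2)}
    & {within D, continuous (fun p : R * R => partial2 h p.1 p.2)}].

(* The data (h, (delta_i), (\gamma^i)) of a representation of an element of
   G_t; t_i is ptime (gpath i). *)
Record Grep := MkGrep
  { gh : R -> R -> R ; gdelta : nat -> R ; gpath : nat -> hpath }.

Definition gshift (e : R -> {linear H -> H}) (r : Grep) (g : hpath) (i : nat) :=
  sub_path g (flow_path e (gpath r i) (ptime g)).

Definition in_G (T : R) (e : R -> {linear H -> H}) (t : R) (g : hpath -> R)
    (r : Grep) : Prop :=
  [/\ pcont T e (Lambda T t) g,
      C1_strip T (gh r),
      forall s x, 0 <= s <= T -> 0 <= partial2 (gh r) s x,
      exists2 N : R, 0 < N &
        [/\ forall i, 0 < gdelta r i,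
            forall i, Lambda T 0 (gpath r i) /\ ptime (gpath r i) <= t,
            forall i, pnorm (gpath r i) <= N
          & (\sum_(0 <= i <oo) (gdelta r i)%:E <= N%:E)%E]
    & forall k, Lambda T t k ->
        series (fun i => gdelta r i * (Upsilon2 (gshift e r k i)
                           + `|ptime k - ptime (gpath r i)| ^+ 2)) n
          @[n --> \oo] --> g k - gh r (ptime k) (Upsilon2 k)].

Definition dtG (T : R) (r : Grep) (k : hpath) : R :=
  partial1 T (gh r) (ptime k) (Upsilon2 k)
  + 2 * limn (series (fun i => gdelta r i * (ptime k - ptime (gpath r i)))).

Definition dxG (ip : {dot H for idfun}) (e : R -> {linear H -> H}) (r : Grep)
    (k : hpath) : H :=
  partial2 (gh r) (ptime k) (Upsilon2 k) *: dx ip Upsilon2 k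
  + limn (series (fun i => gdelta r i *: dx ip Upsilon2 (gshift e r k i))).

End Paths.

(** * The control problem *)

Section Control.
Context (R : realType) (H : completeNormedModType R) (ip : {dot H for idfun}).
Context (T : R) (A : operator H) (e : R -> {linear H -> H}).
Context (U : metricType R).
Context (F : hpath H -> U -> H) (q : hpath H -> U -> R) (phi : hpath H -> R).

Definition hyp_b : Prop :=
  forall g, Lambda T 0 g -> continuous (F g) /\ continuous (q g).

Definition hyp_c : Prop :=
  let LambdaT := Lambda T T in
  exists2 L : R, 0 < L &
    (forall g k u, Lambda T 0 g -> Lambda T 0 k ->
       [/\ `|F g u| ^+ 2 <= L ^+ 2 * (1 + pnorm g ^+ 2),
           `|F g u - F k u| <= L * dinf T e g k,
           `|q g u - q k u| <= L * dinf T e g k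
         & `|q g u| <= L * (1 + pnorm g)]) /\
    (forall g k, LambdaT g -> LambdaT k ->
       `|phi g - phi k| <= L * pnorm (sub_path g k) /\
       `|phi g| <= L * (1 + pnorm g)).

(* Measurable controls [t, T] -> U, for the Borel sigma-algebras; the values
   outside [t, T] are irrelevant. *)
Definition controls (t : R) : set (R -> U) :=
  [set u | forall B : set U, <<s open >> B -> measurable (`[t, T] `&` u @^-1` B)].

Definition is_mild (g : hpath H) (u : R -> U) (X : R -> H) : Prop :=
  let t := ptime g in
  [/\ {within `[0, T], continuous X},
      forall s, 0 <= s < t -> X s = g s,
      forall s, t <= s <= T ->
        is_bochner `[t, s]
          (fun r => e (s - r) (F (restrict_path r X) (u r)))
          (X s - e (s - t) (g t))
    & forall s, ~~ ((0 <= s) && (s <= T)) -> X s = 0].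

Definition mild (g : hpath H) (u : R -> U) : R -> H :=
  xget (fun=> 0) [set X | is_mild g u X].

Definition cost (g : hpath H) (u : R -> U) : R :=
  \int[lebesgue_measure]_(r in `[ptime g, T])
     q (restrict_path r (mild g u)) (u r)
  + phi (restrict_path T (mild g u)).

Definition value (g : hpath H) : R :=
  inf [set cost g u | u in controls (ptime g)].

Definition Hamiltonian (g : hpath H) (p : H) : R :=
  inf [set ip p (F g u) + q g u | u in [set: U]].

Definition viscosity_subsolution (w : hpath H -> R) : Prop :=
  [/\ pcont T e (Lambda T 0) w,
      forall g, Lambda T T g -> w g <= phi g
    & forall f g r k, Phi ip A T e f -> Lambda T 0 k -> ptime k < T ->
        in_G T e (ptime k) g r ->
        w k - f k - g k = 0 ->
        ereal_sup [set (w k' - f k' - g k')%:E | k' in Lambda T (ptime k)] = 0%E ->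
        0 <= dt f k + dtG T r k
             + ip (oval (adjoint ip A) (dx ip f k)) (k (ptime k))
             + Hamiltonian k (dx ip f k + dxG ip e r k)].

Definition viscosity_supersolution (w : hpath H -> R) : Prop :=
  [/\ pcont T e (Lambda T 0) w,
      forall g, Lambda T T g -> phi g <= w g
    & forall f g r k, Phi ip A T e f -> Lambda T 0 k -> ptime k < T ->
        in_G T e (ptime k) g r ->
        w k + f k + g k = 0 ->
        ereal_inf [set (w k' + f k' + g k')%:E | k' in Lambda T (ptime k)] = 0%E ->
        - dt f k - dtG T r k
        - ip (oval (adjoint ip A) (dx ip f k)) (k (ptime k))
        + Hamiltonian k (- dx ip f k - dxG ip e r k) <= 0].

Definition viscosity_solution (w : hpath H -> R) : Prop :=
  viscosity_subsolution w /\ viscosity_supersolution w.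

End Control.

(* Main.v *)
Require Import Defs.
From HB Require Import structures.
From mathcomp Require Import all_boot all_order all_algebra.
From mathcomp Require Import all_classical all_reals all_analysis.
From mathcomp Require Import measurable_realfun.
From mathcomp Require Import ring lra.

Set Implicit Arguments.
Unset Strict Implicit.
Unset Printing Implicit Defensive.

Import Order.TTheory GRing.Theory Num.Theory.
Import numFieldNormedType.Exports.

Local Open Scope classical_set_scope.
Local Open Scope ring_scope.

(** Everything reduces to the behaviour of the test functionals along the mild
trajectories issued from a contact point [k], whose final time is [t].  For a
constant control [w], dynamic programming ([dpp_le]) bounds [V k] by the reward
over [[t, t + d]] plus the value of the trajectory at time [t + d]; replacing the
value by the test pair [f + g], which touches it from above at [k], gives
[0 <= \int q + (f + g)(X_(t+d)) - (f + g)(k)].  Dividing by [d] yields the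
subsolution inequality for every [w], hence for the infimum over [w].  For the
supersolution, [dpp_ge] provides a control which is optimal up to [eps * d]; it
depends on [d], so all estimates have to be uniform over the controls.  They are:
[F] and [q] are Lipschitz in the path uniformly in the control, and they may be
frozen at [k] with an error independent of the control ([integrand_near]).

What remains is to expand [f] and [g] along a curve
[X b = e (b - a) (X a) + \int_a^b e (b - r) (G r) dr] with [|G| <= C], uniformly
over all such curves (the class [flow_driven]).  Both signs of the viscosity
inequality only ask for upper bounds of the increment of [g].

- [test_functional_increment].  The derivatives of [f] only control the effect of
  stopping a path and of making its last value jump, and [X] is in general not
  differentiable.  So [X] is replaced by polygons with vertices on [X]; along a
  Lipschitz curve an Euler scheme that stops and jumps alternately shows that [f]
  has the right derivative expected from the chain rule ([lipschitz_derivative]).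
  A chord of the polygon is [(e D - 1) (X a)] plus a Bochner integral; its first
  part is paired with [dx f] at the current path, which lies in the domain of the
  adjoint, and so becomes [A^* dx f] paired with [\int_0^D e r (X a) dr]
  ([adjoint_orbit]).  The errors are proportional to the length of the time
  interval, with a factor independent of the mesh, which is then refined
  ([polygon_increment]).

- [gauge_increment].  In terms of [m = ||X||_0^2] and [a = |X t|^2] the functional
  [Upsilon^2] is [m + a^2 / m], nondecreasing in both variables for [0 <= a <= m].
  By contractivity [a] grows at most like [2 \int (X t, G)]: the semigroup only
  helps, and [A] is never applied to a value of the path ([Upsilon2_increment]).  The paths
  [X - gamma^i_(.,A)] are driven by the same [G], so the same bound holds for each
  term of the series; finitely many terms are expanded precisely, and the tail is
  controlled by a Lipschitz bound ([Upsilon2_lipschitz]).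

An estimate uniform in [G] appears at several places: for a fixed vector [p],
[(p, (e s - 1) v)] is small compared with [|v|] as [s] tends to [0], uniformly in
[v] ([semigroup_weak_uniform]).  This is strong continuity of the adjoint
semigroup, derived from contractivity.

The state equation is solved by Picard iteration in the norm weighted by
[expR (2 L s)], for which the integral term is a contraction of ratio [1 / 2]; the
same weight gives the growth and stability bounds. *)

(** * Inner product and integrals of bounded measurable functions *)

Section InnerProduct.
Context (R : realType) (H : completeNormedModType R) (ip : {dot H for idfun}).
Hypothesis Hip : inner_product_of_norm ip.
Implicit Types x y z h : H.

Lemma ipC x y : ip x y = ip y x.
Proof. by rewrite hermC expr0 mul1r. Qed.

Lemma ipDl x y z : ip (x + y) z = ip x z + ip y z.
Proof. exact: linearDl. Qed.

Lemma ipBl x y z : ip (x - y) z = ip x z - ip y z.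
Proof. exact: linearBl. Qed.

Lemma ipZl (a : R) x z : ip (a *: x) z = a * ip x z.
Proof. exact: linearZl_LR. Qed.

Lemma ipNl x z : ip (- x) z = - ip x z.
Proof. exact: linearNl. Qed.

Lemma ip0l z : ip 0 z = 0.
Proof. exact: linear0l. Qed.

Lemma ipDr x y z : ip z (x + y) = ip z x + ip z y.
Proof. by rewrite ipC ipDl !(ipC z). Qed.

Lemma ipBr x y z : ip z (x - y) = ip z x - ip z y.
Proof. by rewrite ipC ipBl !(ipC z). Qed.

Lemma ipZr (a : R) x z : ip z (a *: x) = a * ip z x.
Proof. by rewrite ipC ipZl (ipC z). Qed.

Lemma ipNr x z : ip z (- x) = - ip z x.
Proof. by rewrite ipC ipNl (ipC z). Qed.

Lemma ip0r z : ip z 0 = 0.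
Proof. by rewrite ipC ip0l. Qed.

Lemma normD2 x y : `|x + y| ^+ 2 = `|x| ^+ 2 + 2 * ip x y + `|y| ^+ 2.
Proof. by rewrite -!Hip ipDl !ipDr (ipC y x); ring. Qed.

Lemma normB2 x y : `|x - y| ^+ 2 = `|x| ^+ 2 - 2 * ip x y + `|y| ^+ 2.
Proof. by rewrite normD2 ipNr normrN; ring. Qed.

Lemma ip_le x y : ip x y <= `|x| * `|y|.
Proof.
have h : `|x + y| ^+ 2 <= (`|x| + `|y|) ^+ 2.
  by rewrite ler_sqr ?nnegrE ?addr_ge0// ler_normD.
rewrite normD2 in h.
have : (`|x| + `|y|) ^+ 2 = `|x| ^+ 2 + 2 * (`|x| * `|y|) + `|y| ^+ 2 by ring.
by move=> e; rewrite e in h; lra.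
Qed.

Lemma norm_ip_le x y : `|ip x y| <= `|x| * `|y|.
Proof.
rewrite ler_norml ip_le andbT.
by have := ip_le (- x) y; rewrite ipNl normrN; lra.
Qed.

Lemma ip_inj x y : (forall h, ip x h = ip y h) -> x = y.
Proof.
move=> xy; apply/eqP; rewrite -subr_eq0 -normr_eq0 -sqrf_eq0.
by rewrite -Hip ipBl xy subrr.
Qed.

Lemma norm_le_ip x (c : R) : 0 <= c -> (forall h, ip x h <= c * `|h|) -> `|x| <= c.
Proof.
move=> c0 /(_ x); rewrite Hip expr2.
have [->//|x0] := eqVneq (`|x|) 0.
by rewrite ler_pM2r// lt_def x0 normr_ge0.
Qed.

End InnerProduct.

Section RealIntegral.
Context (R : realType).
Notation mu := (@lebesgue_measure R).
Implicit Types (f g : R -> R) (a b c C : R).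

(** Bounded measurable functions are all that occurs under an integral sign
    below; the class is closed under products, which integrability is not. *)
Definition bmeas a b f :=
  measurable_fun `[a, b] f /\ exists C, forall x, a <= x <= b -> `|f x| <= C.

Fact rint_key : unit. Proof. exact: tt. Qed.

(** Sealed, since conversion would otherwise unfold the Lebesgue integral
    whenever two integrals are compared. *)
Definition rint := locked_with rint_key
  (fun a b f => \int[mu]_(x in `[a, b]) f x : R).

Lemma rintE a b f : rint a b f = \int[mu]_(x in `[a, b]) f x.
Proof. by rewrite /rint locked_withE. Qed.

Lemma fin_itv a b : (mu `[a, b] < +oo)%E.
Proof. by rewrite lebesgue_measure_itv/=; case: ifP => // _; rewrite -EFinB ltry. Qed.

Lemma mu_itv a b : a <= b -> fine (mu `[a, b]) = b - a.
Proof.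
move=> ab; rewrite lebesgue_measure_itv/= lte_fin.
case: ltP => h; first by rewrite -EFinB.
by have -> : b = a; [apply/le_anti; rewrite ab h|rewrite subrr].
Qed.

Lemma bmeas_int a b f : bmeas a b f -> mu.-integrable `[a, b] (EFin \o f).
Proof.
move=> [mf [C fC]]; apply: measurable_bounded_integrable => //; first exact: fin_itv.
exists C; split; first exact: num_real.
by move=> M CM x /= /[!in_itv]/= abx; apply: (le_trans (fC _ abx)); exact: ltW.
Qed.

Lemma bmeas_sub a b c d f : a <= c -> d <= b -> bmeas a b f -> bmeas c d f.
Proof.
move=> ac db [mf [C fC]]; split.
  apply: (measurable_funS _ _ mf) => //.
  by move=> x /=; rewrite !in_itv/= => /andP[cx xd]; rewrite (le_trans ac)//= (le_trans _ db).
by exists C => x /andP[cx xd]; apply: fC; rewrite (le_trans ac)//= (le_trans _ db).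
Qed.

Lemma bmeas_cst a b c : bmeas a b (fun=> c).
Proof. by split; [exact: measurable_cst|exists `|c|]. Qed.

Lemma bmeasD a b f g : bmeas a b f -> bmeas a b g -> bmeas a b (fun x => f x + g x).
Proof.
move=> [mf [C fC]] [mg [D gD]]; split; first exact: measurable_funD.
by exists (C + D) => x abx; rewrite (le_trans (ler_normD _ _))// lerD// ?fC ?gD.
Qed.

Lemma bmeasM a b f g : bmeas a b f -> bmeas a b g -> bmeas a b (fun x => f x * g x).
Proof.
move=> [mf [C fC]] [mg [D gD]]; split; first exact: measurable_funM.
by exists (C * D) => x abx; rewrite normrM ler_pM// ?fC ?gD.
Qed.

Lemma bmeasZ a b f c : bmeas a b f -> bmeas a b (fun x => c * f x).
Proof. by move=> ?; apply: bmeasM => //; exact: bmeas_cst. Qed.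

Lemma bmeasB a b f g : bmeas a b f -> bmeas a b g -> bmeas a b (fun x => f x - g x).
Proof.
move=> hf /(bmeasZ (-1)) hg.
have := bmeasD hf hg; congr bmeas.
by apply/funext => x; rewrite mulN1r.
Qed.

Lemma bmeas_norm a b f : bmeas a b f -> bmeas a b (fun x => `|f x|).
Proof.
move=> [mf [C fC]]; split; first exact: measurableT_comp.
by exists C => x abx; rewrite normr_id fC.
Qed.

Lemma rintD a b f g : bmeas a b f -> bmeas a b g ->
  rint a b (fun x => f x + g x) = rint a b f + rint a b g.
Proof. by move=> hf hg; rewrite !rintE RintegralD//; exact: bmeas_int. Qed.

Lemma rintB a b f g : bmeas a b f -> bmeas a b g ->
  rint a b (fun x => f x - g x) = rint a b f - rint a b g.
Proof. by move=> hf hg; rewrite !rintE RintegralB//; exact: bmeas_int. Qed.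

Lemma rintZ a b f c : bmeas a b f -> rint a b (fun x => c * f x) = c * rint a b f.
Proof. by move=> hf; rewrite !rintE RintegralZl//; exact: bmeas_int. Qed.

Lemma rint_cst a b c : a <= b -> rint a b (fun=> c) = c * (b - a).
Proof. by move=> ab; rewrite !rintE Rintegral_cst// mu_itv. Qed.

Lemma eq_rint a b f g : (forall x, a <= x <= b -> f x = g x) -> rint a b f = rint a b g.
Proof. by move=> fg; rewrite !rintE; apply: eq_Rintegral => x; rewrite inE/= in_itv/=; exact: fg. Qed.

Lemma eq_bmeas a b f g : (forall x, a <= x <= b -> f x = g x) -> bmeas a b f -> bmeas a b g.
Proof.
move=> fg [mf [C fC]]; split.
  apply: eq_measurable_fun mf => x; rewrite inE/= in_itv/=; exact: fg.
by exists C => x abx; rewrite -fg// fC.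
Qed.

Lemma le_rint a b f g : bmeas a b f -> bmeas a b g ->
  (forall x, a <= x <= b -> f x <= g x) -> rint a b f <= rint a b g.
Proof.
move=> hf hg fg; rewrite !rintE; apply: le_Rintegral => //; exact: bmeas_int.
Qed.

Lemma rint_le a b f C : a <= b -> bmeas a b f ->
  (forall x, a <= x <= b -> f x <= C) -> rint a b f <= C * (b - a).
Proof. by move=> ab hf fC; rewrite -rint_cst//; apply: le_rint => //; exact: bmeas_cst. Qed.

Lemma rint_ge a b f C : a <= b -> bmeas a b f ->
  (forall x, a <= x <= b -> C <= f x) -> C * (b - a) <= rint a b f.
Proof. by move=> ab hf fC; rewrite -rint_cst//; apply: le_rint => //; exact: bmeas_cst. Qed.

Lemma norm_rint_le a b f C : a <= b -> bmeas a b f ->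
  (forall x, a <= x <= b -> `|f x| <= C) -> `|rint a b f| <= C * (b - a).
Proof.
move=> ab hf fC; rewrite ler_norml -mulNr rint_ge ?rint_le// => x /fC;
  by rewrite ler_norml => /andP[].
Qed.

Lemma norm_rint a b f : bmeas a b f -> `|rint a b f| <= rint a b (fun x => `|f x|).
Proof. by move=> hf; rewrite !rintE; apply: le_normr_Rintegral => //; exact: bmeas_int. Qed.

Lemma rint_split b a c f : a <= b <= c -> bmeas a c f ->
  rint a c f = rint a b f + rint b c f.
Proof.
move=> /andP[ab bc] hf.
have := @Rintegral_itvB R f (BLeft a) (BRight c) b.
rewrite !rintE => /(_ (bmeas_int hf)); rewrite !bnd_simp => /(_ ab bc) => h.
rewrite -[X in _ + X]Rintegral_itv_obnd_cbnd; first by rewrite -h addrC subrK.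
apply: integrableS (bmeas_int hf) => //.
by move=> x /=; rewrite !in_itv/= => /andP[/ltW bx ->]; rewrite (le_trans ab).
Qed.

Lemma rintaa a f : rint a a f = 0.
Proof. by rewrite !rintE set_itv1 Rintegral_set1. Qed.

(** A left-continuous dependence on the first variable makes the diagonal
    measurable: for each [x] the first variable is sampled at the point of a
    uniform grid just before [x], and the diagonal is the limit of these
    countably piecewise functions.  This gives the measurability of [r |-> q
    (X_r) (u r)], where the path argument also moves. *)
Lemma measurable_diagonal a b (g : R -> R -> R) :
  (forall c, a <= c <= b -> measurable_fun `[a, b] (g c)) ->
  (forall x, a <= x <= b -> forall eps : R, 0 < eps -> exists2 del : R, 0 < del &
     forall c, a <= c <= x -> x - c < del -> `|g c x - g x x| < eps) ->
  measurable_fun `[a, b] (fun x => g x x).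
Proof.
move=> mg cg.
have [ab|ba] := leP a b; last first.
  rewrite set_itv_ge; last by rewrite bnd_simp -ltNge.
  exact: measurable_fun_set0.
pose J n x := Num.truncn ((x - a) * n.+1%:R).
pose node n k : R := a + k%:R / n.+1%:R.
have nodeP n x : a <= x <= b -> a <= node n (J n x) <= x /\ x - node n (J n x) < n.+1%:R^-1.
  move=> /andP[ax xb].
  have n0 : 0 < n.+1%:R :> R by [].
  have : 0 <= (x - a) * n.+1%:R by rewrite mulr_ge0// subr_ge0.
  move=> /truncn_itv; rewrite -/(J n x) => /andP[h1 h2].
  have k1 : (J n x)%:R / n.+1%:R <= x - a by rewrite ler_pdivrMr.
  have k2 : x - a < ((J n x)%:R + 1) / n.+1%:R.
    by rewrite ltr_pdivlMr// natr1.
  rewrite mulrDl mul1r in k2.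
  have k3 : 0 <= (J n x)%:R / n.+1%:R :> R by rewrite divr_ge0.
  rewrite /node; move: k1 k2 k3.
  move: (n.+1%:R^-1) ((J n x)%:R / n.+1%:R) => w p k1 k2 k3; split; last lra.
  by apply/andP; split; lra.
apply: (@measurable_fun_cvg _ _ _ _ (fun n x => g (node n (J n x)) x)); last first.
  move=> x /=; rewrite in_itv/= => abx.
  apply/cvgrPdist_lt => eps eps0; have [d d0 hd] := cg x abx eps eps0.
  near=> n.
  have [h1 h2] := nodeP n x abx.
  rewrite distrC; apply: hd => //; apply: (lt_trans h2).
  rewrite invf_plt ?posrE//.
  apply: (@lt_le_trans _ _ n%:R); last by rewrite ler_nat.
  near: n; exact: nbhs_infty_gtr.
move=> n.
have -> : `[a, b]%classic = \bigcup_k (`[a, b] `&` [set x | J n x = k]).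
  apply/seteqP; split => x /=; last by move=> [k _ []].
  by move=> h; exists (J n x).
have mJ k : measurable (`[a, b] `&` [set x | J n x = k]).
  have -> : `[a, b] `&` [set x | J n x = k] = `[a, b] `&` `[node n k, node n k.+1[%classic.
    apply/seteqP; split => x /=; rewrite !in_itv/= => -[/[dup] abx -> h]; split => //.
      have /andP[ax xb] := abx; have n0 : 0 < n.+1%:R :> R by [].
      have : 0 <= (x - a) * n.+1%:R by rewrite mulr_ge0// subr_ge0.
      move=> /truncn_itv; rewrite -/(J n x) h => /andP[h1 h2].
      by rewrite /node -lerBrDl ler_pdivrMr// h1/= -ltrBlDl ltr_pdivlMr.
    move: h; rewrite /node -lerBrDl ler_pdivrMr// -ltrBlDl ltr_pdivlMr//.
    by move=> h; rewrite /J; apply/eqP; rewrite truncn_eq//; case/andP: abx => *; rewrite mulr_ge0// subr_ge0.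
  by apply: measurableI.
apply/measurable_fun_bigcup => // k.
have [knode|knode] := boolP (a <= node n k <= b).
  apply: (@eq_measurable_fun _ _ _ _ _ (g (node n k))).
    by move=> x; rewrite inE/= => -[_ ->].
  apply: measurable_funS (mg _ knode) => //.
have -> : `[a, b] `&` [set x | J n x = k] = set0.
  rewrite -subset0 => x [/=]; rewrite in_itv/= => abx Jk.
  have [] := nodeP n x abx; rewrite Jk => /andP[h1 h2] _.
  case/negP: knode; rewrite h1/=; apply: (le_trans h2); by case/andP: abx.
exact: measurable_fun_set0.
Unshelve. all: by end_near.
Qed.

End RealIntegral.

(** * Bochner integrals of bounded strongly measurable functions *)

Lemma cauchy_seq_cvg (R : realType) (H : completeNormedModType R) (u : nat -> H) :
  (forall eps : R, 0 < eps -> exists N, forall m n, (N <= m)%N -> (N <= n)%N ->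
     `|u m - u n| < eps) ->
  exists v : H, u n @[n --> \oo] --> v.
Proof.
move=> hu; suff : cvg (u n @[n --> \oo]) by move=> /cvg_ex.
apply/cauchy_cvgP/cauchy_ballP => e e0.
have [N hN] := hu e e0.
exists (u @` [set n | (N <= n)%N], u @` [set n | (N <= n)%N]).
  by split; exists N => // n /= hn; exists n.
by move=> [x y] [/= [m hm <-] [n hn <-]]; rewrite -ball_normE/=; apply: hN.
Qed.

Lemma cvgn_eps (R : realType) (V : normedModType R) (u : nat -> V) (v : V) :
  u n @[n --> \oo] --> v ->
  forall eps : R, 0 < eps -> exists N, forall n, (N <= n)%N -> `|u n - v| < eps.
Proof.
move=> /cvgrPdist_lt uv e e0; have [N _ hN] := uv e e0.
by exists N => n /hN; rewrite distrC.
Qed.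

Section Bochner.
Context (R : realType) (H : completeNormedModType R) (ip : {dot H for idfun}).
Hypothesis Hip : inner_product_of_norm ip.
Hypothesis Hsep : separable_space H.
Notation mu := (@lebesgue_measure R).
Implicit Types (a b C : R) (f g : R -> H).

(** In a separable space, measurability of all the distances to fixed vectors is
    strong measurability; unlike the latter it is stated by real functions only. *)
Definition smeas (D : set R) f := forall h : H, measurable_fun D (fun x => `|f x - h|).

Definition vmeas a b f :=
  smeas `[a, b] f /\ exists C, forall x, a <= x <= b -> `|f x| <= C.

(** The sequence starts at [0], so that the nearest point among its first terms
    is never farther than the norm. *)
Lemma dense_sequence : exists d : nat -> H, d 0%N = 0 /\
  forall x eps, 0 < eps -> exists k, `|x - d k| < eps.
Proof.
have [D /countable_injP[j ij] dD] := Hsep.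
pose d k := if k is k'.+1 then xget 0 [set x | D x /\ j x = k'] else 0.
exists d; split=> // x eps eps0.
have [y [xy Dy]] : ball x eps `&` D !=set0.
  by apply: dD; [exists x; exact: ballxx|exact: ball_open].
exists (j y).+1 => /=.
have -> : xget 0 [set x | D x /\ j x = j y] = y.
  case: xgetP => [z _ [Dz jz]|/(_ y)/=]; last by case.
  by apply: ij => //; rewrite inE.
by move: xy; rewrite -ball_normE.
Qed.

Lemma bmeas_dist a b f h : vmeas a b f -> bmeas a b (fun x => `|f x - h|).
Proof.
move=> [mf [C fC]]; split; first exact: mf.
exists (C + `|h|) => x abx; rewrite normr_id (le_trans (ler_normB _ _))// lerD2r fC//.
Qed.

(** Polarization expresses the inner product by distances. *)
Lemma bmeas_ip a b f h : vmeas a b f -> bmeas a b (fun x => ip (f x) h).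
Proof.
move=> hf; have h0 := bmeas_dist 0 hf; have h1 := bmeas_dist h hf.
have hm := bmeasZ (2^-1) (bmeasB (bmeasD (bmeasM h0 h0) (bmeas_cst a b (`|h| ^+ 2))) (bmeasM h1 h1)).
apply: eq_bmeas hm => x _; rewrite subr0 -!expr2 (normB2 Hip); by field.
Qed.

Lemma bmeas_normv a b f : vmeas a b f -> bmeas a b (fun x => `|f x|).
Proof. by move=> /(bmeas_dist 0); under eq_fun do rewrite subr0. Qed.

Lemma eq_vmeas a b f g : (forall x, a <= x <= b -> f x = g x) -> vmeas a b f -> vmeas a b g.
Proof.
move=> fg [mf [C fC]]; split.
  move=> h; apply: eq_measurable_fun (mf h) => x; rewrite inE/= in_itv/= => /fg ->//.
by exists C => x abx; rewrite -fg// fC.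
Qed.

Lemma vmeas_sub a b c d f : a <= c -> d <= b -> vmeas a b f -> vmeas c d f.
Proof.
move=> ac db hf; split.
  by move=> h; have [] := bmeas_sub ac db (bmeas_dist h hf).
have [_ [C fC]] := bmeas_sub ac db (bmeas_normv hf).
by exists C => x /fC; rewrite normr_id.
Qed.

Lemma smeas_step (D : set R) f n (E : nat -> set R) (c : nat -> H) :
  (forall k, measurable (E k)) -> smeas D f -> smeas D (fun x => f x - step n E c x).
Proof.
move=> mE mf; elim: n => [|n IH] h.
  by under eq_fun do rewrite /step big_ord0 subr0; exact: mf.
have -> : (fun x => `|f x - step n.+1 E c x - h|) =
   (fun x => \1_(E n) x * `|f x - step n E c x - (h + c n)|) \+
   (fun x => (1 - \1_(E n) x) * `|f x - step n E c x - h|).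
  apply/funext => x /=; rewrite {1}/step big_ord_recr/= -/(step n E c x) indicE.
  case: (x \in E n) => /=.
    by rewrite scale1r subrr mul0r addr0 mul1r; congr `|_|; rewrite !opprD !addrA [LHS]addrAC.
  by rewrite scale0r addr0 mul0r add0r subr0 mul1r.
apply: measurable_funD; apply: measurable_funM.
- exact: measurable_indic.
- exact: IH.
- by apply: measurable_funB; [exact: measurable_cst|exact: measurable_indic].
- exact: IH.
Qed.

Lemma step_bounded n (E : nat -> set R) (c : nat -> H) x :
  `|step n E c x| <= \sum_(k < n) `|c k|.
Proof.
rewrite /step (le_trans (ler_norm_sum _ _ _))// ler_sum// => k _.
rewrite normrZ indicE; case: (_ \in _); rewrite ?normr1 ?mul1r// normr0 mul0r//.
Qed.

Lemma bmeas_step_dist a b f n (E : nat -> set R) (c : nat -> H) :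
  (forall k, measurable (E k)) -> vmeas a b f ->
  bmeas a b (fun x => `|f x - step n E c x|).
Proof.
move=> mE [mf [C fC]]; split.
  by apply: eq_measurable_fun (smeas_step n c mE mf 0) => x _; rewrite subr0.
exists (C + \sum_(k < n) `|c k|) => x abx; rewrite normr_id (le_trans (ler_normB _ _))//.
by rewrite lerD ?fC// step_bounded.
Qed.

Lemma rint_step a b n (E : nat -> set R) (c : nat -> H) h :
  (forall k, measurable (E k)) -> (forall k, E k `<=` `[a, b]) ->
  bmeas a b (fun x => ip (step n E c x) h) /\
  rint a b (fun x => ip (step n E c x) h) = ip (step_integral n E c) h.
Proof.
move=> mE ED; elim: n => [|n [IHm IH]].
  rewrite /step_integral big_ord0 ip0l; split.
    apply: eq_bmeas (bmeas_cst a b 0) => x _.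
    by rewrite /step big_ord0 ip0l.
  rewrite (@eq_rint _ _ _ _ (fun=> 0)); last by move=> x _; rewrite /step big_ord0 ip0l.
  by rewrite rintE Rintegral_cst// mul0r.
have eqs x : ip (step n E c x) h + ip (c n) h * \1_(E n) x = ip (step n.+1 E c x) h.
  by rewrite [in RHS]/step big_ord_recr/= ipDl ipZl mulrC.
have mi : bmeas a b (\1_(E n) : R -> R).
  split; first exact: measurable_indic.
  by exists 1 => x _; rewrite indicE; case: (_ \in _); rewrite ?normr1 ?normr0.
have mz := bmeasZ (ip (c n) h) mi.
split; first by apply: eq_bmeas (bmeasD IHm mz) => x _.
rewrite -(@eq_rint _ _ _ (fun x => ip (step n E c x) h + ip (c n) h * \1_(E n) x)); last by [].
rewrite rintD// IH rintZ// /step_integral big_ord_recr/= ipDl ipZl mulrC.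
congr (_ + _ * _); rewrite rintE /Rintegral integral_indic ?setIidl//; exact: mE.
Qed.

(** Tested against [h], so that no vector-valued integral is needed before
    existence is known. *)
Lemma step_integral_approx a b f n (E : nat -> set R) (c : nat -> H) h :
  (forall k, measurable (E k)) -> (forall k, E k `<=` `[a, b]) -> vmeas a b f ->
  `|ip (step_integral n E c) h - rint a b (fun x => ip (f x) h)|
    <= `|h| * rint a b (fun x => `|f x - step n E c x|).
Proof.
move=> mE ED hf; have [ms <-] := rint_step n c h mE ED.
have mfh := bmeas_ip h hf.
rewrite -rintB// (le_trans (norm_rint (bmeasB ms mfh)))//.
have md := bmeas_step_dist n c mE hf.
rewrite -rintZ//; apply: le_rint.
- exact/bmeas_norm/bmeasB.
- exact: bmeasZ.
by move=> x _; rewrite -ipBl (le_trans (norm_ip_le Hip _ _))// mulrC distrC.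
Qed.

(** On [E m k] the value is the nearest among the first [m + 1] terms of a dense
    sequence, with ties resolved by the least index, so that the sets are
    disjoint. *)
Lemma simple_approximation a b f : vmeas a b f ->
  exists (E : nat -> nat -> set R) (c : nat -> nat -> H),
    [/\ forall m k, [/\ measurable (E m k), E m k `<=` `[a, b]
                      & (mu (E m k) < +oo)%E],
      forall m x, a <= x <= b -> `|f x - step m.+1 (E m) (c m) x| <= `|f x|
    & forall x, a <= x <= b -> forall eps : R, 0 < eps -> exists N, forall m, (N <= m)%N ->
        `|f x - step m.+1 (E m) (c m) x| < eps].
Proof.
move=> [mf [C fC]]; have [d [d0 dd]] := dense_sequence.
pose P m k j x := (j <= m)%N ->
  (`|f x - d k| <= `|f x - d j|) /\ ((j < k)%N -> `|f x - d k| < `|f x - d j|).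
pose E m k := \bigcap_j (`[a, b] `&` [set x | P m k j x]).
have mle i j : measurable (`[a, b] `&` [set x | `|f x - d i| <= `|f x - d j|]).
  by apply: measurable_fun_le.
have mlt i j : measurable (`[a, b] `&` [set x | `|f x - d i| < `|f x - d j|]).
  have -> : `[a, b] `&` [set x | `|f x - d i| < `|f x - d j|] =
     `[a, b] `\` (`[a, b] `&` [set x | `|f x - d j| <= `|f x - d i|]).
    apply/seteqP; split => x /=.
      by move=> [-> h]; split=> // -[_]; rewrite leNgt h.
    by move=> [-> h]; split=> //; rewrite ltNge; apply/negP => h'; apply: h.
  by apply: measurableD.
have mE m k : measurable (E m k).
  apply: bigcapT_measurable => j; rewrite /P.
  have [jm|jm] := boolP (j <= m)%N; last first.
    rewrite (_ : _ `&` _ = `[a, b]%classic)//; apply/seteqP; split => x /=; first by case.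
    by move=> h; split.
  have [jk|jk] := boolP (j < k)%N.
    rewrite (_ : _ `&` _ = (`[a, b] `&` [set x | `|f x - d k| <= `|f x - d j|]) `&`
       (`[a, b] `&` [set x | `|f x - d k| < `|f x - d j|])).
      exact: measurableI.
    apply/seteqP; split => x /=.
      by move=> [h /(_ isT)[h1 /(_ isT) h2]].
    by move=> [[h h1] [_ h2]]; split.
  rewrite (_ : _ `&` _ = (`[a, b] `&` [set x | `|f x - d k| <= `|f x - d j|]))//.
  apply/seteqP; split => x /=.
    by move=> [h /(_ isT)[h1 _]].
  by move=> [h h1]; split.
have ED m k : E m k `<=` `[a, b] by move=> x /(_ 0%N I)[].
have stepE m x : a <= x <= b -> forall j, (j <= m)%N ->
    `|f x - step m.+1 (E m) d x| <= `|f x - d j|.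
  move=> abx.
  pose Q k := (k <= m)%N && [forall j : 'I_m.+1, `|f x - d k| <= `|f x - d j|].
  have [k0 /andP[k0m /forallP k0min] k0first] : exists2 k, Q k & forall j, Q j -> (k <= j)%N.
    have exQ : exists k, Q k.
      have [i _ hi] := @arg_minP _ _ 'I_m.+1 ord0 xpredT (fun i => `|f x - d i|) isT.
      exists i; rewrite /Q -ltnS ltn_ord/=; apply/forallP => j; exact: hi.
    by exists (ex_minn exQ); case: ex_minnP.
  have Ek0 : E m k0 x.
    move=> j _; split; first by rewrite /= in_itv.
    move=> jm; split; first exact: (k0min (Ordinal (jm : (j < m.+1)%N))).
    move=> jk; rewrite ltNge; apply/negP => h.
    suff /k0first : Q j by rewrite leqNgt jk.
    by rewrite /Q jm; apply/forallP => i; exact: le_trans h (k0min i).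
  have uniqk k : (k <= m)%N -> E m k x -> k = k0.
    move=> km Ek; apply/eqP; rewrite eqn_leq; apply/andP; split; rewrite leqNgt; apply/negP => h.
      have [_ /(_ k0m)[_ /(_ h) h1]] := Ek k0 I.
      have [_ /(_ km)[h2 _]] := Ek0 k I.
      by rewrite ltNge h2 in h1.
    have [_ /(_ k0m)[h2 _]] := Ek k0 I.
    have [_ /(_ km)[_ /(_ h) h1]] := Ek0 k I.
    by rewrite ltNge h2 in h1.
  have -> : step m.+1 (E m) d x = d k0.
    rewrite /step (bigD1 (Ordinal (k0m : (k0 < m.+1)%N)))//= indicE mem_set// scale1r.
    rewrite big1 ?addr0// => i ik; rewrite indicE; case: (boolP (x \in E m i)); last first.
      by rewrite scale0r.
    rewrite inE => /uniqk ie; case/eqP: ik; apply: val_inj => /=; apply: ie.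
    by rewrite -ltnS.
  move=> j jm; exact: (k0min (Ordinal (jm : (j < m.+1)%N))).
exists E, (fun _ => d); split.
- move=> m k; split => //.
  apply: le_lt_trans (fin_itv a b); apply: le_measure; rewrite ?inE//; first exact: mE.
- by move=> m x abx; have := stepE m x abx 0%N (leq0n _); rewrite d0 subr0.
- move=> x abx eps eps0; have [j hj] := dd (f x) eps eps0.
  exists j => m jm; exact: le_lt_trans (stepE m x abx j jm) hj.
Qed.

(** The integrals of the step functions form a Cauchy sequence by
    [step_integral_approx], the distance to [f] being dominated by [|f|]. *)
Lemma bochner_exists a b f : vmeas a b f -> exists v, is_bochner `[a, b] f v.
Proof.
move=> hf; have [E [c [hE hle hcv]]] := simple_approximation hf.
have mE m k : measurable (E m k) by case: (hE m k).
have ED m k : E m k `<=` `[a, b] by case: (hE m k).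
pose s m x := step m.+1 (E m) (c m) x.
have md m : bmeas a b (fun x => `|f x - s m x|) by apply: bmeas_step_dist.
have int0 : (\int[mu]_(x in `[a, b]) (`|f x - s m x|%:E))%E @[m --> \oo] --> 0%E.
  have [_ [C fC]] := hf.
  have [] := @dominated_convergence _ _ _ mu `[a, b] _
    (fun m x => (`|f x - s m x|)%:E) (fun=> 0%E) (fun x => C%:E).
  - exact: measurable_itv.
  - by move=> n; apply/measurable_EFinP; case: (md n).
  - exact: measurable_cst.
  - apply: aeW => x /= ; rewrite in_itv/= => abx.
    apply: cvg_EFin; first by near=> n.
    apply/cvgrPdist_lt => eps eps0; have [N hN] := hcv x abx eps eps0.
    near=> n; rewrite /= sub0r normrN normr_id; apply: hN.
    by near: n; exists N.
  - by apply: (bmeas_int (bmeas_cst a b C)).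
  - apply: aeW => x n /=; rewrite in_itv/= => abx; rewrite normr_id lee_fin.
    exact: le_trans (hle _ _ abx) (fC _ abx).
  by move=> _ _; rewrite integral0.
have rint0 : rint a b (fun x => `|f x - s m x|) @[m --> \oo] --> (0 : R).
  by under eq_fun do rewrite rintE; exact: (fine_cvg int0).
have [v hv] : exists v : H, step_integral m.+1 (E m) (c m) @[m --> \oo] --> v.
  apply: cauchy_seq_cvg => eps eps0.
  have [N hN] := cvgn_eps rint0 (divr_gt0 eps0 (ltr0Sn _ 2)).
  exists N => m n mN nN.
  apply: (@le_lt_trans _ _ (2 * (eps / 3))); last lra.
  apply: (norm_le_ip Hip); first by rewrite mulr_ge0// divr_ge0// ltW.
  move=> h; rewrite ipBl.
  have h1 := step_integral_approx m.+1 (c m) h (mE m) (ED m) hf.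
  have h2 := step_integral_approx n.+1 (c n) h (mE n) (ED n) hf.
  have e1 := hN _ mN; have e2 := hN _ nN.
  rewrite subr0 in e1; rewrite subr0 in e2.
  have {}h1 := le_trans h1 (ler_wpM2l (normr_ge0 h) (le_trans (ler_norm _) (ltW e1))).
  have {}h2 := le_trans h2 (ler_wpM2l (normr_ge0 h) (le_trans (ler_norm _) (ltW e2))).
  move: h1 h2; rewrite !ler_norml => /andP[h1 h1'] /andP[h2 h2']; lra.
exists v, (fun m => m.+1), E, c; split => //.
apply: aeW => x /=; rewrite in_itv/= => abx.
apply/cvgrPdist_lt => eps eps0; have [N hN] := hcv x abx eps eps0.
by near=> n; apply: hN; near: n; exists N.
Unshelve. all: by end_near.
Qed.

(** The properties of the Bochner integral, its uniqueness first, are read off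
    from this identity. *)
Lemma bochner_weak a b f v : vmeas a b f -> is_bochner `[a, b] f v ->
  forall h, ip v h = rint a b (fun x => ip (f x) h).
Proof.
move=> hf [n [E [c [hE _ int0 hv]]]] h.
have mE m k : measurable (E m k) by case: (hE m k).
have ED m k : E m k `<=` `[a, b] by case: (hE m k).
have rint0 : rint a b (fun x => `|f x - step (n m) (E m) (c m) x|) @[m --> \oo] --> (0 : R).
  by under eq_fun do rewrite rintE; exact: (fine_cvg int0).
apply/eqP; rewrite -subr_eq0 -normr_le0; apply/ler_addgt0Pl => eps eps0; rewrite addr0.
pose d := eps / (2 * (`|h| + 1)).
have h1 : 0 < `|h| + 1 by rewrite ltr_wpDl.
have d0 : 0 < d by rewrite divr_gt0// mulr_gt0.
have [N hN] := cvgn_eps rint0 d0; have [M hM] := cvgn_eps hv d0.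
pose m := maxn N M.
have := hN m (leq_maxl _ _); rewrite subr0 => e1.
have e2 := hM m (leq_maxr _ _).
have a1 := step_integral_approx (n m) (c m) h (mE m) (ED m) hf.
have {}a1 := le_trans a1 (ler_wpM2l (normr_ge0 h) (le_trans (ler_norm _) (ltW e1))).
have a2 := norm_ip_le Hip (step_integral (n m) (E m) (c m) - v) h.
have {}a2 := le_trans a2 (ler_wpM2r (normr_ge0 h) (ltW e2)).
have e3 : `|h| * d <= eps / 2.
  rewrite /d mulrA ler_pdivrMr ?mulr_gt0//.
  have : `|h| * eps <= (`|h| + 1) * eps by rewrite ler_pM2r// lerDl.
  lra.
move: a1 a2; rewrite ipBl !ler_norml (mulrC d) => /andP[? ?] /andP[? ?].
by apply/andP; split; lra.
Qed.

Fact vint_key : unit. Proof. exact: tt. Qed.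

(** Sealed for the same reason as the real integral. *)
Definition vint := locked_with vint_key
  (fun a b f => xget 0 [set v | is_bochner `[a, b] f v] : H).

Lemma vintP a b f : vmeas a b f -> is_bochner `[a, b] f (vint a b f).
Proof.
move=> /bochner_exists[v hv]; rewrite /vint locked_withE.
by case: xgetP => [//|/(_ v)/=]; case.
Qed.

Lemma ip_vint a b f h : vmeas a b f -> ip (vint a b f) h = rint a b (fun x => ip (f x) h).
Proof. by move=> hf; apply: bochner_weak => //; exact: vintP. Qed.

Lemma bochner_vint a b f v : vmeas a b f -> is_bochner `[a, b] f v -> v = vint a b f.
Proof.
by move=> hf hv; apply: (ip_inj Hip) => h; rewrite (ip_vint h hf) (bochner_weak hf hv).
Qed.

Lemma norm_vint_le a b f C : a <= b -> 0 <= C -> vmeas a b f ->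
  (forall x, a <= x <= b -> `|f x| <= C) -> `|vint a b f| <= C * (b - a).
Proof.
move=> ab C0 hf fC; apply: (norm_le_ip Hip); first by rewrite mulr_ge0// subr_ge0.
move=> h; rewrite ip_vint//.
rewrite mulrAC; apply: rint_le => //; first exact: bmeas_ip.
by move=> x abx; rewrite (le_trans (ip_le Hip _ _))// ler_wpM2r// fC.
Qed.

Lemma vint_split b a c f : a <= b <= c -> vmeas a c f ->
  vint a c f = vint a b f + vint b c f.
Proof.
move=> /[dup] abc /andP[ab bc] hf; apply: (ip_inj Hip) => h; rewrite ipDl.
have h1 := vmeas_sub (lexx a) bc hf; have h2 := vmeas_sub ab (lexx c) hf.
by rewrite !ip_vint//; apply: rint_split => //; exact: bmeas_ip.
Qed.

Lemma eq_vint a b f g : vmeas a b f -> (forall x, a <= x <= b -> f x = g x) ->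
  vint a b f = vint a b g.
Proof.
move=> hf fg; have hg := eq_vmeas fg hf; apply: (ip_inj Hip) => h.
by rewrite !ip_vint//; apply: eq_rint => x /fg ->.
Qed.

Lemma vintaa a f : vmeas a a f -> vint a a f = 0.
Proof. by move=> hf; apply: (ip_inj Hip) => h; rewrite ip_vint// rintaa ip0l. Qed.

(** A contraction maps approximating step functions to approximating step
    functions. *)
Lemma vint_contraction a b f (S : {linear H -> H}) : (forall x, `|S x| <= `|x|) ->
  vmeas a b f -> vmeas a b (S \o f) -> S (vint a b f) = vint a b (S \o f).
Proof.
move=> cS hf hSf; apply: bochner_vint => //.
have [n [E [c [hE hae int0 hv]]]] := vintP hf.
have mE m k : measurable (E m k) by case: (hE m k).
have Ss m x : S (step (n m) (E m) (c m) x) = step (n m) (E m) (fun k => S (c m k)) x.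
  by rewrite /step raddf_sum; apply: eq_bigr => k _ /=; rewrite linearZZ.
have cvS (u : nat -> H) v : u m @[m --> \oo] --> v -> S (u m) @[m --> \oo] --> S v.
  move=> /cvgrPdist_lt uv; apply/cvgrPdist_lt => eps eps0.
  near=> m; rewrite -raddfB; apply: le_lt_trans (cS _) _.
  by near: m; exact: uv.
exists n, E, (fun m k => S (c m k)); split => //.
- have [N [mN N0 subN]] := hae; exists N; split => // x /= hx; apply: subN => /= hx'.
  apply: hx => Dx; have := cvS _ _ (hx' Dx).
  by apply: cvg_trans; apply: near_eq_cvg; near=> m; rewrite Ss.
- apply: (@squeeze_cvge _ _ _ _ (fun=> 0%E) _
     (fun m => (\int[mu]_(x in `[a, b]) (`|f x - step (n m) (E m) (c m) x|%:E))%E)) int0.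
    near=> m; apply/andP; split; first exact: integral_ge0.
    apply: ge0_le_integral => //.
    + by apply/measurable_EFinP; case: (bmeas_step_dist (n m) (fun k => S (c m k)) (mE m) hSf).
    + by apply/measurable_EFinP; case: (bmeas_step_dist (n m) (c m) (mE m) hf).
    + by move=> x _; rewrite lee_fin /= -Ss -raddfB cS.
  exact: cvg_cst.
- have := cvS _ _ hv; apply: cvg_trans; apply: near_eq_cvg; near=> m.
  by rewrite /step_integral raddf_sum; apply: eq_bigr => k _ /=; rewrite linearZZ.
Unshelve. all: by end_near.
Qed.

End Bochner.

(** * Contraction semigroups *)

Section RealAnalysis.
Context (R : realType).

Lemma cvg_right_epsP (V : normedModType R) (f : R -> V) (x : R) (l : V) :
  f y @[y --> x^'+] --> l <->
  (forall eps : R, 0 < eps -> exists2 d : R, 0 < d & forall y, x < y -> y < x + d -> `|f y - l| < eps).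
Proof.
split.
  move=> /cvgrPdist_lt h eps eps0; have [d /= d0 hd] := h eps eps0.
  exists d => // y xy yd; rewrite distrC; apply: hd => //=.
  by rewrite ltr0_norm ?subr_lt0// opprB ltrBlDl.
move=> h; apply/cvgrPdist_lt => eps eps0; have [d d0 hd] := h eps eps0.
exists d => //= y /= xyd xy; rewrite distrC; apply: hd => //.
by move: xyd; rewrite distrC gtr0_norm ?subr_gt0// ltrBlDl.
Qed.

Lemma cvg_left_epsP (V : normedModType R) (f : R -> V) (x : R) (l : V) :
  f y @[y --> x^'-] --> l <->
  (forall eps : R, 0 < eps -> exists2 d : R, 0 < d & forall y, y < x -> x - d < y -> `|f y - l| < eps).
Proof.
split.
  move=> /cvgrPdist_lt h eps eps0; have [d /= d0 hd] := h eps eps0.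
  exists d => // y xy yd; rewrite distrC; apply: hd => //=.
  by rewrite gtr0_norm ?subr_gt0// ltrBlDl -ltrBlDr.
move=> h; apply/cvgrPdist_lt => eps eps0; have [d d0 hd] := h eps eps0.
exists d => //= y /= xyd xy; rewrite distrC; apply: hd => //.
by move: xyd; rewrite gtr0_norm ?subr_gt0// ltrBlDl -ltrBlDr.
Qed.

Lemma within_continuousP (V : normedModType R) (f : R -> V) (a b : R) :
  {within `[a, b], continuous f} <->
  (forall x, a <= x <= b -> forall eps : R, 0 < eps -> exists2 d : R, 0 < d &
    forall y, a <= y <= b -> `|x - y| < d -> `|f x - f y| < eps).
Proof.
rewrite subspace_continuousP; split.
  move=> h x abx eps eps0.
  have /cvgrPdist_lt/(_ eps eps0)[d /= d0 hd] := h x abx.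
  by exists d => // y aby xyd; apply: hd => //=.
move=> h x abx; apply/cvgrPdist_lt => eps eps0; have [d d0 hd] := h x abx eps eps0.
by exists d => //= y xyd aby; apply: hd => //.
Qed.

Lemma uniformly_continuous_segment (V : normedModType R) (f : R -> V) (a b : R) :
  {within `[a, b], continuous f} ->
  forall eps : R, 0 < eps -> exists2 d : R, 0 < d &
    forall x y, a <= x <= b -> a <= y <= b -> `|x - y| < d -> `|f x - f y| < eps.
Proof.
move=> /within_continuousP cf eps eps0.
have := @segment_compact R a b; rewrite compact_near_coveringP => ncov.
pose P (d x : R) := forall y, a <= y <= b -> `|x - y| < d -> a <= x <= b -> `|f x - f y| < eps.
have : \forall d \near 0^'+, `[a, b]%classic `<=` P d.
  apply: ncov => x /=; rewrite in_itv/= => abx.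
  have [e e0 he] := cf x abx (eps / 2) (divr_gt0 eps0 (ltr0Sn _ 1)).
  exists ([set z | `|x - z| < e / 2], [set d | d < e / 2]).
    split => /=; first by exists (e / 2) => //=; rewrite divr_gt0.
    exists (e / 2); rewrite /= ?divr_gt0// => d /=; rewrite sub0r normrN => h d0.
    by rewrite (le_lt_trans (ler_norm _)).
  move=> [z d] [/= xz de] y aby zy abz.
  have h1 := he z abz; have h2 := he y aby.
  have {}h1 : `|f x - f z| < eps / 2 by apply: h1; lra.
  have {}h2 : `|f x - f y| < eps / 2.
    by apply: h2; rewrite (le_lt_trans (ler_distD z _ _))//; lra.
  by rewrite (le_lt_trans (ler_distD (f x) _ _))// distrC; lra.
move=> [d /= d0 hd].
exists (d / 2) => [|x y abx aby xy]; first by rewrite divr_gt0.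
apply: (hd (d / 2)) => //=; rewrite ?in_itv//= ?divr_gt0//.
by rewrite sub0r normrN gtr0_norm ?divr_gt0//; lra.
Qed.

Lemma bounded_segment (V : normedModType R) (f : R -> V) (a b : R) :
  {within `[a, b], continuous f} -> exists C, forall x, a <= x <= b -> `|f x| <= C.
Proof.
move=> cf; have /compact_bounded := continuous_compact cf (@segment_compact R a b).
move=> [M [_ hM]]; exists (M + 1) => x abx.
by apply: (hM (M + 1)); [rewrite ltrDl|exists x => //=; rewrite in_itv].
Qed.

Lemma rint_shift (f : R -> R) (a b h : R) : a <= b ->
  {within `[a + h, b + h], continuous f} ->
  rint (a + h) (b + h) f = rint a b (fun x => f (x + h)).
Proof.
move=> ab cf.
have dF : (fun x : R => x + h)^`()%classic = fun=> 1.
  by apply/funext => x; rewrite derive1E deriveD// derive_id derive_cst addr0.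
have cF (x : R) : {for x, continuous (fun x : R => x + h)}.
  by apply: cvgD; [exact: cvg_id|exact: cvg_cst].
rewrite !rintE /Rintegral.
rewrite (@integration_by_substitution_increasing _ (fun x => x + h) f)//.
- by congr fine; apply: eq_integral => x _; rewrite dF /= mulr1.
- by move=> x y _ _; rewrite ltrD2r.
- by move=> x _; rewrite dF; exact: cst_continuous.
- by rewrite dF; exact: is_cvg_cst.
- by rewrite dF; exact: is_cvg_cst.
- split; first by move=> x _; exact: derivableD.
    by apply: cvg_at_right_filter; exact: cF.
  by apply: cvg_at_left_filter; exact: cF.
Qed.

End RealAnalysis.

Section Semigroup.
Context (R : realType) (H : completeNormedModType R) (ip : {dot H for idfun}).
Hypothesis Hip : inner_product_of_norm ip.
Hypothesis Hsep : separable_space H.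
Context (A : operator H) (e : R -> {linear H -> H}).
Hypothesis He : C0_semigroup e.
Hypothesis HA : generates A e.
Hypothesis Hc : contraction_semigroup e.

(** Vector-valued form of [measurable_diagonal], for [r |-> e (s - r) (F (X_r)
    (u r))]. *)
Lemma vmeas_diagonal (G : R -> R -> H) (a b C : R) :
  (forall c, a <= c <= b -> smeas `[a, b] (G c)) ->
  (forall x, a <= x <= b -> forall eps : R, 0 < eps -> exists2 del : R, 0 < del &
     forall c, a <= c <= x -> x - c < del -> `|G c x - G x x| < eps) ->
  (forall x, a <= x <= b -> `|G x x| <= C) ->
  vmeas a b (fun x => G x x).
Proof.
move=> mG cG GC; split; last by exists C.
move=> h; apply: (measurable_diagonal (g := fun c x => `|G c x - h|)).
  by move=> c abc; exact: mG.
move=> x abx eps eps0; have [d d0 hd] := cG x abx eps eps0.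
exists d => // c axc xc; apply: le_lt_trans (hd c axc xc).
by rewrite (le_trans (ler_dist_dist _ _))// opprB addrA subrK.
Qed.

Lemma vmeas_continuous (f : R -> H) a b : {within `[a, b], continuous f} -> vmeas a b f.
Proof.
move=> cf; have [C fC] := bounded_segment cf.
apply: (vmeas_diagonal (G := fun c _ => f c) _ _ fC).
  by move=> c _ h; exact: measurable_cst.
move=> x abx eps eps0; have [d d0 hd] := (within_continuousP f a b).1 cf x abx eps eps0.
exists d => // c /andP[ac cx] xc; rewrite distrC; apply: hd.
  by rewrite ac (le_trans cx)//; case/andP: abx.
by rewrite ger0_norm ?subr_ge0.
Qed.

Lemma e0 x : e 0 x = x. Proof. by case: He. Qed.

Lemma eD s t x : 0 <= s -> 0 <= t -> e (s + t) x = e s (e t x).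
Proof. by case: He => _ _ + _; apply. Qed.

Lemma e_near0 x (eps : R) : 0 < eps ->
  exists2 d : R, 0 < d & forall s : R, 0 <= s < d -> `|e s x - x| < eps.
Proof.
move=> eps0; case: He => _ _ _ /(_ x)/cvg_right_epsP/(_ eps eps0)[d d0 hd].
exists d => // s /andP[]; rewrite le_eqVlt => /predU1P[<-|s0] sd.
  by rewrite e0 subrr normr0.
by apply: hd => //; rewrite add0r.
Qed.

Lemma e_dist x s t : 0 <= s <= t -> `|e t x - e s x| <= `|e (t - s) x - x|.
Proof.
move=> /andP[s0 st].
have -> : e t x = e s (e (t - s) x) by rewrite -eD ?subr_ge0// subrKC.
by rewrite -linearB; exact: Hc.
Qed.

Lemma e_uniform x (eps : R) : 0 < eps -> exists2 d : R, 0 < d &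
  forall s t : R, 0 <= s -> 0 <= t -> `|s - t| < d -> `|e s x - e t x| < eps.
Proof.
move=> eps0; have [d d0 hd] := e_near0 x eps0; exists d => // s t s0 t0.
wlog st : s t s0 t0 / s <= t.
  by move=> h; have [/h|/ltW/h] := leP s t; [exact|rewrite distrC [X in _ -> X < _]distrC; exact].
rewrite distrC => std; rewrite distrC.
rewrite (le_lt_trans (e_dist x _)) ?s0//; apply: hd.
by rewrite subr_ge0 st/= (le_lt_trans (ler_norm _)).
Qed.

Lemma e_continuous x a b : 0 <= a -> {within `[a, b], continuous (fun s => e s x)}.
Proof.
move=> a0; apply/within_continuousP => s /andP[sa _] eps eps0.
have [d d0 hd] := e_uniform x eps0; exists d => // t /andP[ta _]; apply: hd.
  exact: le_trans sa.
exact: le_trans ta.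
Qed.

Lemma vint_near (f : R -> H) (a b : R) v (eps : R) : a <= b -> 0 <= eps -> vmeas a b f ->
  (forall x, a <= x <= b -> `|f x - v| <= eps) ->
  `|vint a b f - (b - a) *: v| <= eps * (b - a).
Proof.
move=> ab eps0 hf fv; apply: (norm_le_ip Hip); first by rewrite mulr_ge0// subr_ge0.
move=> h; rewrite ipBl (ip_vint Hip Hsep)// ipZl (mulrC (b - a)) -(@rint_cst R a b (ip v h))//.
rewrite -rintB; [|exact: bmeas_ip|exact: bmeas_cst].
rewrite mulrAC; apply: rint_le => //.
  by apply: bmeasB; [exact: bmeas_ip|exact: bmeas_cst].
by move=> x abx; rewrite -ipBl (le_trans (ip_le Hip _ _))// ler_wpM2r// fv.
Qed.

(** Since [e h z - z] is the difference of the integrals of the orbit over [[D,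
    D + h]] and [[0, h]], its quotient by [h] converges to [e D x - x]. *)
Lemma orbit_integral_domain x D : 0 <= D ->
  let z := vint 0 D (fun r => e r x) in
  odom A z /\ oval A z = e D x - x.
Proof.
move=> D0 z; apply/HA/cvg_right_epsP => eps eps0.
have [d d0 hd] := e_near0 x (divr_gt0 eps0 (ltr0Sn _ 2)).
exists d => // h h0; rewrite add0r => hdd.
have h0' := ltW h0.
have mo b : vmeas 0 b (fun r => e r x) by apply/vmeas_continuous/e_continuous.
have -> : e h z = vint h (D + h) (fun r => e r x).
  have mh : vmeas 0 D (e h \o (fun r => e r x)).
    apply: vmeas_continuous; apply/within_continuousP => s /andP[s0 _] eps' eps0'.
    have [d' d0' hd'] := e_uniform x eps0'; exists d' => // t /andP[t0 _] st /=.
    rewrite -raddfB (le_lt_trans (Hc _ _))// hd'//.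
  rewrite (vint_contraction Hip Hsep _ (mo D) mh); last by move=> y; exact: Hc.
  have hDh : vmeas h (D + h) (fun r => e r x) by apply: vmeas_sub (mo (D + h)).
  apply: (ip_inj Hip) => y; rewrite !(ip_vint Hip Hsep)//.
  have := @rint_shift R (fun r => ip (e r x) y) 0 D h D0; rewrite add0r => ->.
    by apply: eq_rint => r /andP[r0 _] /=; rewrite addrC eD.
  have /within_continuousP ce := @e_continuous x h (D + h) h0'.
  apply/within_continuousP => s hs eps' eps0'.
  have y1 : 0 < `|y| + 1 by rewrite ltr_wpDl.
  have [d' d0' hd'] := ce s hs (eps' / (`|y| + 1)) (divr_gt0 eps0' y1).
  exists d' => // t ht st; rewrite -ipBl (le_lt_trans (norm_ip_le Hip _ _))//.
  have := hd' t ht st; rewrite ltr_pdivlMr//; apply: le_lt_trans.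
  by rewrite ler_wpM2l// lerDl.
have -> : vint h (D + h) (fun r => e r x) - z =
    vint D (D + h) (fun r => e r x) - vint 0 h (fun r => e r x).
  have E1 : vint 0 (D + h) (fun r => e r x) = z + vint D (D + h) (fun r => e r x).
    by apply: (vint_split Hip Hsep) => //; rewrite D0/= lerDl.
  have E2 : vint 0 (D + h) (fun r => e r x) =
      vint 0 h (fun r => e r x) + vint h (D + h) (fun r => e r x).
    by apply: (vint_split Hip Hsep) => //; rewrite h0'/= lerDr.
  rewrite -[X in X - z](addKr (vint 0 h (fun r => e r x))) -E2 E1.
  by rewrite [z + _]addrC addrA addrK addrC.
have n1 : `|vint 0 h (fun r => e r x) - h *: x| <= eps / 3 * h.
  have := @vint_near (fun r => e r x) 0 h x (eps / 3) h0'; rewrite subr0; apply=> //.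
    by rewrite divr_ge0// ltW.
  by move=> r /andP[r0 rh]; apply/ltW/hd; rewrite r0 (le_lt_trans rh).
have n2 : `|vint D (D + h) (fun r => e r x) - h *: e D x| <= eps / 3 * h.
  have := @vint_near (fun r => e r x) D (D + h) (e D x) (eps / 3).
  rewrite (addrC D) addrK; apply.
  - by rewrite lerDr.
  - by rewrite divr_ge0// ltW.
  - by rewrite addrC; apply: vmeas_sub (mo (D + h)).
  move=> r /andP[Dr rh]; rewrite (le_trans (e_dist x _)) ?D0//.
  apply/ltW/hd; rewrite subr_ge0 Dr/=; lra.
rewrite -[X in _ - X]scale1r -(mulVf (lt0r_neq0 h0)) -scalerA -scalerBr normrZ gtr0_norm ?invr_gt0//.
rewrite -ltr_pdivlMl ?invr_gt0// invrK.
rewrite scalerBr opprB addrACA.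
rewrite [X in `|X|](_ : _ = (vint D (D + h) (fun r => e r x) - h *: e D x) -
   (vint 0 h (fun r => e r x) - h *: x)); last first.
  by rewrite opprB [- _ + _]addrC addrACA.
rewrite (le_lt_trans (ler_normB _ _))//.
have he0 : 0 < h * eps by rewrite mulr_gt0.
lra.
Qed.

(** The increment of any orbit, smooth or not, becomes bounded in the initial
    value once it is paired with an element of the domain of the adjoint. *)
Lemma adjoint_orbit p x D : 0 <= D -> odom (adjoint ip A) p ->
  ip p (e D x - x) = ip (oval (adjoint ip A) p) (vint 0 D (fun r => e r x)).
Proof.
move=> D0 [y hy]; have [dz <-] := orbit_integral_domain x D0.
rewrite /= ; case: xgetP => [w _ hw|/(_ y)]; last by case.
by rewrite !(ipC _ _ (vint _ _ _)) -hw// ipC.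
Qed.

(** The form [(x, y) |-> (x, y) - (e s x, e s y)] is nonnegative by
    contractivity, and its value at [(p, p)] tends to [0] with [s]; Cauchy-
    Schwarz then bounds it at [(p, v)], uniformly in [v]. *)
Lemma semigroup_weak_uniform p (eps : R) : 0 < eps -> exists2 d : R, 0 < d &
  forall s v, 0 <= s < d -> `|ip p (e s v - v)| <= eps * `|v|.
Proof.
move=> eps0.
pose b := (eps / 2) ^+ 2 / (2 * (`|p| + 1)).
have p1 : 0 < `|p| + 1 by rewrite ltr_wpDl.
have b0 : 0 < b by rewrite divr_gt0 ?exprn_gt0 ?mulr_gt0// divr_gt0.
have [d1 d10 hd1] := e_near0 p b0.
have [d2 d20 hd2] := e_near0 p (divr_gt0 eps0 (ltr0Sn _ 1)).
exists (Num.min d1 d2); first by rewrite lt_min d10.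
move=> s v /andP[s0]; rewrite lt_min => /andP[sd1 sd2].
have [->|v0] := eqVneq v 0; first by rewrite raddf0 subrr ip0r !normr0 mulr0.
have {}v0 : 0 < `|v| by rewrite normr_gt0.
have h1 : `|e s p - p| < b by apply: hd1; rewrite s0.
have h2 : `|e s p - p| < eps / 2 by apply: hd2; rewrite s0.
pose B x y := ip x y - ip (e s x) (e s y).
have Bpp : B p p <= (eps / 2) ^+ 2.
  rewrite /B !Hip.
  have e1 : `|p| ^+ 2 - `|e s p| ^+ 2 = (`|p| - `|e s p|) * (`|p| + `|e s p|) by ring.
  rewrite e1; have e2 : `|p| - `|e s p| <= `|e s p - p|.
    by rewrite (le_trans (ler_norm _))// (le_trans (ler_dist_dist _ _))// distrC.
  have e3 : `|p| + `|e s p| <= 2 * (`|p| + 1) by have := Hc p s0; lra.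
  have e4 : 0 <= `|p| + `|e s p| by rewrite addr_ge0.
  have e5 : 0 <= `|e s p - p| by [].
  have e6 : b * (2 * (`|p| + 1)) = (eps / 2) ^+ 2 by rewrite /b divfK// mulf_neq0// gt_eqF.
  rewrite -e6; apply: (le_trans (ler_wpM2r e4 e2)); apply: ler_pM => //; exact: ltW.
have Bvv : B v v <= `|v| ^+ 2 by rewrite /B !Hip gerBl// sqr_ge0.
have Bpos x : 0 <= B x x.
  by rewrite /B !Hip subr_ge0 ler_sqr ?nnegrE//; exact: Hc.
have BE c : B (p + c *: v) (p + c *: v) = B p p + 2 * c * B p v + c ^+ 2 * B v v.
  have ee : e s (p + c *: v) = e s p + c *: e s v by rewrite linearD linearZZ.
  rewrite /B ee !ipDl !ipDr !ipZl !ipZr (ipC ip v p) (ipC ip (e s v) (e s p)).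
  ring.
have cS c : - (2 * c * B p v) <= (eps / 2) ^+ 2 + (c * `|v|) ^+ 2.
  have := Bpos (p + c *: v); rewrite BE exprMn => h.
  have : c ^+ 2 * B v v <= c ^+ 2 * `|v| ^+ 2 by rewrite ler_wpM2l// sqr_ge0.
  lra.
have hB : `|B p v| <= eps / 2 * `|v|.
  (* This multiple of [v] has norm [eps / 2], the bound on [B p p] being its
     square. *)
  have k1 := cS (eps / 2 / `|v|); have k2 := cS (- (eps / 2 / `|v|)).
  rewrite mulNr sqrrN in k2; rewrite divfK ?gt_eqF// in k1 k2.
  have E : 2 * (eps / 2 / `|v|) * B p v = (eps / `|v|) * B p v by rewrite !mulrA; field; rewrite gt_eqF.
  have E' : 2 * (- (eps / 2 / `|v|)) * B p v = - ((eps / `|v|) * B p v).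
    by rewrite !mulrN !mulNr E.
  rewrite E in k1; rewrite E' in k2.
  have : `|(eps / `|v|) * B p v| <= 2 * (eps / 2) ^+ 2.
    by rewrite ler_norml; apply/andP; split; lra.
  rewrite normrM gtr0_norm ?divr_gt0// mulrAC ler_pdivrMr// => h.
  rewrite -(ler_pM2l eps0) (le_trans h)//.
  have -> : 2 * (eps / 2) ^+ 2 * `|v| = eps * (eps / 2 * `|v|) by field.
  by [].
have -> : ip p (e s v - v) = ip (p - e s p) (e s v) - B p v.
  by rewrite /B ipBr ipBl; ring.
rewrite (le_trans (ler_normB _ _))//.
have h3 : `|ip (p - e s p) (e s v)| <= eps / 2 * `|v|.
  rewrite (le_trans (norm_ip_le Hip _ _))// ler_pM//; first by rewrite distrC ltW.
  exact: Hc.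
lra.
Qed.

End Semigroup.

(** * Path spaces *)

Section Paths.
Context (R : realType) (H : completeNormedModType R).
Implicit Types (g k P Q : hpath H) (X Y : R -> H) (a b c r s t : R).

Lemma hpath_eq g k : ptime g = ptime k -> (forall s, g s = k s) -> g = k.
Proof. by case: g k => [p f] [p' f'] /= -> fE; congr Path; apply/funext. Qed.

Lemma restrictE r X s : 0 <= s <= r -> restrict_path r X s = X s.
Proof. by rewrite /restrict_path/= => ->. Qed.

Lemma restrict_out r X s : ~~ (0 <= s <= r) -> restrict_path r X s = 0.
Proof. by rewrite /restrict_path/= => /negbTE ->. Qed.

Lemma pnorm_le g c : 0 <= ptime g -> (forall s, 0 <= s <= ptime g -> `|g s| <= c) ->
  pnorm g <= c.
Proof.
move=> g0 gc; apply: ge_sup.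
  by exists `|g 0|, 0 => //=; rewrite in_itv/= lexx.
by move=> _ [s /= + <-]; rewrite in_itv/=; exact: gc.
Qed.

Lemma le_pnorm g c : (forall s, 0 <= s <= ptime g -> `|g s| <= c) ->
  forall s, 0 <= s <= ptime g -> `|g s| <= pnorm g.
Proof.
move=> gc s sg; apply: ub_le_sup; last by exists s => //=; rewrite in_itv.
by exists c => _ [r /= + <-]; rewrite in_itv/=; exact: gc.
Qed.

Lemma Lambda_bounded T t g : Lambda T t g ->
  forall s, 0 <= s <= ptime g -> `|g s| <= pnorm g.
Proof. by case=> _ _ /bounded_segment[c gc]; exact: (@le_pnorm _ c). Qed.

Lemma pnorm_ge0 T t g : 0 <= t -> Lambda T t g -> 0 <= pnorm g.
Proof.
move=> t0 Lg; apply: (le_trans (normr_ge0 (g 0))); apply: (Lambda_bounded Lg).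
by rewrite lexx; case: Lg => /andP[/(le_trans t0)].
Qed.

Lemma LambdaW T s t g : s <= t -> Lambda T t g -> Lambda T s g.
Proof. by move=> st [/andP[tg gT] ? ?]; split => //; rewrite (le_trans st). Qed.

Lemma within_continuousS X a b c d : a <= c -> d <= b ->
  {within `[a, b], continuous X} -> {within `[c, d], continuous X}.
Proof.
move=> ac db /within_continuousP cX; apply/within_continuousP => x /andP[cx xd] eps eps0.
have [|del del0 hd] := cX x _ eps eps0; first by rewrite (le_trans ac)//= (le_trans xd).
by exists del => // y /andP[cy yd]; apply: hd; rewrite (le_trans ac)//= (le_trans yd).
Qed.

Lemma eq_within_continuous X Y a b : (forall x, a <= x <= b -> X x = Y x) ->
  {within `[a, b], continuous X} -> {within `[a, b], continuous Y}.
Proof.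
move=> XY /within_continuousP cX; apply/within_continuousP => x xab eps eps0.
have [del del0 hd] := cX x xab eps eps0.
by exists del => // y yab; rewrite -!XY//; exact: hd.
Qed.

Lemma within_continuousU X a b c : a <= b <= c ->
  {within `[a, b], continuous X} -> {within `[b, c], continuous X} ->
  {within `[a, c], continuous X}.
Proof.
move=> /andP[ab bc] /within_continuousP c1 /within_continuousP c2.
apply/within_continuousP => x /andP[ax xc] eps eps0.
have [xb|bx|xb] := ltgtP x b.
- have [|d d0 hd] := c1 x _ eps eps0; first by rewrite ax ltW.
  exists (Num.min d (b - x)); first by rewrite lt_min d0 subr_gt0.
  move=> y /andP[ay yc]; rewrite lt_min => /andP[xyd xyb]; apply: hd => //.
  rewrite ay/=; have := le_lt_trans (ler_norm _) xyb.
  by have := ler_norm (y - x); rewrite distrC; lra.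
- have [|d d0 hd] := c2 x _ eps eps0; first by rewrite xc ltW.
  exists (Num.min d (x - b)); first by rewrite lt_min d0 subr_gt0.
  move=> y /andP[ay yc]; rewrite lt_min => /andP[xyd xyb]; apply: hd => //.
  by rewrite yc andbT; have := le_lt_trans (ler_norm _) xyb; lra.
- subst x; have [|d1 d10 hd1] := c1 b _ eps eps0; first by rewrite ab lexx.
  have [|d2 d20 hd2] := c2 b _ eps eps0; first by rewrite bc lexx.
  exists (Num.min d1 d2); first by rewrite lt_min d10.
  move=> y /andP[ay yc]; rewrite lt_min => /andP[h1 h2].
  have [yb|/ltW by'] := leP y b; first by apply: hd1 => //; rewrite ay.
  by apply: hd2 => //; rewrite by'.
Qed.

Lemma Lambda_restrict T t r X : 0 <= r -> t <= r <= T ->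
  {within `[0, T], continuous X} -> Lambda T t (restrict_path r X).
Proof.
move=> r0 trT cX; split => //; first by move=> s /restrict_out.
apply: (eq_within_continuous (X := X)); last by apply: within_continuousS cX => //; case/andP: trT.
by move=> x xr; rewrite restrictE.
Qed.

Lemma pnorm_restrict r X c : 0 <= r -> (forall s, 0 <= s <= r -> `|X s| <= c) ->
  pnorm (restrict_path r X) <= c.
Proof. by move=> r0 Xc; apply: pnorm_le => // s sr; rewrite restrictE ?Xc. Qed.

Context (e : R -> {linear H -> H}) (T : R).
Hypothesis He : C0_semigroup e.
Hypothesis Hc : contraction_semigroup e.

Lemma dinfC g k : dinf T e g k = dinf T e k g.
Proof.
rewrite /dinf distrC; congr (_ + sup _); apply/seteqP; split => _ [s sT <-];
  by exists s => //=; rewrite distrC.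
Qed.

Lemma flow_before g s : 0 <= s <= T -> s < ptime g -> flow_path e g T s = g s.
Proof. by move=> sT sg; rewrite /flow_path restrictE// sg. Qed.

Lemma flow_after g t s : 0 <= s <= t -> ptime g <= s ->
  flow_path e g t s = e (s - ptime g) (g (ptime g)).
Proof. by move=> sT sg; rewrite /flow_path restrictE// ltNge sg. Qed.

(** Only the times up to [ptime Q] matter, since afterwards both extensions
    follow the contraction semigroup. *)
Lemma dinf_le P Q c : 0 <= ptime P -> ptime P <= ptime Q <= T ->
  (forall s, 0 <= s < ptime P -> `|P s - Q s| <= c) ->
  (forall s, ptime P <= s <= ptime Q -> `|e (s - ptime P) (P (ptime P)) - Q s| <= c) ->
  dinf T e P Q <= ptime Q - ptime P + c.
Proof.
move=> p0 /andP[pq qT] h1 h2; rewrite /dinf distrC ger0_norm ?subr_ge0// lerD2l.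
apply: pnorm_le; first by rewrite /= (le_trans p0)// (le_trans pq).
move=> s sT; have {}sT : 0 <= s <= T := sT.
change (`|flow_path e P T s - flow_path e Q T s| <= c); have [sp|ps] := ltP s (ptime P).
  rewrite !flow_before// ?(lt_le_trans sp)//; apply: h1; rewrite sp andbT; by case/andP: sT.
rewrite (flow_after sT ps); have [sq|qs] := ltP s (ptime Q).
  by rewrite flow_before//; apply: h2; rewrite ps ltW.
rewrite (flow_after sT qs).
have -> : s - ptime P = (s - ptime Q) + (ptime Q - ptime P) by rewrite addrA subrK.
rewrite (eD He) ?subr_ge0// -linearB (le_trans (Hc _ _)) ?subr_ge0//.
by apply: h2; rewrite pq lexx.
Qed.

Lemma dinf_restrict_le X Y r c : 0 <= r <= T ->
  (forall s, 0 <= s <= r -> `|X s - Y s| <= c) ->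
  dinf T e (restrict_path r X) (restrict_path r Y) <= c.
Proof.
move=> /andP[r0 rT] h; have := @dinf_le (restrict_path r X) (restrict_path r Y) c r0.
rewrite [ptime _ - ptime _]subrr add0r; apply; rewrite ?lexx//.
  by move=> s /andP[s0 /ltW sr]; rewrite !restrictE ?s0//; apply: h; rewrite s0.
move=> s; rewrite -eq_le => /eqP <-; rewrite subrr (e0 He) !restrictE ?r0 ?lexx//.
by apply: h; rewrite r0 lexx.
Qed.

Lemma dinf_restrict_near X x (eps : R) : {within `[0, T], continuous X} -> 0 <= x <= T -> 0 < eps ->
  exists2 del : R, 0 < del & forall c, 0 <= c <= x -> x - c < del ->
     dinf T e (restrict_path c X) (restrict_path x X) < eps.
Proof.
move=> /within_continuousP cX xT eps0; have e8 : 0 < eps / 8 by rewrite divr_gt0.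
have [d1 d10 hd1] := cX x xT (eps / 8) e8.
have [d2 d20 hd2] := e_near0 He (X x) e8.
exists (Num.min (eps / 8) (Num.min d1 d2)); first by rewrite !lt_min e8 d10.
move=> c /andP[c0 cx]; rewrite !lt_min => /and3P[h0 h1 h2]; case/andP: xT => x0 xT.
apply: (@le_lt_trans _ _ (x - c + 3 * (eps / 8))); last lra.
have hX s : c <= s <= x -> `|X x - X s| < eps / 8.
  move=> /andP[cs sx]; apply: hd1; first by rewrite (le_trans c0)//= (le_trans sx).
  by rewrite ger0_norm ?subr_ge0//; lra.
apply: dinf_le => //; rewrite ?cx//.
  move=> s /andP[s0 sc]; rewrite !restrictE ?s0 ?(ltW sc)//; last by rewrite (le_trans (ltW sc)).
  by rewrite subrr normr0 mulr_ge0// ltW.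
move=> s /andP[cs0 sx0]; have cs : c <= s := cs0; have sx : s <= x := sx0.
rewrite restrictE ?c0 ?lexx// restrictE ?sx ?(le_trans c0)//.
have -> : e (s - c) (X c) - X s = (e (s - c) (X c - X x)) + (e (s - c) (X x) - X x) + (X x - X s).
  by rewrite linearB/= !addrA !subrK.
have k1 : `|e (s - c) (X c - X x)| <= eps / 8.
  by rewrite (le_trans (Hc _ _)) ?subr_ge0// distrC ltW// hX// lexx.
have k2 : `|e (s - c) (X x) - X x| <= eps / 8.
  apply/ltW/hd2; rewrite subr_ge0 cs/=; lra.
have k3 : `|X x - X s| <= eps / 8 by apply/ltW/hX; rewrite cs.
rewrite (le_trans (ler_normD _ _))// (le_trans (lerD (ler_normD _ _) (lexx _)))//; lra.
Qed.

(** Both values are compared with the orbit issued from a slightly earlier point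
    of the curve, on which strong continuity is uniform. *)
Lemma near_flow_continuous (Y : R -> H) a b C : 0 <= C ->
  (forall s s', a <= s <= s' -> s' <= b -> `|Y s' - e (s' - s) (Y s)| <= C * (s' - s)) ->
  {within `[a, b], continuous Y}.
Proof.
move=> C0 hY; apply/within_continuousP => x /andP[ax xb] eps eps0.
pose n := eps / (8 * (C + 1)).
have C1 : 0 < C + 1 by rewrite ltr_wpDl.
have n0 : 0 < n by rewrite divr_gt0// mulr_gt0.
have nC : C * n <= eps / 8.
  have -> : eps / 8 = (C + 1) * n by rewrite /n; field; rewrite gt_eqF.
  by rewrite ler_pM2r// lerDl.
pose s0 := Num.max a (x - n).
have s0x : s0 <= x by rewrite ge_max ax/= gerBl ltW.
have as0 : a <= s0 by rewrite le_max lexx.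
have xs0 : x - s0 <= n by rewrite lerBlDr addrC -lerBlDr le_max lexx orbT.
have [d d0 hd] := e_uniform He Hc (Y s0) (divr_gt0 eps0 (ltr0Sn _ 1)).
exists (Num.min d n); first by rewrite lt_min d0.
move=> y /andP[ay yb]; rewrite lt_min => /andP[xyd xyn].
have s0y : s0 <= y.
  by rewrite ge_max ay/=; have := le_lt_trans (ler_norm _) xyn; lra.
have ysn : y - s0 <= 2 * n.
  by have := ler_norm (y - x); rewrite distrC; lra.
have k1 : `|Y x - e (x - s0) (Y s0)| <= eps / 8.
  by rewrite (le_trans (hY _ _ _ _))// ?as0// (le_trans _ nC)// ler_wpM2l.
have k2 : `|Y y - e (y - s0) (Y s0)| <= 2 * (eps / 8).
  rewrite (le_trans (hY _ _ _ _))// ?as0//.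
  by have := ler_wpM2l C0 ysn; lra.
have k3 : `|e (x - s0) (Y s0) - e (y - s0) (Y s0)| < eps / 2.
  by apply: hd; rewrite ?subr_ge0// opprB addrA subrK.
have -> : Y x - Y y = (Y x - e (x - s0) (Y s0)) + (e (x - s0) (Y s0) - e (y - s0) (Y s0)) -
   (Y y - e (y - s0) (Y s0)) by rewrite addrA subrK opprB addrA subrK.
rewrite (le_lt_trans (ler_normB _ _))// (le_lt_trans (lerD (ler_normD _ _) (lexx _)))//; lra.
Qed.

Lemma flow_continuous g t : Lambda T 0 g -> ptime g <= t ->
  {within `[0, t], continuous (flow_path e g t)}.
Proof.
move=> [/andP[g0 gT] _ cg] gt; apply: (@within_continuousU _ _ (ptime g)); rewrite ?g0//.
  apply: eq_within_continuous cg => s /andP[s0 sg].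
  rewrite /flow_path restrictE ?s0 ?(le_trans sg)//; case: ltP => // gs.
  have -> : s = ptime g by apply/le_anti; rewrite sg.
  by rewrite subrr (e0 He).
apply: (@near_flow_continuous _ _ _ 0) => // s s' /andP[gs ss'] s't.
rewrite mul0r !flow_after ?(le_trans gs)// ?(le_trans g0)// ?(le_trans gs)// ?(le_trans ss')//.
by rewrite -(eD He) ?subr_ge0// addrA subrK subrr normr0.
Qed.

Lemma flow_norm_le g t : Lambda T 0 g -> forall s, `|flow_path e g t s| <= pnorm g.
Proof.
move=> Lg s; have g0 : 0 <= ptime g by case: Lg => /andP[].
rewrite /flow_path/=; case: ifPn => [/andP[s0 sT]|_]; last by rewrite normr0 (pnorm_ge0 _ Lg).
case: ltP => sg; first by apply: (Lambda_bounded Lg); rewrite s0 ltW.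
rewrite (le_trans (Hc _ _)) ?subr_ge0//; apply: (Lambda_bounded Lg).
by rewrite g0 lexx.
Qed.

Lemma flow_dist_le g k : Lambda T 0 g -> Lambda T 0 k -> forall s, 0 <= s <= T ->
  `|flow_path e g T s - flow_path e k T s| <= dinf T e g k - `|ptime g - ptime k|.
Proof.
move=> Lg Lk s sT; rewrite /dinf [X in _ <= X - _]addrC addrK.
pose P := Defs.sub_path (flow_path e g T) (flow_path e k T).
have hb r : 0 <= r <= ptime P -> `|P r| <= pnorm g + pnorm k.
  by move=> _; rewrite (le_trans (ler_normB _ _))// lerD// flow_norm_le.
exact: (le_pnorm hb sT).
Qed.

End Paths.

(** * Mild solutions: existence *)

Section WeightedEstimates.
Context (R : realType).
Implicit Types (a b c l m : R).

Lemma bmeas_exp l a b : 0 <= l -> bmeas a b (fun r => expR (l * r)).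
Proof.
move=> l0; split.
  apply: measurable_funTS; apply: continuous_measurable_fun => x.
  by apply: continuous_comp; [apply: mulrl_continuous|exact: continuous_expR].
exists (expR (l * b)) => x /andP[_ xb].
by rewrite ger0_norm ?expR_ge0// ler_expR ler_wpM2l.
Qed.

Lemma rint_exp_le l a b : 0 < l -> a <= b ->
  rint a b (fun r => expR (l * r)) <= expR (l * b) / l.
Proof.
move=> l0; rewrite le_eqVlt => /predU1P[<-|ab].
  by rewrite rintaa divr_ge0 ?expR_ge0// ltW.
have dF (x : R) : is_derive x 1 (fun r => l^-1 * expR (l * r)) (expR (l * x)).
  have h : is_derive x 1 (fun r : R => l * r) l.
    by apply: is_derive_eq; rewrite ?scaler0 ?addr0 /GRing.scale/= mulr1.
  have := @is_derive1_comp _ expR (fun r => l * r) x _ _ (is_derive_expR _) h.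
  move=> /(is_deriveZ l^-1) h2; apply: is_derive_eq h2 _.
  by rewrite /GRing.scale/= mulrA (mulrC l^-1) -mulrA mulVf ?mulr1 ?gt_eqF.
have cF (f : R -> R) : (forall x, derivable f x 1) -> continuous f.
  by move=> df x; apply/differentiable_continuous/derivable1_diffP.
have ce (x : R) : {for x, continuous (fun r => expR (l * r))}.
  by apply: continuous_comp; [apply: mulrl_continuous|exact: continuous_expR].
have cFF : continuous (fun r => l^-1 * expR (l * r)).
  by move=> x; apply: cF => y; case: (dF y).
rewrite rintE /Rintegral (@continuous_FTC2 _ _ (fun r => l^-1 * expR (l * r)))//=.
- by rewrite mulrC gerBl mulr_ge0 ?expR_ge0// invr_ge0 ltW.
- by apply: continuous_subspaceT => x; exact: ce.
- split; first by move=> x _; case: (dF x).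
    by apply: cvg_at_right_filter; exact: cFF.
  by apply: cvg_at_left_filter; exact: cFF.
- by move=> x _; rewrite derive1E; case: (dF x).
Qed.

(** The least admissible [m] satisfies [m <= a + m / 2]. *)
Lemma weighted_gronwall (D : R -> R) T l a M : 0 <= T -> 0 <= l -> 0 <= a ->
  (forall s, 0 <= s <= T -> 0 <= D s <= M) ->
  (forall m, 0 <= m -> (forall s, 0 <= s <= T -> D s <= m * expR (l * s)) ->
     forall s, 0 <= s <= T -> D s <= a + m / 2 * expR (l * s)) ->
  forall s, 0 <= s <= T -> D s <= 2 * a * expR (l * s).
Proof.
move=> T0 l0 a0 DM h.
have E1 s : 0 <= s -> 1 <= expR (l * s).
  by move=> s0; rewrite -expR0 ler_expR mulr_ge0.
pose W := [set D s / expR (l * s) | s in `[0, T]].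
have W0 : W !=set0 by exists (D 0 / expR (l * 0)), 0 => //=; rewrite in_itv/= lexx.
have Wub : has_ubound W.
  exists M => _ [s /= + <-]; rewrite in_itv/= => sT; have /andP[D0 DsM] := DM s sT.
  rewrite ler_pdivrMr ?expR_gt0// (le_trans DsM)// ler_peMr ?E1//; last by case/andP: sT.
  exact: le_trans D0 DsM.
pose m := sup W.
have Dm s : 0 <= s <= T -> D s <= m * expR (l * s).
  move=> sT; rewrite -ler_pdivrMr ?expR_gt0//; apply: ub_le_sup => //.
  by exists s => //=; rewrite in_itv.
have m0 : 0 <= m.
  have z0 : 0 <= (0 : R) <= T by rewrite lexx.
  have := Dm 0 z0; rewrite mulr0 expR0 mulr1; apply: le_trans; by have /andP[] := DM 0 z0.
have {}h := h m m0 Dm.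
have : m <= a + m / 2.
  apply: ge_sup => // _ [s /= + <-]; rewrite in_itv/= => sT.
  rewrite ler_pdivrMr ?expR_gt0// (le_trans (h s sT))// mulrDl lerD2r ler_peMr// E1//.
  by case/andP: sT.
move=> mle s sT; rewrite (le_trans (Dm s sT))// ler_wpM2r ?expR_ge0//; lra.
Qed.

End WeightedEstimates.

(** The growth of [F] is stated linearly rather than with squares. *)
Record standing (R : realType) (H : completeNormedModType R) (ip : {dot H for idfun})
    (T : R) (A : operator H) (e : R -> {linear H -> H}) (U : metricType R)
    (F : hpath H -> U -> H) (q : hpath H -> U -> R) (phi : hpath H -> R) (L : R) : Prop :=
  Standing {
    st_ip : inner_product_of_norm ip;
    st_sep : separable_space H;
    st_T : 0 < T;
    st_e : C0_semigroup e;
    st_A : generates A e;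
    st_contr : contraction_semigroup e;
    st_cont : hyp_b T F q;
    st_L : 0 < L;
    st_F : forall g u, Lambda T 0 g -> `|F g u| <= L * (1 + pnorm g);
    st_FL : forall g k u, Lambda T 0 g -> Lambda T 0 k ->
      `|F g u - F k u| <= L * dinf T e g k;
    st_q : forall g u, Lambda T 0 g -> `|q g u| <= L * (1 + pnorm g);
    st_qL : forall g k u, Lambda T 0 g -> Lambda T 0 k ->
      `|q g u - q k u| <= L * dinf T e g k;
    st_phi : forall g, Lambda T T g -> `|phi g| <= L * (1 + pnorm g);
    st_phiL : forall g k, Lambda T T g -> Lambda T T k ->
      `|phi g - phi k| <= L * pnorm (Defs.sub_path g k) }.

Section Mild.
Context (R : realType) (H : completeNormedModType R) (ip : {dot H for idfun})
    (T : R) (A : operator H) (e : R -> {linear H -> H}) (U : metricType R)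
    (F : hpath H -> U -> H) (q : hpath H -> U -> R) (phi : hpath H -> R) (L : R).
Hypothesis S : standing ip T A e F q phi L.
Implicit Types (g k : hpath H) (X Y : R -> H) (u v : R -> U) (a b c r s t m : R).

Let Hip := st_ip S.
Let Hsep := st_sep S.
Let T0 : 0 <= T := ltW (st_T S).
Let He := st_e S.
Let Hc := st_contr S.
Let L0 := st_L S.
Let L0' : 0 <= L := ltW L0.
Let l := 2 * L.
Let l0 : 0 < l. Proof. by rewrite mulr_gt0. Qed.

Local Notation contT X := {within `[0, T], continuous X}.
Local Notation ctl t := (@controls R T U t).

Lemma Lambda_restrictT X r : contT X -> 0 <= r <= T -> Lambda T 0 (restrict_path r X).
Proof. by move=> cX /andP[r0 rT]; apply: Lambda_restrict => //; rewrite r0. Qed.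

Lemma measurable_control (psi : U -> R) u t a b : continuous psi -> ctl t u ->
  t <= a -> b <= T -> measurable_fun `[a, b] (psi \o u).
Proof.
move=> cpsi hu ta bT mab.
apply: (measurability _ (RGenOInfty.measurableE R)) => // _ [_ [c ->] <-].
rewrite (_ : _ `&` _ = `[a, b] `&` (`[t, T] `&` u @^-1` (psi @^-1` `]c, +oo[))).
  apply: measurableI => //; apply: hu; apply: sub_sigma_algebra.
  by have /continuousP := cpsi; apply; exact: rray_open.
apply/seteqP; split => x [/= xab]; last by move=> [_]; split.
have xT : t <= x <= T.
  by move: xab; rewrite !in_itv/= => /andP[ax xb]; rewrite (le_trans ta ax) (le_trans xb bT).
by move=> xc; split => //; split => //=; rewrite in_itv.
Qed.

Definition driver X u s r : H := e (s - r) (F (restrict_path r X) (u r)).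

Lemma F_restrict_le X C r w : contT X -> (forall s, 0 <= s <= T -> `|X s| <= C) ->
  0 <= r <= T -> `|F (restrict_path r X) w| <= L * (1 + C).
Proof.
move=> cX XC rT; rewrite (le_trans (st_F S _ (Lambda_restrictT cX rT)))// ler_pM2l// lerD2l.
case/andP: rT => r0 rT; apply: pnorm_restrict => // s /andP[s0 sr].
by apply: XC; rewrite s0 (le_trans sr).
Qed.

Lemma q_restrict_le X C r w : contT X -> (forall s, 0 <= s <= T -> `|X s| <= C) ->
  0 <= r <= T -> `|q (restrict_path r X) w| <= L * (1 + C).
Proof.
move=> cX XC rT; rewrite (le_trans (st_q S _ (Lambda_restrictT cX rT)))// ler_pM2l// lerD2l.
case/andP: rT => r0 rT; apply: pnorm_restrict => // s /andP[s0 sr].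
by apply: XC; rewrite s0 (le_trans sr).
Qed.

Lemma driver_le X C u s r : contT X -> (forall s, 0 <= s <= T -> `|X s| <= C) ->
  0 <= r <= T -> r <= s -> `|driver X u s r| <= L * (1 + C).
Proof.
move=> cX XC rT rs; rewrite (le_trans (Hc _ _)) ?subr_ge0//; exact: F_restrict_le.
Qed.

Lemma vmeas_driver X u t a b s : contT X -> ctl t u -> 0 <= t <= a -> b <= s -> b <= T ->
  vmeas a b (driver X u s).
Proof.
move=> cX hu /andP[t0 ta] bs bT; have [C XC] := bounded_segment cX.
have a0 := le_trans t0 ta.
have inT r : a <= r <= b -> 0 <= r <= T.
  by move=> /andP[ar rb]; rewrite (le_trans a0 ar) (le_trans rb bT).
apply: (vmeas_diagonal (G := fun c r => e (s - c) (F (restrict_path c X) (u r))) (C := L * (1 + C))).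
- move=> c cab h.
  apply: (@measurable_control (fun w => `|e (s - c) (F (restrict_path c X) w) - h|) u t a b) => //.
  have [cF _] := st_cont S (Lambda_restrictT cX (inT c cab)).
  have sc : 0 <= s - c by rewrite subr_ge0 (le_trans _ bs)//; case/andP: cab.
  move=> w; apply/cvgrPdist_lt => eps eps0.
  have /cvgrPdist_lt/(_ eps eps0) := cF w; apply: filterS => w' hw'.
  rewrite (le_lt_trans (ler_dist_dist _ _))// opprB addrA subrK -linearB.
  exact: le_lt_trans (Hc _ sc) hw'.
- move=> x xab eps eps0; have xT := inT x xab.
  have eps1 : 0 < eps / (2 * L) by rewrite divr_gt0.
  have [d1 d10 hd1] := dinf_restrict_near He Hc cX xT eps1.
  have [d2 d20 hd2] := e_uniform He Hc (F (restrict_path x X) (u x)) (divr_gt0 eps0 (ltr0Sn _ 1)).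
  exists (Num.min d1 d2); first by rewrite lt_min d10.
  move=> c /andP[ac cx]; rewrite lt_min => /andP[h1 h2].
  have c0 : 0 <= c by exact: le_trans ac.
  have xs : x <= s by rewrite (le_trans _ bs)//; case/andP: xab.
  have sc : 0 <= s - c by rewrite subr_ge0 (le_trans cx).
  rewrite -(subrK (e (s - c) (F (restrict_path x X) (u x))) (e (s - c) _)) -addrA.
  rewrite (le_lt_trans (ler_normD _ _))// -linearB.
  have k1 : `|e (s - c) (F (restrict_path c X) (u x) - F (restrict_path x X) (u x))| < eps / 2.
    apply: (le_lt_trans (Hc _ sc)).
    have cT : 0 <= c <= T by rewrite c0 (le_trans cx)//; case/andP: xT.
    apply: (le_lt_trans (st_FL S _ (Lambda_restrictT cX cT) (Lambda_restrictT cX xT))).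
    have c0x : 0 <= c <= x by rewrite c0.
    have := hd1 c c0x h1; rewrite ltr_pdivlMr ?mulr_gt0//; lra.
  have k2 : `|e (s - c) (F (restrict_path x X) (u x)) - e (s - x) (F (restrict_path x X) (u x))| < eps / 2.
    apply: hd2 => //; rewrite ?subr_ge0//.
    have -> : s - c - (s - x) = x - c by ring.
    by rewrite ger0_norm ?subr_ge0//.
  lra.
- move=> x xab; rewrite -/(driver X u s x); apply: driver_le => //; first exact: inT.
  by rewrite (le_trans _ bs)//; case/andP: xab.
Qed.

Lemma bmeas_q X u t a b : contT X -> ctl t u -> 0 <= t <= a -> b <= T ->
  bmeas a b (fun r => q (restrict_path r X) (u r)).
Proof.
move=> cX hu /andP[t0 ta] bT; have [C XC] := bounded_segment cX.
have a0 := le_trans t0 ta.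
have inT r : a <= r <= b -> 0 <= r <= T.
  by move=> /andP[ar rb]; rewrite (le_trans a0 ar) (le_trans rb bT).
split; last by exists (L * (1 + C)) => x xab; apply: q_restrict_le => //; exact: inT.
apply: (measurable_diagonal (g := fun c r => q (restrict_path c X) (u r))).
  move=> c cab; apply: (@measurable_control (q (restrict_path c X)) u t a b) => //.
  by have [_] := st_cont S (Lambda_restrictT cX (inT c cab)).
move=> x xab eps eps0; have xT := inT x xab.
have eps1 : 0 < eps / L by rewrite divr_gt0.
have [d1 d10 hd1] := dinf_restrict_near He Hc cX xT eps1.
exists d1 => // c /andP[ac cx] h1.
have c0 : 0 <= c by exact: le_trans ac.
have cT : 0 <= c <= T by rewrite c0 (le_trans cx)//; case/andP: xT.
apply: (le_lt_trans (st_qL S _ (Lambda_restrictT cX cT) (Lambda_restrictT cX xT))).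
have c0x : 0 <= c <= x by rewrite c0.
by have := hd1 c c0x h1; rewrite ltr_pdivlMr// mulrC.
Qed.

Lemma norm_vint_rint a b (f : R -> H) (p : R -> R) : vmeas a b f -> bmeas a b p ->
  (forall x, a <= x <= b -> `|f x| <= p x) -> 0 <= rint a b p -> `|vint a b f| <= rint a b p.
Proof.
move=> hf hp fp p0; apply: (norm_le_ip Hip) => // h.
rewrite (ip_vint Hip Hsep)// mulrC -rintZ//; apply: le_rint; [exact: bmeas_ip|exact: bmeasZ|].
by move=> x xab; rewrite mulrC (le_trans (ip_le Hip _ _))// ler_wpM2r// fp.
Qed.

Lemma vint_diff_le a b (f g : R -> H) (p : R -> R) : vmeas a b f -> vmeas a b g ->
  bmeas a b p -> (forall x, a <= x <= b -> `|f x - g x| <= p x) -> 0 <= rint a b p ->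
  `|vint a b f - vint a b g| <= rint a b p.
Proof.
move=> hf hg hp fp p0; apply: (norm_le_ip Hip) => // h.
have mf := bmeas_ip Hip h hf; have mg := bmeas_ip Hip h hg.
rewrite ipBl !(ip_vint Hip Hsep)// -rintB// mulrC -rintZ//.
apply: le_rint; [exact: bmeasB|exact: bmeasZ|].
by move=> x xab; rewrite -ipBl mulrC (le_trans (ip_le Hip _ _))// ler_wpM2r// fp.
Qed.

(** The rate [2 L] of the weight turns the Lipschitz constant [L] into the ratio
    [1 / 2]. *)
Lemma driver_contraction X Y u t a s m : contT X -> contT Y -> ctl t u ->
  0 <= t <= a -> a <= s <= T -> 0 <= m ->
  (forall r, 0 <= r <= T -> `|X r - Y r| <= m * expR (l * r)) ->
  `|vint a s (driver X u s) - vint a s (driver Y u s)| <= m / 2 * expR (l * s).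
Proof.
move=> cX cY hu ta /andP[as_ sT] m0 XY.
have a0 : 0 <= a by case/andP: ta => /le_trans; apply.
have hb := bmeasZ (L * m) (@bmeas_exp R l a s (ltW l0)).
have hle : rint a s (fun r => L * m * expR (l * r)) <= m / 2 * expR (l * s).
  rewrite rintZ; last exact: bmeas_exp (ltW l0).
  apply: (le_trans (ler_wpM2l _ (rint_exp_le l0 as_))); first by rewrite mulr_ge0.
  suff -> : L * m * (expR (l * s) / l) = m / 2 * expR (l * s) by [].
  by rewrite {2}/l; field; rewrite gt_eqF.
apply: le_trans hle; apply: vint_diff_le => //.
- exact: (vmeas_driver (t := t)).
- exact: (vmeas_driver (t := t)).
- move=> r /andP[ar rs]; rewrite /driver -linearB (le_trans (Hc _ _)) ?subr_ge0//.
  have rT : 0 <= r <= T by rewrite (le_trans a0 ar) (le_trans rs).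
  apply: (le_trans (st_FL S _ (Lambda_restrictT cX rT) (Lambda_restrictT cY rT))).
  rewrite -mulrA ler_pM2l//; apply: (dinf_restrict_le He) => // x /andP[x0 xr].
  rewrite (le_trans (XY x _)) ?x0 ?(le_trans xr)//; first by case/andP: rT.
  by rewrite ler_wpM2l// ler_expR ler_wpM2l// ltW.
- have := rint_ge (C := 0) as_ hb; rewrite mul0r; apply => x _.
  by rewrite mulr_ge0 ?expR_ge0// mulr_ge0.
Qed.

Lemma driver_shift X u t a b s c : contT X -> ctl t u -> 0 <= t <= a -> b <= s -> b <= T ->
  0 <= c -> e c (vint a b (driver X u s)) = vint a b (driver X u (s + c)).
Proof.
move=> cX hu ta bs bT c0.
have E r : a <= r <= b -> (e c \o driver X u s) r = driver X u (s + c) r.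
  move=> /andP[_ rb] /=; rewrite /driver -(eD He)// ?subr_ge0 ?(le_trans rb)//.
  by congr (e _ _); rewrite addrA (addrC c).
have h1 : vmeas a b (driver X u s) by exact: (vmeas_driver (t := t)).
have h2 : vmeas a b (driver X u (s + c)).
  by apply: (vmeas_driver (t := t)) => //; rewrite (le_trans bs)// lerDl.
have h3 : vmeas a b (e c \o driver X u s) by apply: eq_vmeas h2 => r /E.
rewrite (vint_contraction Hip Hsep _ h1 h3); last by move=> x; exact: Hc.
exact: (eq_vint Hip Hsep).
Qed.

(** Replaces the predicate on Bochner integrals by an equation. *)
Lemma is_mildP g u X : Lambda T 0 g -> ctl (ptime g) u -> is_mild T e F g u X <->
  [/\ contT X, forall s, 0 <= s < ptime g -> X s = g s,
     forall s, ptime g <= s <= T ->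
       X s = e (s - ptime g) (g (ptime g)) + vint (ptime g) s (driver X u s)
   & forall s, ~~ (0 <= s <= T) -> X s = 0].
Proof.
move=> Lg hu; have t0 : 0 <= ptime g by case: Lg => /andP[].
split=> -[cX h1 h2 h3]; split => // s sT; have /andP[ts s_T] := sT;
  have hm : vmeas (ptime g) s (driver X u s) by apply: (vmeas_driver (t := ptime g)) => //; rewrite t0 lexx.
  by have := bochner_vint Hip Hsep hm (h2 s sT) => <-; rewrite addrC subrK.
by rewrite h2// addrC addKr; exact: (vintP Hip Hsep hm).
Qed.

Definition picard g u X s : H :=
  if 0 <= s <= T then
    if s < ptime g then g s
    else e (s - ptime g) (g (ptime g)) + vint (ptime g) s (driver X u s)
  else 0.

Lemma picard_continuous g u X : Lambda T 0 g -> ctl (ptime g) u -> contT X ->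
  contT (picard g u X).
Proof.
move=> Lg hu cX; have [/andP[t0 tT] _ cg] := Lg.
have [C XC] := bounded_segment cX.
have C0 : 0 <= C by apply: le_trans (XC 0 _); rewrite ?lexx.
have vm a s : ptime g <= a -> s <= T -> vmeas a s (driver X u s).
  by move=> ta sT; apply: (vmeas_driver (t := ptime g)) => //; rewrite t0.
apply: (@within_continuousU _ _ _ _ (ptime g)); rewrite ?t0//.
  apply: eq_within_continuous cg => s /andP[s0 st].
  rewrite /picard s0 (le_trans st tT)/=; case: ltP => // ts.
  have -> : s = ptime g by apply/le_anti; rewrite st.
  rewrite subrr (e0 He) (vintaa Hip Hsep) ?addr0//; exact: vm.
apply: (near_flow_continuous He Hc (C := L * (1 + C))); first by rewrite mulr_ge0// addr_ge0.
move=> s s' /andP[ts ss'] s'T.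
have sT := le_trans ss' s'T; have s0 := le_trans t0 ts; have s'0 := le_trans s0 ss'.
rewrite /picard s0 sT s'0 s'T/= !ltNge ts (le_trans ts ss')/=.
rewrite linearD/= -(eD He) ?subr_ge0// (driver_shift (t := ptime g))// ?subr_ge0 ?t0 ?lexx//.
rewrite addrA subrK [s + _]addrC subrK.
rewrite (@vint_split _ _ _ Hip Hsep s); [|by rewrite ts|exact: vm].
rewrite opprD addrACA subrr add0r addrAC subrr add0r.
apply: (norm_vint_le Hip Hsep) => //; first by rewrite mulr_ge0// addr_ge0.
  exact: vm.
move=> r /andP[sr rs']; apply: driver_le => //.
by rewrite (le_trans s0 sr) (le_trans rs').
Qed.

Lemma picard_contraction g u X Y m : Lambda T 0 g -> ctl (ptime g) u -> contT X -> contT Y ->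
  0 <= m -> (forall r, 0 <= r <= T -> `|X r - Y r| <= m * expR (l * r)) ->
  forall s, 0 <= s <= T -> `|picard g u X s - picard g u Y s| <= m / 2 * expR (l * s).
Proof.
move=> Lg hu cX cY m0 XY s sT; rewrite /picard sT.
case: ltP => ts; first by rewrite subrr normr0 mulr_ge0 ?expR_ge0// divr_ge0.
rewrite opprD addrACA subrr add0r; apply: (driver_contraction (t := ptime g)) => //.
  by rewrite lexx andbT; case: Lg => /andP[].
by rewrite ts; case/andP: sT.
Qed.

(** Successive iterates differ by [M * 2^-n] in the weighted norm; they converge
    uniformly, and the limit is a fixed point by [picard_contraction]. *)
Lemma mild_exists g u : Lambda T 0 g -> ctl (ptime g) u -> exists X, is_mild T e F g u X.
Proof.
move=> Lg hu; pose x n := iter n (picard g u) (flow_path e g T).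
have tT : ptime g <= T by case: Lg => /andP[].
have cx n : contT (x n).
  elim: n => [|n IH]; first by apply: (flow_continuous He Hc Lg tT).
  by apply: (picard_continuous Lg hu IH).
have E1 s : 0 <= s -> 1 <= expR (l * s).
  by move=> s0; rewrite -expR0 ler_expR mulr_ge0// ltW.
have [M0 hM0] := bounded_segment (cx 0%N); have [M1 hM1] := bounded_segment (cx 1%N).
pose M := M0 + M1.
have M_ge0 : 0 <= M.
  by apply: addr_ge0; [apply: le_trans (hM0 0 _)|apply: le_trans (hM1 0 _)]; rewrite ?lexx.
(* the sum of all the increments from rank [n] on, in the weighted norm *)
pose w n : R := 2 * M * 2^-1 ^+ n.
have w0 n : 0 <= w n by rewrite mulr_ge0 ?exprn_ge0 ?invr_ge0// mulr_ge0.
have step1 n s : 0 <= s <= T -> `|x n.+1 s - x n s| <= (w n - w n.+1) * expR (l * s).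
  have wE (i : nat) : w i - w i.+1 = M * 2^-1 ^+ i by rewrite /w exprS; field.
  elim: n s => [|n IH] s sT.
    rewrite wE expr0 mulr1; apply: (@le_trans _ _ M).
      by rewrite (le_trans (ler_normB _ _))// addrC lerD ?hM0 ?hM1.
    by rewrite ler_peMr// E1//; case/andP: sT.
  have -> : (w n.+1 - w n.+2) * expR (l * s) = (w n - w n.+1) / 2 * expR (l * s).
    by rewrite !wE exprS; field.
  apply: (picard_contraction Lg hu (cx n.+1) (cx n) _ IH) => //.
  by rewrite wE mulr_ge0// exprn_ge0// invr_ge0.
have stepk n (k : nat) s : 0 <= s <= T -> `|x (n + k)%N s - x n s| <= (w n - w (n + k)%N) * expR (l * s).
  move=> sT; elim: k => [|k IH]; first by rewrite addn0 !subrr normr0 mul0r.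
  rewrite addnS -(subrK (x (n + k)%N s) (x (n + k).+1 s)) -addrA.
  rewrite (le_trans (ler_normD _ _))//.
  by have := step1 (n + k)%N s sT; have := expR_ge0 (l * s); lra.
have stepw (m n : nat) s : 0 <= s <= T -> (n <= m)%N -> `|x m s - x n s| <= w n * expR (l * s).
  move=> sT /subnKC <-; rewrite (le_trans (stepk _ _ _ sT))// ler_wpM2r ?expR_ge0//.
  by rewrite gerBl.
have wcv (eps : R) : 0 < eps -> exists N, forall n, (N <= n)%N -> w n < eps.
  have h : w n @[n --> \oo] --> (0 : R).
    rewrite -(mulr0 (2 * M)); apply: cvgMr; apply: cvg_expr.
    by rewrite ger0_norm ?invr_ge0// invf_lt1// ltr1n.
  move=> eps0; have [N hN] := cvgn_eps h eps0.
  by exists N => n /hN; rewrite subr0; apply: le_lt_trans; exact: ler_norm.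
have xout n s : ~~ (0 <= s <= T) -> x n s = 0.
  by case: n => [|n] sT; [exact: restrict_out|rewrite /x/= /picard (negbTE sT)].
have /choice[X hX] : forall s, exists v : H, x n s @[n --> \oo] --> v.
  move=> s; have [sT|sT] := boolP (0 <= s <= T); last first.
    by exists 0; under eq_fun do rewrite xout//; exact: cvg_cst.
  apply: cauchy_seq_cvg => eps eps0.
  have [N hN] := wcv (eps / (2 * expR (l * s))) (divr_gt0 eps0 (mulr_gt0 (ltr0Sn _ 1) (expR_gt0 _))).
  exists N => m n mN nN; have := hN N (leqnn N).
  rewrite ltr_pdivlMr ?mulr_gt0 ?expR_gt0// => h.
  rewrite -(subrK (x N s) (x m s)) -addrA (le_lt_trans (ler_normD _ _))//.
  have h1 := stepw m N s sT mN; have := stepw n N s sT nN; rewrite distrC => h2; lra.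
have Xx n s : 0 <= s <= T -> `|X s - x n s| <= w n * expR (l * s).
  move=> sT; apply/ler_addgt0Pl => eps eps0.
  have [N hN] := cvgn_eps (hX s) eps0.
  have h1 := hN (maxn N n) (leq_maxl _ _); rewrite distrC in h1.
  rewrite -(subrK (x (maxn N n) s) (X s)) -addrA (le_trans (ler_normD _ _))//.
  by rewrite lerD ?(ltW h1)//; apply: stepw => //; exact: leq_maxr.
have cX : contT X.
  apply/within_continuousP => s sT eps eps0.
  have Ege : 0 < 4 * expR (l * T) by rewrite mulr_gt0 ?expR_gt0.
  have [N hN] := wcv (eps / (4 * expR (l * T))) (divr_gt0 eps0 Ege).
  have hw r : 0 <= r <= T -> `|X r - x N r| < eps / 4.
    move=> rT; apply: le_lt_trans (Xx N r rT) _; apply: (@le_lt_trans _ _ (w N * expR (l * T))).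
      by rewrite ler_wpM2l// ler_expR ler_wpM2l// ?(ltW l0)//; case/andP: rT.
    by have := hN N (leqnn N); rewrite ltr_pdivlMr//; lra.
  have e4 : 0 < eps / 4 by rewrite divr_gt0.
  have [d d0 hd] := (within_continuousP _ _ _).1 (cx N) s sT (eps / 4) e4.
  exists d => // r rT sr; have h1 := hw s sT; have h2 := hw r rT; have h3 := hd r rT sr.
  have -> : X s - X r = (X s - x N s) + (x N s - x N r) - (X r - x N r).
    by rewrite addrA subrK opprB addrA subrK.
  rewrite (le_lt_trans (ler_normB _ _))// (le_lt_trans (lerD (ler_normD _ _) (lexx _)))//; lra.
have fix_ s : 0 <= s <= T -> X s = picard g u X s.
  move=> sT; apply/eqP; rewrite -subr_eq0 -normr_le0; apply/ler_addgt0Pl => eps eps0; rewrite addr0.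
  have Ege : 0 < 2 * expR (l * s) by rewrite mulr_gt0 ?expR_gt0.
  have [N hN] := wcv (eps / (2 * expR (l * s))) (divr_gt0 eps0 Ege).
  have h1 := Xx N.+1 s sT; have := hN N.+1 (leqnSn _); have := hN N (leqnn _).
  rewrite !ltr_pdivlMr// => k1 k2.
  have h2 : `|x N.+1 s - picard g u X s| <= w N / 2 * expR (l * s).
    by apply: (picard_contraction Lg hu (cx N) cX) => // r rT; rewrite distrC Xx.
  rewrite -(subrK (x N.+1 s) (X s)) -addrA (le_trans (ler_normD _ _))//; lra.
exists X; apply/is_mildP => //; split => //.
- move=> s /andP[s0 st]; rewrite fix_ /picard ?s0 ?(le_trans (ltW st))//= st//.
- move=> s /andP[ts sT]; have s0 : 0 <= s by rewrite (le_trans _ ts)//; case: Lg => /andP[].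
  by rewrite fix_ /picard ?s0 ?sT//= ltNge ts.
- move=> s sT; have := hX s; under eq_fun do rewrite xout//.
  move=> h; apply: (@cvg_unique _ (@norm_hausdorff _ _) _ _ _ _ h); exact: cvg_cst.
Qed.

End Mild.

(** * Mild solutions: estimates, dynamic programming *)

Section ValueFunction.
Context (R : realType) (H : completeNormedModType R) (ip : {dot H for idfun})
    (T : R) (A : operator H) (e : R -> {linear H -> H}) (U : metricType R)
    (F : hpath H -> U -> H) (q : hpath H -> U -> R) (phi : hpath H -> R) (L : R).
Hypothesis S : standing ip T A e F q phi L.
Implicit Types (g k : hpath H) (X Y : R -> H) (u v : R -> U) (a b c r s t m p : R).

Let Hip := st_ip S.
Let Hsep := st_sep S.
Let T0 : 0 <= T := ltW (st_T S).
Let He := st_e S.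
Let Hc := st_contr S.
Let L0 := st_L S.
Let L0' : 0 <= L := ltW L0.
Let l := 2 * L.
Let l0 : 0 < l. Proof. by rewrite mulr_gt0. Qed.

Local Notation contT X := {within `[0, T], continuous X}.
Local Notation ctl t := (@controls R T U t).
Local Notation drv := (driver e F).

Lemma controlsW t t' u : t <= t' -> ctl t u -> ctl t' u.
Proof.
move=> tt' hu B mB; have := measurableI `[t', T]%classic _ (measurable_itv _) (hu B mB).
rewrite setIA; congr measurable; congr (_ `&` _); apply/seteqP; split => x /=; rewrite !in_itv/=.
  by case.
by move=> /andP[t'x ->]; rewrite t'x (le_trans tt').
Qed.

Lemma controls_cst t (w : U) : ctl t (fun=> w).
Proof.
move=> B _; rewrite preimage_cst; case: ifP => _; first exact: measurableI.
by rewrite setI0.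
Qed.

Definition switch t1 u v : R -> U := fun r => if r < t1 then u r else v r.

Lemma controls_switch t t1 u v : t <= t1 -> ctl t u -> ctl t1 v -> ctl t (switch t1 u v).
Proof.
move=> tt1 hu hv B mB.
rewrite (_ : _ `&` _ = ((`[t, T] `&` u @^-1` B) `&` `]-oo, t1[) `|` (`[t1, T] `&` v @^-1` B)).
  by apply: measurableU; [apply: measurableI => //; exact: hu|exact: hv].
apply/seteqP; split => x /=; rewrite /switch !in_itv/=.
  by case: ltP => xt1 [xT Bx]; [left|right; split => //; case/andP: xT].
move=> [[[xT Bx] xt1]|[/andP[t1x xT] Bx]]; first by rewrite xt1.
by rewrite ltNge t1x/= xT (le_trans tt1 t1x).
Qed.

Lemma eq_rint_co a b (f g : R -> R) : bmeas a b f -> bmeas a b g ->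
  (forall x, a <= x < b -> f x = g x) -> rint a b f = rint a b g.
Proof.
move=> hf hg fg.
have sub : `[a, b[ `<=` `[a, b].
  by move=> x /=; rewrite !in_itv/= => /andP[-> /ltW].
rewrite !rintE -!Rintegral_itv_bndo_bndc.
- by apply: eq_Rintegral => x; rewrite inE/= in_itv/=; exact: fg.
- by apply: integrableS (bmeas_int hg).
- by apply: integrableS (bmeas_int hf).
Qed.

Lemma eq_vint_co a b (f g : R -> H) : vmeas a b f -> vmeas a b g ->
  (forall x, a <= x < b -> f x = g x) -> vint a b f = vint a b g.
Proof.
move=> hf hg fg; apply: (ip_inj Hip) => h; rewrite !(ip_vint Hip Hsep)//.
by apply: eq_rint_co; [exact: bmeas_ip|exact: bmeas_ip|move=> x /fg ->].
Qed.

Lemma eq_restrict X Y r : (forall s, 0 <= s <= r -> X s = Y s) ->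
  restrict_path r X = restrict_path r Y.
Proof.
move=> XY; apply: hpath_eq => // s.
have [sr|sr] := boolP (0 <= s <= r); first by rewrite !restrictE// XY.
by rewrite !restrict_out.
Qed.

Fact mild_key : unit. Proof. exact: tt. Qed.

(** Sealed, so that conversion never unfolds the choice operator. *)
Definition mild_solution := locked_with mild_key (fun g u => mild T e F g u).

Local Notation mld g u := (mild_solution g u).

Lemma mild_solutionE g u : mild T e F g u = mld g u.
Proof. by rewrite /mild_solution locked_withE. Qed.

Lemma mildP g u : Lambda T 0 g -> ctl (ptime g) u -> is_mild T e F g u (mld g u).
Proof.
move=> Lg hu; have [X hX] := mild_exists S Lg hu.
by rewrite -mild_solutionE /mild; case: xgetP => [//|/(_ X)/=]; case.
Qed.

Lemma mild_unique g u X Y : Lambda T 0 g -> ctl (ptime g) u ->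
  is_mild T e F g u X -> is_mild T e F g u Y -> X = Y.
Proof.
move=> Lg hu /(is_mildP S _ Lg hu)[cX X1 X2 X3] /(is_mildP S _ Lg hu)[cY Y1 Y2 Y3].
have t0 : 0 <= ptime g by case: Lg => /andP[].
have [C XC] := bounded_segment cX; have [D YD] := bounded_segment cY.
have hD s : 0 <= s <= T -> 0 <= `|X s - Y s| <= C + D.
  by move=> sT; rewrite normr_ge0/= (le_trans (ler_normB _ _))// lerD ?XC ?YD.
have h0 := @weighted_gronwall R (fun s => `|X s - Y s|) T l 0 (C + D) T0 (ltW l0) (lexx _) hD.
apply/funext => s; have [sT|sT] := boolP (0 <= s <= T); last by rewrite X3// Y3.
apply/eqP; rewrite -subr_eq0 -normr_le0 -(mul0r (expR (l * s))) -{1}(mulr0 2).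
apply: h0 => // m m0 XY r /andP[r0 rT]; rewrite add0r.
have [rt|tr] := ltP r (ptime g).
  by rewrite X1 ?Y1 ?r0//= subrr normr0 mulr_ge0 ?expR_ge0// divr_ge0.
rewrite X2 ?Y2 ?tr ?rT//= opprD addrACA subrr add0r.
by apply: (driver_contraction S (t := ptime g)) => //; rewrite ?tr ?t0 ?lexx.
Qed.

Lemma mild_eq g u X : Lambda T 0 g -> ctl (ptime g) u -> is_mild T e F g u X -> mld g u = X.
Proof. by move=> Lg hu hX; apply: (mild_unique Lg hu) => //; exact: mildP. Qed.

Lemma mild_continuous g u : Lambda T 0 g -> ctl (ptime g) u -> contT (mld g u).
Proof. by move=> Lg hu; case: (mildP Lg hu). Qed.

Lemma mild_before g u s : Lambda T 0 g -> ctl (ptime g) u -> 0 <= s < ptime g ->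
  mld g u s = g s.
Proof. by move=> Lg hu; case: (mildP Lg hu) => _ + _ _; apply. Qed.

Lemma mild_out g u s : Lambda T 0 g -> ctl (ptime g) u -> ~~ (0 <= s <= T) -> mld g u s = 0.
Proof. by move=> Lg hu; case: (mildP Lg hu) => _ _ _; apply. Qed.

Lemma vmeas_drv g X u a b s : Lambda T 0 g -> ctl (ptime g) u -> contT X ->
  ptime g <= a -> b <= s -> b <= T -> vmeas a b (drv X u s).
Proof.
move=> Lg hu cX ga bs bT; apply: (vmeas_driver S (t := ptime g)) => //.
by rewrite ga andbT; case: Lg => /andP[].
Qed.

Lemma mild_after g u s t1 : Lambda T 0 g -> ctl (ptime g) u -> ptime g <= t1 <= s -> s <= T ->
  mld g u s = e (s - t1) (mld g u t1) + vint t1 s (drv (mld g u) u s).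
Proof.
move=> Lg hu /andP[tt1 t1s] sT; have cX := mild_continuous Lg hu.
have [_ _ h _] := (is_mildP S _ Lg hu).1 (mildP Lg hu).
have ts := le_trans tt1 t1s; have t1T := le_trans t1s sT.
rewrite (h s); last by rewrite ts.
rewrite (h t1); last by rewrite tt1.
rewrite linearD/= -(eD He) ?subr_ge0// addrA subrK.
rewrite (driver_shift S (t := ptime g))// ?subr_ge0 ?lexx ?andbT//; last by case: Lg => /andP[].
rewrite [t1 + _]addrC subrK -addrA; congr (_ + _).
apply: (vint_split Hip Hsep); first by rewrite tt1.
exact: (vmeas_drv Lg).
Qed.

Lemma mild_start g u : Lambda T 0 g -> ctl (ptime g) u -> mld g u (ptime g) = g (ptime g).
Proof.
move=> Lg hu; have [_ _ h _] := (is_mildP S _ Lg hu).1 (mildP Lg hu).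
have tT : ptime g <= T by case: Lg => /andP[].
rewrite h ?lexx// subrr (e0 He) (vintaa Hip Hsep) ?addr0//.
by apply: (vmeas_drv Lg) => //; exact: mild_continuous.
Qed.

Lemma restrict_mild g u : Lambda T 0 g -> ctl (ptime g) u ->
  restrict_path (ptime g) (mld g u) = g.
Proof.
move=> Lg hu; apply: hpath_eq => // s.
have [/[dup] st /andP[s0 sg]|sg] := boolP (0 <= s <= ptime g); last first.
  by rewrite restrict_out//; case: Lg => _ /(_ s sg) ->.
rewrite restrictE//; move: sg; rewrite le_eqVlt => /predU1P[->|sg].
  exact: mild_start.
by rewrite mild_before// s0.
Qed.

(** Both sides are mild solutions for the concatenated control. *)
Lemma mild_switch g u v t1 : Lambda T 0 g -> ctl (ptime g) u -> ptime g <= t1 <= T ->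
  ctl t1 v -> mld g (switch t1 u v) = mld (restrict_path t1 (mld g u)) v.
Proof.
move=> Lg hu /[dup] tt1T /andP[tt1 t1T] hv.
have t0 : 0 <= ptime g by case: Lg => /andP[].
have t10 := le_trans t0 tt1.
have cX := mild_continuous Lg hu; set X := mld g u in cX *.
have LX : Lambda T 0 (restrict_path t1 X) by apply: Lambda_restrict; rewrite ?t10.
have hw := controls_switch tt1 hu hv.
have cZ := @mild_continuous (restrict_path t1 X) v LX hv.
have Z0 : restrict_path t1 (mld (restrict_path t1 X) v) = restrict_path t1 X.
  exact: (restrict_mild (g := restrict_path t1 X)).
set Z := mld (restrict_path t1 X) v in cZ Z0 *.
have ZX s : 0 <= s <= t1 -> Z s = X s.
  by move=> st; rewrite -(restrictE Z st) Z0 restrictE.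
apply: mild_eq => //; apply/(is_mildP S _ Lg hw); split => //.
- move=> s /andP[s0 st]; rewrite ZX ?s0 ?(le_trans (ltW st))//=.
  by rewrite /X mild_before// s0.
- have E s : ptime g <= s <= t1 -> vint (ptime g) s (drv Z (switch t1 u v) s) =
      vint (ptime g) s (drv X u s).
    move=> /andP[ts st1]; have sT := le_trans st1 t1T; apply: eq_vint_co.
    + exact: (vmeas_drv Lg hw).
    + exact: (vmeas_drv Lg hu).
    + move=> r /andP[tr rs]; rewrite /driver /switch (lt_le_trans rs st1).
      congr (e _ (F _ _)); apply: eq_restrict => x /andP[x0 xr]; rewrite ZX// x0.
      by rewrite (le_trans xr)// (le_trans (ltW rs)).
  move=> s /andP[ts sT]; have [st1|/ltW t1s] := leP s t1.
    rewrite E ?ts// ZX ?st1 ?(le_trans t0 ts)// /X (mild_after (t1 := ptime g))// ?lexx//.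
    by rewrite mild_start.
  have := @mild_after (restrict_path t1 X) v s t1 LX hv.
  rewrite -/Z => ->; rewrite ?lexx//.
  rewrite (@vint_split _ _ _ Hip Hsep t1 (ptime g)); [|by rewrite tt1|exact: (vmeas_drv Lg hw)].
  have -> : vint t1 s (drv Z (switch t1 u v) s) = vint t1 s (drv Z v s).
    apply: (eq_vint Hip Hsep); first exact: (vmeas_drv Lg hw).
    by move=> r /andP[t1r _]; rewrite /driver /switch ltNge t1r.
  rewrite addrA; congr (_ + _); rewrite ZX ?t10 ?lexx// /X (mild_after (t1 := ptime g) (s := t1))// ?lexx//.
  rewrite mild_start// linearD/= -(eD He) ?subr_ge0//.
  rewrite (driver_shift S (t := ptime g))// ?subr_ge0 ?t0 ?lexx//.
  rewrite addrA subrK [t1 + _]addrC subrK; congr (_ + _).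
  apply: eq_vint_co.
  + exact: (vmeas_drv Lg hu).
  + exact: (vmeas_drv Lg hw).
  + move=> r /andP[tr rs]; rewrite /driver /switch rs.
    congr (e _ (F _ _)); apply: eq_restrict => x /andP[x0 xr]; rewrite ZX// x0.
    by rewrite (le_trans xr)// ltW.
- by move=> s sT; rewrite /Z mild_out.
Qed.

Lemma switch_id t1 u : switch t1 u u = u.
Proof. by apply/funext => r; rewrite /switch; case: ifP. Qed.

Lemma mild_ext g u v : Lambda T 0 g -> ctl (ptime g) u -> ctl (ptime g) v ->
  (forall r, ptime g <= r <= T -> u r = v r) -> mld g u = mld g v.
Proof.
move=> Lg hu hv uv; apply: mild_eq => //; apply/(is_mildP S _ Lg hu).
have [h1 h2 h3 h4] := (is_mildP S _ Lg hv).1 (mildP Lg hv); split => // s /[dup] sT /andP[ts s_T].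
rewrite h3//; congr (_ + _); apply: (eq_vint Hip Hsep); first exact: (vmeas_drv Lg hv).
by move=> r /andP[tr rs]; rewrite /driver uv// tr (le_trans rs).
Qed.

(** Constants of the a priori bounds: for the solution ([Kmild]), for [F] and
    [q] along it ([Kvel]), for its dependence on the initial path ([Kstab]) and
    that of the cost ([Kcost]). *)
Definition Kexp : R := 2 * expR (l * T).
Definition Kmild p : R := Kexp * (1 + p).
Definition Kvel p : R := L * (1 + Kmild p).
Definition Kstab p : R := Kexp * (1 + Kvel p).
Definition Kcost p : R := Kvel p + T * (L * Kstab p) + L * Kstab p.

Lemma Kexp_ge0 : 0 <= Kexp. Proof. by rewrite mulr_ge0 ?expR_ge0. Qed.
Lemma Kmild_ge0 p : 0 <= p -> 0 <= Kmild p.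
Proof. by move=> p0; rewrite mulr_ge0 ?Kexp_ge0// addr_ge0. Qed.
Lemma Kvel_ge0 p : 0 <= p -> 0 <= Kvel p.
Proof. by move=> p0; rewrite mulr_ge0// addr_ge0// Kmild_ge0. Qed.
Lemma Kstab_ge0 p : 0 <= p -> 0 <= Kstab p.
Proof. by move=> p0; rewrite mulr_ge0 ?Kexp_ge0// addr_ge0// Kvel_ge0. Qed.
Lemma Kcost_ge0 p : 0 <= p -> 0 <= Kcost p.
Proof.
move=> p0; have V0 := Kvel_ge0 p0; have S0 := Kstab_ge0 p0.
have LS := mulr_ge0 L0' S0.
by rewrite /Kcost addr_ge0// addr_ge0// mulr_ge0.
Qed.
Lemma Kcost_le p r : 0 <= p -> p <= r -> Kcost p <= Kcost r.
Proof.
move=> p0 pr; have K0 := Kexp_ge0.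
have h1 : Kmild p <= Kmild r by rewrite ler_wpM2l// lerD2l.
have h2 : Kvel p <= Kvel r by rewrite ler_wpM2l// lerD2l.
have h3 : Kstab p <= Kstab r by rewrite ler_wpM2l// lerD2l.
have h4 := ler_wpM2l L0' h3; have h5 := ler_wpM2l T0 h4.
by rewrite /Kcost; lra.
Qed.

Lemma weight_le s m : 0 <= m -> 0 <= s <= T -> 2 * m * expR (l * s) <= Kexp * m.
Proof.
move=> m0 /andP[s0 sT]; rewrite /Kexp mulrAC ler_wpM2r// ler_wpM2l// ler_expR.
by rewrite ler_wpM2l// ltW.
Qed.

(** The weighted inequality is applied to [|X s| + 1], which bounds [F / L]. *)
Lemma mild_growth g u s : Lambda T 0 g -> ctl (ptime g) u -> 0 <= s <= T ->
  `|mld g u s| <= Kmild (pnorm g).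
Proof.
move=> Lg hu sT; have cX := mild_continuous Lg hu.
set X := mld g u in cX *; have [C XC] := bounded_segment cX.
have t0 : 0 <= ptime g by case: Lg => /andP[].
have p0 := pnorm_ge0 (lexx 0) Lg.
suff : `|X s| + 1 <= 2 * (1 + pnorm g) * expR (l * s).
  move=> h; apply: (@le_trans _ _ (`|X s| + 1)); first by rewrite lerDl.
  by rewrite (le_trans h)// weight_le// addr_ge0.
apply: (@weighted_gronwall R (fun s => `|X s| + 1) T l _ (C + 1)) => //.
- exact: ltW.
- by rewrite addr_ge0.
- by move=> r rT; rewrite addr_ge0//= lerD2r XC.
move=> m m0 Xm r /andP[r0 rT].
have mE0 : 0 <= m / 2 * expR (l * r) by rewrite mulr_ge0 ?expR_ge0// divr_ge0.
have [rt|tr] := ltP r (ptime g).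
  have := Lambda_bounded Lg (s := r); rewrite r0 ltW// => /(_ isT).
  by rewrite /X mild_before ?r0//; lra.
rewrite /X (mild_after (t1 := ptime g))// ?lexx// mild_start// -/X.
have h1 : `|e (r - ptime g) (g (ptime g))| <= pnorm g.
  by rewrite (le_trans (Hc _ _)) ?subr_ge0// (Lambda_bounded Lg)// t0 lexx.
suff h2 : `|vint (ptime g) r (drv X u r)| <= m / 2 * expR (l * r).
  by have := ler_normD (e (r - ptime g) (g (ptime g))) (vint (ptime g) r (drv X u r)); lra.
have hb := bmeasZ (L * m) (@bmeas_exp R l (ptime g) r (ltW l0)).
have hle : rint (ptime g) r (fun r => L * m * expR (l * r)) <= m / 2 * expR (l * r).
  rewrite rintZ; last exact: bmeas_exp (ltW l0).
  apply: (le_trans (ler_wpM2l _ (rint_exp_le l0 tr))); first by rewrite mulr_ge0.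
  suff -> : L * m * (expR (l * r) / l) = m / 2 * expR (l * r) by [].
  by rewrite {2}/l; field; rewrite gt_eqF.
apply: le_trans hle; apply: (norm_vint_rint S) => //.
- exact: (vmeas_drv Lg).
- move=> x /andP[tx xr]; have xT : 0 <= x <= T by rewrite (le_trans t0 tx) (le_trans xr).
  rewrite (le_trans (Hc _ _)) ?subr_ge0//.
  rewrite (le_trans (st_F S _ (Lambda_restrictT cX xT)))// -mulrA ler_pM2l//.
  case/andP: xT => x0 xT; rewrite addrC -lerBrDr; apply: pnorm_restrict => // y /andP[y0 yx].
  rewrite lerBrDr (le_trans (Xm y _)) ?y0 ?(le_trans yx)//.
  by rewrite ler_wpM2l// ler_expR ler_wpM2l// ltW.
- have := rint_ge (C := 0) tr hb; rewrite mul0r; apply => x _.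
  by rewrite mulr_ge0 ?expR_ge0// mulr_ge0.
Qed.

Lemma F_mild_le g u r w : Lambda T 0 g -> ctl (ptime g) u -> 0 <= r <= T ->
  `|F (restrict_path r (mld g u)) w| <= Kvel (pnorm g).
Proof.
move=> Lg hu rT; apply: (F_restrict_le S) => //; first exact: mild_continuous.
by move=> s sT; exact: mild_growth.
Qed.

Lemma q_mild_le g u r w : Lambda T 0 g -> ctl (ptime g) u -> 0 <= r <= T ->
  `|q (restrict_path r (mld g u)) w| <= Kvel (pnorm g).
Proof.
move=> Lg hu rT; apply: (q_restrict_le S) => //; first exact: mild_continuous.
by move=> s sT; exact: mild_growth.
Qed.

Lemma vint_driver_le g u a b s : Lambda T 0 g -> ctl (ptime g) u ->
  ptime g <= a <= b -> b <= s -> b <= T ->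
  `|vint a b (drv (mld g u) u s)| <= Kvel (pnorm g) * (b - a).
Proof.
move=> Lg hu /andP[ta ab] bs bT; have t0 : 0 <= ptime g by case: Lg => /andP[].
apply: (norm_vint_le Hip Hsep) => //.
- by rewrite Kvel_ge0// (pnorm_ge0 (lexx 0) Lg).
- by apply: (vmeas_drv Lg) => //; exact: mild_continuous.
move=> r /andP[ar rb]; rewrite (le_trans (Hc _ _)) ?subr_ge0 ?(le_trans rb)//.
by apply: F_mild_le => //; rewrite (le_trans t0)// ?(le_trans ta)// (le_trans rb).
Qed.

(** With different initial times, the trajectory that starts first moves freely
    during the gap, at speed at most [Kvel]. *)
Lemma mild_stable g k u s : Lambda T 0 g -> Lambda T 0 k -> ptime g <= ptime k ->
  ctl (ptime g) u -> 0 <= s <= T ->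
  `|mld g u s - mld k u s| <= Kstab (pnorm g) * dinf T e g k.
Proof.
move=> Lg Lk gk hu sT; have hu' := controlsW gk hu.
have cX := mild_continuous Lg hu; have cY := mild_continuous Lk hu'.
set X := mld g u in cX *; set Y := mld k u in cY *.
have t0 : 0 <= ptime g by case: Lg => /andP[].
have kT : ptime k <= T by case: Lk => /andP[].
have p0 := pnorm_ge0 (lexx 0) Lg; have V0 := Kvel_ge0 p0.
pose d := dinf T e g k - `|ptime g - ptime k|.
have hd r := flow_dist_le Hc Lg Lk (s := r).
have d0 : 0 <= d by apply: le_trans (hd 0 _); rewrite ?lexx.
have dk : `|ptime g - ptime k| = ptime k - ptime g by rewrite distrC ger0_norm ?subr_ge0.
have [C XC] := bounded_segment cX; have [D YD] := bounded_segment cY.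
pose a := d + Kvel (pnorm g) * (ptime k - ptime g).
have a0 : 0 <= a by rewrite addr_ge0// mulr_ge0// subr_ge0.
suff h : `|X s - Y s| <= 2 * a * expR (l * s).
  rewrite (le_trans h)// (le_trans (weight_le a0 sT))// /Kstab -mulrA ler_wpM2l ?Kexp_ge0//.
  rewrite mulrDl mul1r lerD//; first by rewrite /d gerBl.
  by rewrite ler_wpM2l// -dk -subr_ge0 -/d.
apply: (@weighted_gronwall R (fun s => `|X s - Y s|) T l a (C + D)) => //.
- exact: ltW.
- by move=> r rT; rewrite normr_ge0/= (le_trans (ler_normB _ _))// lerD ?XC ?YD.
move=> m m0 XY r /[dup] rT' /andP[r0 rT].
have mE0 : 0 <= m / 2 * expR (l * r) by rewrite mulr_ge0 ?expR_ge0// divr_ge0.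
have k0 : 0 <= Kvel (pnorm g) * (ptime k - ptime g) by rewrite mulr_ge0// subr_ge0.
have da : d <= a by rewrite lerDl.
have [rt|tr] := ltP r (ptime g).
  have := hd r rT'; rewrite !flow_before// ?(lt_le_trans rt)// -/d.
  rewrite /X /Y !mild_before ?r0 ?(lt_le_trans rt)//; lra.
have EX : X r = flow_path e g T r + vint (ptime g) r (drv X u r).
  by rewrite flow_after// /X (mild_after (t1 := ptime g))// ?lexx// mild_start.
have hdr := hd r rT'; rewrite -/d in hdr.
have [rk|kr] := ltP r (ptime k).
  have h1 : `|vint (ptime g) r (drv X u r)| <= Kvel (pnorm g) * (ptime k - ptime g).
    rewrite (le_trans (vint_driver_le Lg hu _ _ _)) ?lexx//.
    by rewrite ler_wpM2l// lerD2r ltW.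
  have EY : Y r = flow_path e k T r by rewrite flow_before// /Y mild_before// r0.
  rewrite EX EY addrAC (le_trans (ler_normD _ _))//; rewrite /a; lra.
have EY : Y r = flow_path e k T r + vint (ptime k) r (drv Y u r).
  by rewrite flow_after// /Y (mild_after (t1 := ptime k))// ?lexx// mild_start.
have ES : vint (ptime g) r (drv X u r) = vint (ptime g) (ptime k) (drv X u r) +
    vint (ptime k) r (drv X u r).
  by apply: (vint_split Hip Hsep); [rewrite gk|exact: (vmeas_drv Lg)].
have h1 : `|vint (ptime g) (ptime k) (drv X u r)| <= Kvel (pnorm g) * (ptime k - ptime g).
  by rewrite (le_trans (vint_driver_le Lg hu _ _ _)) ?lexx.
have h2 : `|vint (ptime k) r (drv X u r) - vint (ptime k) r (drv Y u r)| <= m / 2 * expR (l * r).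
  by apply: (driver_contraction S (t := ptime g)) => //; rewrite ?t0 ?kr.
have -> : X r - Y r = (flow_path e g T r - flow_path e k T r) +
   vint (ptime g) (ptime k) (drv X u r) +
   (vint (ptime k) r (drv X u r) - vint (ptime k) r (drv Y u r)).
  by rewrite EX EY ES opprD addrACA -!addrA.
rewrite (le_trans (ler_normD _ _))// (le_trans (lerD (ler_normD _ _) (lexx _)))// /a; lra.
Qed.

Local Notation cst g u := (cost T e F q phi g u).
Local Notation V g := (value T e F q phi g).

Lemma costE g u : cst g u = rint (ptime g) T (fun r => q (restrict_path r (mld g u)) (u r)) +
  phi (restrict_path T (mld g u)).
Proof. by rewrite rintE -mild_solutionE. Qed.

Lemma bmeas_qmild g u a : Lambda T 0 g -> ctl (ptime g) u -> ptime g <= a ->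
  bmeas a T (fun r => q (restrict_path r (mld g u)) (u r)).
Proof.
move=> Lg hu ga; apply: (bmeas_q S (t := ptime g)) => //; first exact: mild_continuous.
by rewrite ga andbT; case: Lg => /andP[].
Qed.

Lemma LambdaT_mild g u : Lambda T 0 g -> ctl (ptime g) u ->
  Lambda T T (restrict_path T (mld g u)).
Proof. by move=> Lg hu; apply: Lambda_restrict => //; [rewrite !lexx|exact: mild_continuous]. Qed.

Lemma norm_cost_le g u : Lambda T 0 g -> ctl (ptime g) u ->
  `|cst g u| <= Kvel (pnorm g) * T + Kvel (pnorm g).
Proof.
move=> Lg hu; rewrite costE; have /andP[t0 tT] : 0 <= ptime g <= T by case: Lg.
have V0 := Kvel_ge0 (pnorm_ge0 (lexx 0) Lg).
rewrite (le_trans (ler_normD _ _))// lerD//.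
  rewrite (le_trans (norm_rint_le (C := Kvel (pnorm g)) tT (bmeas_qmild Lg hu (lexx _)) _))//.
    by move=> r /andP[tr rT]; apply: q_mild_le => //; rewrite (le_trans t0 tr).
  by rewrite ler_wpM2l// gerBl.
rewrite (le_trans (st_phi S (LambdaT_mild Lg hu)))// ler_pM2l// lerD2l.
by apply: pnorm_restrict => // s sT; exact: mild_growth.
Qed.

Lemma value_le g u : Lambda T 0 g -> ctl (ptime g) u -> V g <= cst g u.
Proof.
move=> Lg hu; apply: ge_inf; last by exists u.
exists (- (Kvel (pnorm g) * T + Kvel (pnorm g))) => _ [v hv <-].
by have := norm_cost_le Lg hv; rewrite ler_norml => /andP[].
Qed.

Hypothesis U0 : [set: U] !=set0.

Lemma le_value g c : (forall u, ctl (ptime g) u -> c <= cst g u) -> c <= V g.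
Proof.
move=> h; apply: lb_le_inf; last by move=> _ [u hu <-]; exact: h.
by have [w _] := U0; exists (cst g (fun=> w)), (fun=> w) => //; exact: controls_cst.
Qed.

Lemma cost_split g u v t1 : Lambda T 0 g -> ctl (ptime g) u -> ptime g <= t1 <= T -> ctl t1 v ->
  cst g (switch t1 u v) = rint (ptime g) t1 (fun r => q (restrict_path r (mld g u)) (u r)) +
    cst (restrict_path t1 (mld g u)) v.
Proof.
move=> Lg hu /[dup] tt1T /andP[tt1 t1T] hv; have hw := controls_switch tt1 hu hv.
have t0 : 0 <= ptime g by case: Lg => /andP[].
have t10 := le_trans t0 tt1; have cX := mild_continuous Lg hu.
have LX : Lambda T 0 (restrict_path t1 (mld g u)) by apply: Lambda_restrict; rewrite ?t10.
rewrite !costE mild_switch//.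
set Z := mld (restrict_path t1 (mld g u)) v.
have ZX s : 0 <= s <= t1 -> Z s = mld g u s.
  move=> st; rewrite -(restrictE Z st) -[RHS](restrictE _ st).
  by rewrite [restrict_path t1 Z](restrict_mild (g := restrict_path t1 (mld g u))).
have bq : bmeas (ptime g) T (fun r => q (restrict_path r Z) (switch t1 u v r)).
  by have := bmeas_qmild Lg hw (lexx _); rewrite mild_switch.
rewrite (@rint_split R t1 (ptime g) T); [|exact: tt1T|exact: bq].
rewrite -addrA; congr (_ + _).
  apply: eq_rint_co.
  - exact: bmeas_sub bq.
  - by apply: bmeas_sub (bmeas_qmild Lg hu (lexx _)).
  - move=> r /andP[tr rt1]; rewrite /switch rt1; congr (q _ _); apply: eq_restrict => x /andP[x0 xr].
    by rewrite ZX// x0 (le_trans xr)// ltW.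
congr (_ + _); apply: eq_rint => r /andP[t1r rT].
by rewrite /switch ltNge t1r.
Qed.

Lemma cost_ext g u v : Lambda T 0 g -> ctl (ptime g) u -> ctl (ptime g) v ->
  (forall r, ptime g <= r <= T -> u r = v r) -> cst g u = cst g v.
Proof.
move=> Lg hu hv uv; rewrite !costE (mild_ext Lg hu hv uv); congr (_ + _).
by apply: eq_rint => r rT; rewrite uv.
Qed.

Lemma dpp_le g u t1 : Lambda T 0 g -> ctl (ptime g) u -> ptime g <= t1 <= T ->
  V g <= rint (ptime g) t1 (fun r => q (restrict_path r (mld g u)) (u r)) +
    V (restrict_path t1 (mld g u)).
Proof.
move=> Lg hu tt1T; rewrite -lerBlDl; apply: le_value => v hv; rewrite lerBlDl.
rewrite -cost_split//; apply: value_le => //.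
by apply: controls_switch => //; case/andP: tt1T.
Qed.

(** A control optimal up to [eps], and a cost that splits at [t1]. *)
Lemma dpp_ge g t1 (eps : R) : Lambda T 0 g -> ptime g <= t1 <= T -> 0 < eps ->
  exists2 u, ctl (ptime g) u &
    rint (ptime g) t1 (fun r => q (restrict_path r (mld g u)) (u r)) +
    V (restrict_path t1 (mld g u)) <= V g + eps.
Proof.
move=> Lg tt1T eps0; apply: contrapT => /forall2NP hn.
suff : V g + eps <= V g by rewrite gerDl leNgt eps0.
apply: le_value => u hu; have := hn u => -[//|/negP]; rewrite -ltNge => /ltW h.
apply: (le_trans h).
have hu1 : ctl t1 u by apply: controlsW hu; case/andP: tt1T.
have -> : cst g u = cst g (switch t1 u u) by rewrite switch_id.
rewrite cost_split// lerD2l; apply: value_le => //.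
case/andP: tt1T => tt1 t1T; apply: Lambda_restrict.
- by rewrite (le_trans _ tt1)//; case: Lg => /andP[].
- by rewrite t1T andbT (le_trans _ tt1)//; case: Lg => /andP[].
- exact: mild_continuous.
Qed.

Lemma cost_stable g k u : Lambda T 0 g -> Lambda T 0 k -> ptime g <= ptime k ->
  ctl (ptime g) u -> `|cst g u - cst k u| <= Kcost (pnorm g) * dinf T e g k.
Proof.
move=> Lg Lk gk hu; have hu' := controlsW gk hu.
have t0 : 0 <= ptime g by case: Lg => /andP[].
have kT : ptime k <= T by case: Lk => /andP[].
have k0 := le_trans t0 gk.
have p0 := pnorm_ge0 (lexx 0) Lg; have V0 := Kvel_ge0 p0; have S0 := Kstab_ge0 p0.
have hd := flow_dist_le Hc Lg Lk (s := 0).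
have d0 : ptime k - ptime g <= dinf T e g k.
  have z0 : 0 <= (0 : R) <= T by rewrite lexx.
  have := le_trans (normr_ge0 _) (hd z0); rewrite subr_ge0; apply: le_trans.
  by rewrite distrC ler_norm.
have d0' : 0 <= dinf T e g k by apply: le_trans d0; rewrite subr_ge0.
have XY s := @mild_stable g k u s Lg Lk gk hu.
have cX := mild_continuous Lg hu; have cY := mild_continuous Lk hu'.
rewrite !costE (rint_split (b := ptime k)) ?gk//; last exact: bmeas_qmild.
set X := mld g u in XY cX *; set Y := mld k u in XY cY *.
have h1 : `|rint (ptime g) (ptime k) (fun r => q (restrict_path r X) (u r))| <= Kvel (pnorm g) * dinf T e g k.
  apply: (@le_trans _ _ (Kvel (pnorm g) * (ptime k - ptime g))); last by rewrite ler_wpM2l.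
  apply: norm_rint_le => //; first by apply: bmeas_sub (bmeas_qmild Lg hu (lexx _)).
  by move=> r /andP[gr rk]; apply: q_mild_le => //; rewrite (le_trans t0 gr) (le_trans rk).
have h2 : `|rint (ptime k) T (fun r => q (restrict_path r X) (u r)) -
    rint (ptime k) T (fun r => q (restrict_path r Y) (u r))| <= T * (L * Kstab (pnorm g)) * dinf T e g k.
  have b1 := bmeas_qmild Lg hu gk; have b2 := bmeas_qmild Lk hu' (lexx _).
  rewrite -rintB//; apply: (@le_trans _ _ (L * (Kstab (pnorm g) * dinf T e g k) * (T - ptime k))).
    apply: norm_rint_le => //; first exact: bmeasB.
    move=> r /andP[kr rT]; have rT' : 0 <= r <= T by rewrite (le_trans k0 kr).
    rewrite (le_trans (st_qL S _ (Lambda_restrictT cX rT') (Lambda_restrictT cY rT')))// ler_pM2l//.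
    apply: (dinf_restrict_le He) => // s /andP[s0 sr]; apply: XY.
    by rewrite s0 (le_trans sr).
  have -> : T * (L * Kstab (pnorm g)) * dinf T e g k = L * (Kstab (pnorm g) * dinf T e g k) * T by ring.
  apply: ler_wpM2l; last by rewrite gerBl.
  by apply: mulr_ge0 => //; exact: mulr_ge0.
have h3 : `|phi (restrict_path T X) - phi (restrict_path T Y)| <= L * Kstab (pnorm g) * dinf T e g k.
  rewrite (le_trans (st_phiL S (LambdaT_mild Lg hu) (LambdaT_mild Lk hu')))// -mulrA ler_pM2l//.
  apply: pnorm_le => // s sT; have {}sT : 0 <= s <= T := sT.
  change (`|restrict_path T X s - restrict_path T Y s| <= Kstab (pnorm g) * dinf T e g k).
  by rewrite !restrictE//; exact: XY.
rewrite /Kcost !mulrDl.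
move: h1 h2 h3; rewrite !ler_norml => /andP[l1 r1] /andP[l2 r2] /andP[l3 r3].
by apply/andP; split; lra.
Qed.

(** A control for the later initial time is extended by a constant one to be
    used from the earlier time. *)
Lemma value_stable g k : Lambda T 0 g -> Lambda T 0 k -> ptime g <= ptime k ->
  `|V g - V k| <= Kcost (pnorm g) * dinf T e g k.
Proof.
move=> Lg Lk gk; rewrite ler_norml; apply/andP; split; last first.
  rewrite lerBlDl -lerBlDr; apply: le_value => v hv.
  have [w _] := U0.
  have hv' : ctl (ptime g) (switch (ptime k) (fun=> w) v).
    by apply: controls_switch => //; exact: controls_cst.
  have E : cst k v = cst k (switch (ptime k) (fun=> w) v).
    apply: cost_ext => //; first exact: controlsW hv'.
    by move=> r /andP[kr _]; rewrite /switch ltNge kr.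
  have := cost_stable Lg Lk gk hv'; rewrite E ler_norml => /andP[_ h].
  by have h' := value_le Lg hv'; lra.
rewrite lerBrDl; apply: le_value => u hu.
have := cost_stable Lg Lk gk hu; rewrite ler_norml => /andP[h _].
by have := value_le Lk (controlsW gk hu); lra.
Qed.

(** The constant in [value_stable] depends on the path with the smaller final
    time, which may be either of the two. *)
Lemma value_continuous : pcont T e (Lambda T 0) (value T e F q phi).
Proof.
move=> g Lg eps eps0; have p0 := pnorm_ge0 (lexx 0) Lg.
have K0 : 0 < Kcost (pnorm g + 1) + 1 by rewrite ltr_wpDl// Kcost_ge0// addr_ge0.
exists (Num.min 1 (eps / (Kcost (pnorm g + 1) + 1))).
  by rewrite lt_min ltr01 divr_gt0.
move=> k Lk; rewrite lt_min => /andP[d1 d2].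
have k0 := pnorm_ge0 (lexx 0) Lk.
have pk : pnorm k <= pnorm g + 1.
  have kT : 0 <= ptime k <= T by case: Lk.
  case/andP: (kT) => kt0 kT'; apply: pnorm_le => // s /andP[s0 sk].
  have sT : 0 <= s <= T by rewrite s0 (le_trans sk).
  have := flow_dist_le Hc Lg Lk sT; have := flow_norm_le Hc T Lg s.
  have -> : k s = flow_path e k T s.
    move: sk; rewrite le_eqVlt => /predU1P[->|sk]; last by rewrite flow_before.
    by rewrite flow_after// subrr (e0 He).
  have := normr_ge0 (ptime g - ptime k).
  have := ler_distD 0 (flow_path e k T s) (flow_path e g T s).
  have := ler_normB (flow_path e g T s) (flow_path e g T s - flow_path e k T s).
  rewrite opprB addrCA subrr addr0; lra.
have dle c : dinf T e g k * (Kcost (pnorm g + 1) + 1) < eps ->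
    c <= pnorm g + 1 -> 0 <= c -> Kcost c * dinf T e g k < eps.
  move=> h ce c0; apply: le_lt_trans h; rewrite mulrC ler_wpM2l//.
    have z0 : 0 <= (0 : R) <= T by rewrite lexx.
    have := flow_dist_le Hc Lg Lk z0; have := normr_ge0 (ptime g - ptime k).
    have := normr_ge0 (flow_path e g T 0 - flow_path e k T 0); lra.
  by rewrite (le_trans (Kcost_le c0 ce))// lerDl.
rewrite ltr_pdivlMr// in d2.
have [gk|/ltW kg] := leP (ptime g) (ptime k).
  apply: le_lt_trans (value_stable Lg Lk gk) _; apply: dle => //.
  by rewrite lerDl.
rewrite distrC; apply: le_lt_trans (value_stable Lk Lg kg) _; rewrite (dinfC e T).
exact: dle.
Qed.

Lemma value_terminal g : Lambda T T g -> V g = phi g.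
Proof.
move=> Lg; have Lg0 := LambdaW T0 Lg.
have gT : ptime g = T by case: Lg => /le_anti.
have cE u : ctl (ptime g) u -> cst g u = phi g.
  move=> hu; rewrite costE {1}gT rintaa add0r; congr phi.
  by rewrite -{1}gT restrict_mild.
apply/le_anti; apply/andP; split.
  have [w _] := U0; rewrite -(cE (fun=> w)); last exact: controls_cst.
  by apply: value_le => //; exact: controls_cst.
by apply: le_value => u /cE ->.
Qed.

End ValueFunction.

(** * Vertical and horizontal mean value inequalities *)

Section Dini.
Context (R : realType).
Implicit Types (psi : R -> R) (a b c : R).

(** Right difference quotients bounded by [c] together with left continuity
    suffice: the set of points up to which the increment is at most [(c + eps) *
    (y - a)] is closed under limits from the left and can be prolonged on the
    right. *)
Lemma dini_le psi a b c : a <= b ->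
  (forall x, a <= x <= b -> forall eps : R, 0 < eps -> exists2 d : R, 0 < d &
     forall y, a <= y <= x -> x - y < d -> `|psi y - psi x| < eps) ->
  (forall x, a <= x < b -> forall eps : R, 0 < eps -> exists2 d : R, 0 < d &
     forall h, 0 < h -> h < d -> x + h <= b -> psi (x + h) - psi x <= (c + eps) * h) ->
  psi b - psi a <= c * (b - a).
Proof.
move=> ab lc rd; apply/ler_addgt0Pl => eps' eps'0.
pose eps := eps' / (b - a + 1).
have ba1 : 0 < b - a + 1 by rewrite ltr_wpDl// subr_ge0.
have eps0 : 0 < eps by rewrite divr_gt0.
apply: (@le_trans _ _ ((c + eps) * (b - a))); last first.
  rewrite mulrDl addrC lerD2r /eps mulrAC ler_pdivrMr// ler_pM2l//; lra.
pose S := [set x | a <= x <= b /\ forall y, a <= y <= x -> psi y - psi a <= (c + eps) * (y - a)].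
have Sa : S a.
  split; first by rewrite lexx.
  by move=> y /le_anti <-; rewrite !subrr mulr0.
have Sub : has_ubound S by exists b => x [/andP[]].
pose z := sup S.
have az : a <= z by apply: ub_le_sup.
have zb : z <= b by apply: ge_sup; [exists a|move=> x [/andP[]]].
have below y : a <= y -> y < z -> psi y - psi a <= (c + eps) * (y - a).
  move=> ay /(@sup_gt R S)[|x [_ Sx] yx]; first by exists a.
  by apply: Sx; rewrite ay ltW.
have atz : psi z - psi a <= (c + eps) * (z - a).
  have [za|za] := eqVneq z a; first by rewrite za !subrr mulr0.
  have {}az : a < z by rewrite lt_def za.
  apply/ler_addgt0Pl => e e0; have e2 : 0 < e / 2 by rewrite divr_gt0.
  have [d d0 hd] := lc z (introT andP (conj (ltW az) zb)) _ e2.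
  pose N := `|c + eps| + 1.
  have N0 : 0 < N by rewrite ltr_wpDl.
  pose m := Num.min (d / 2) (Num.min (z - a) (e / 2 / N)).
  have m0 : 0 < m by rewrite !lt_min !divr_gt0// subr_gt0 az.
  have md : m <= d / 2 by rewrite ge_min lexx.
  have ma : m <= z - a by rewrite !ge_min lexx !orbT.
  have mN : m * N <= e / 2 by rewrite -ler_pdivlMr// !ge_min lexx !orbT.
  have h1 := @below (z - m).
  have h2 : `|psi (z - m) - psi z| < e / 2 by apply: hd; lra.
  have {}h1 : psi (z - m) - psi a <= (c + eps) * (z - m - a) by apply: h1; lra.
  have h3 : - ((c + eps) * m) <= N * m.
    have hN : - (c + eps) <= N.
      by rewrite /N -normrN (le_trans (ler_norm (- (c + eps))))// lerDl.
    by rewrite -mulNr; apply: ler_wpM2r => //; exact: ltW.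
  move: h2; rewrite ltr_norml => /andP[? ?].
  have -> : (c + eps) * (z - a) = (c + eps) * (z - m - a) + (c + eps) * m by ring.
  lra.
have [zb'|zb'] := eqVneq z b; first by rewrite -zb'.
have {}zb' : z < b by rewrite lt_def eq_sym zb'.
have [d d0 hd] := rd z (introT andP (conj az zb')) _ eps0.
pose m := Num.min (d / 2) (b - z).
have m0 : 0 < m by rewrite lt_min divr_gt0//= subr_gt0.
have md : m <= d / 2 by rewrite ge_min lexx.
have mb : m <= b - z by rewrite ge_min lexx orbT.
have : z + m <= z; last by rewrite gerDl leNgt m0.
apply: ub_le_sup => //; split; first by apply/andP; split; lra.
move=> y /andP[ay ym]; have [yz|zy|->//] := ltgtP y z; first exact: below.
have := hd (y - z); rewrite subr_gt0 zy subrKC => /(_ isT) h1.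
have {}h1 : psi y - psi z <= (c + eps) * (y - z) by apply: h1; lra.
have -> : (c + eps) * (y - a) = (c + eps) * (y - z) + (c + eps) * (z - a) by ring.
lra.
Qed.

Lemma dini_norm_le psi a b c : a <= b ->
  (forall x, a <= x <= b -> forall eps : R, 0 < eps -> exists2 d : R, 0 < d &
     forall y, a <= y <= x -> x - y < d -> `|psi y - psi x| < eps) ->
  (forall x, a <= x < b -> forall eps : R, 0 < eps -> exists2 d : R, 0 < d &
     forall h, 0 < h -> h < d -> x + h <= b -> `|psi (x + h) - psi x| <= (c + eps) * h) ->
  `|psi b - psi a| <= c * (b - a).
Proof.
move=> ab lc rd; rewrite ler_norml; apply/andP; split; last first.
  apply: dini_le => // x xab eps eps0; have [d d0 hd] := rd x xab eps eps0.
  by exists d => // h h0 hd' xb; apply: le_trans (hd h h0 hd' xb); exact: ler_norm.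
have : (\- psi) b - (\- psi) a <= c * (b - a); last by rewrite /=; lra.
apply: dini_le => //= x xab eps eps0.
  have [d d0 hd] := lc x xab eps eps0; exists d => // y yx xy.
  by rewrite -normrN opprD !opprK hd.
have [d d0 hd] := rd x xab eps eps0; exists d => // h h0 hd' xb.
apply: le_trans (hd h h0 hd' xb).
by have := ler_norm (psi x - psi (x + h)); rewrite distrC /=; lra.
Qed.

End Dini.

Section VerticalHorizontal.
Context (R : realType) (H : completeNormedModType R) (ip : {dot H for idfun}).
Context (T : R) (e : R -> {linear H -> H}).
Hypothesis Hip : inner_product_of_norm ip.
Hypothesis He : C0_semigroup e.
Hypothesis Hc : contraction_semigroup e.
Implicit Types (P g k : hpath H) (x y v : H) (f : hpath H -> R) (c eps D tau : R).

Lemma bumpE P x s : 0 <= s -> s < ptime P -> bump_path P x s = P s.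
Proof. by move=> s0 sP; rewrite /bump_path restrictE ?s0 ?ltW// sP. Qed.

Lemma bump_last P x : 0 <= ptime P -> bump_path P x (ptime P) = P (ptime P) + x.
Proof. by move=> p0; rewrite /bump_path restrictE ?p0 ?lexx// ltxx. Qed.

Lemma stop_before P t s : 0 <= s <= t -> s < ptime P -> stop_path P t s = P s.
Proof. by move=> st sP; rewrite /stop_path restrictE// sP. Qed.

Lemma stop_after P t s : 0 <= s <= t -> ptime P <= s -> stop_path P t s = P (ptime P).
Proof. by move=> st sP; rewrite /stop_path restrictE// ltNge sP. Qed.

Lemma bump_bump P x y : 0 <= ptime P -> bump_path (bump_path P x) y = bump_path P (x + y).
Proof.
move=> p0; apply: hpath_eq => // s.
have [/andP[s0]|sP] := boolP (0 <= s <= ptime P); last by rewrite /bump_path !restrict_out.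
rewrite le_eqVlt => /predU1P[->|sP]; last by rewrite !bumpE.
by rewrite [LHS](@bump_last (bump_path P x))// !bump_last// addrA.
Qed.

Lemma bump0 P : 0 <= ptime P -> normal_path P -> bump_path P 0 = P.
Proof.
move=> p0 nP; apply: hpath_eq => // s.
have [/andP[s0]|sP] := boolP (0 <= s <= ptime P); last by rewrite /bump_path restrict_out// nP.
by rewrite le_eqVlt => /predU1P[->|sP]; rewrite ?bump_last ?addr0// bumpE.
Qed.

Lemma stop_stop P a b : 0 <= ptime P -> ptime P <= a -> a <= b ->
  stop_path (stop_path P a) b = stop_path P b.
Proof.
move=> p0 pa ab; apply: hpath_eq => // s.
have [/[dup] sb /andP[s0 _]|sP] := boolP (0 <= s <= b); last by rewrite /stop_path !restrict_out.
have [sa|as_] := ltP s a.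
  rewrite stop_before//; have [sp|ps] := ltP s (ptime P).
    by rewrite !stop_before// s0 ltW.
  by rewrite !stop_after// s0 ltW.
rewrite [LHS]stop_after// [LHS]stop_after ?lexx ?(le_trans p0)//.
by rewrite [RHS]stop_after// (le_trans pa).
Qed.

Lemma stop_id P : 0 <= ptime P -> normal_path P -> stop_path P (ptime P) = P.
Proof.
move=> p0 nP; apply: hpath_eq => // s.
have [/andP[s0]|sP] := boolP (0 <= s <= ptime P); last by rewrite /stop_path restrict_out// nP.
rewrite le_eqVlt => /predU1P[->|sP]; first by rewrite stop_after ?p0 ?lexx.
by rewrite stop_before ?s0 ?ltW.
Qed.

Lemma left_limitP (X : R -> H) s : cvg (X r @[r --> s^'-]) <->
  exists l : H, forall eps : R, 0 < eps -> exists2 d : R, 0 < d &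
    forall y : R, y < s -> s - d < y -> `|X y - l| < eps.
Proof.
split; first by move=> /cvg_ex[l /cvg_left_epsP h]; exists l.
by move=> [l h]; apply/cvg_ex; exists l; apply/cvg_left_epsP.
Qed.

Lemma eq_right_limit (X Y : R -> H) s t : s < t -> (forall r, s <= r < t -> X r = Y r) ->
  X r @[r --> s^'+] --> X s -> Y r @[r --> s^'+] --> Y s.
Proof.
move=> st XY /cvg_right_epsP h; apply/cvg_right_epsP => eps eps0.
have [d d0 hd] := h eps eps0; exists (Num.min d (t - s)).
  by rewrite lt_min d0 subr_gt0.
move=> y sy; rewrite -ltrBlDl lt_min => /andP[h1 h2].
rewrite -!XY ?lexx ?st ?(ltW sy)//=; last by lra.
by apply: hd => //; lra.
Qed.

Lemma eq_left_limit (X Y : R -> H) s t : t < s -> (forall r, t < r < s -> X r = Y r) ->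
  cvg (X r @[r --> s^'-]) -> cvg (Y r @[r --> s^'-]).
Proof.
move=> ts XY /left_limitP[l h]; apply/left_limitP; exists l => eps eps0.
have [d d0 hd] := h eps eps0; exists (Num.min d (s - t)).
  by rewrite lt_min d0 subr_gt0.
move=> y ys; rewrite ltrBlDr -ltrBlDl lt_min => /andP[h1 h2].
by rewrite -XY; [apply: hd => //; lra|apply/andP; split; lra].
Qed.

Lemma Lambda_hat t g : Lambda T t g -> hatLambda T t g.
Proof.
move=> [tg ng /within_continuousP cg]; split => //; split.
  move=> s /andP[s0 sg]; apply/cvg_right_epsP => eps eps0.
  have [|d d0 hd] := cg s _ eps eps0; first by rewrite s0 ltW.
  exists (Num.min d (ptime g - s)); first by rewrite lt_min d0 subr_gt0.
  move=> y sy; rewrite -ltrBlDl lt_min => /andP[h1 h2]; rewrite distrC; apply: hd.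
    by apply/andP; split; lra.
  by rewrite distrC gtr0_norm ?subr_gt0.
move=> s /andP[s0 sg]; apply/left_limitP; exists (g s) => eps eps0.
have [|d d0 hd] := cg s _ eps eps0; first by rewrite (ltW s0).
exists (Num.min d s); first by rewrite lt_min d0.
move=> y ys; rewrite ltrBlDr -ltrBlDl lt_min => /andP[h1 h2]; rewrite distrC; apply: hd.
  by apply/andP; split; lra.
by rewrite gtr0_norm ?subr_gt0.
Qed.

Lemma hat_bump P x : hatLambda T 0 P -> hatLambda T 0 (bump_path P x).
Proof.
move=> [/[dup] /andP[p0 _] pT nP [rP lP]]; split => //; first by move=> s h; exact: restrict_out.
split.
  move=> s /andP[s0 sP]; apply: (eq_right_limit (X := P) sP); last by apply: rP; rewrite s0.
  by move=> r /andP[sr rp]; rewrite bumpE// (le_trans s0).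
move=> s /andP[s0 sP]; apply: (eq_left_limit (X := P) s0); last by apply: lP; rewrite s0.
by move=> r /andP[r0 rs]; rewrite bumpE ?ltW// (lt_le_trans rs).
Qed.

Lemma hat_stop P t : hatLambda T 0 P -> ptime P <= t <= T -> hatLambda T 0 (stop_path P t).
Proof.
move=> [/[dup] /andP[p0 _] pT nP [rP lP]] /andP[pt tT]; split.
- by rewrite /= (le_trans p0).
- by move=> s h; exact: restrict_out.
split.
  move=> s /andP[s0 st]; have [sP|Ps] := ltP s (ptime P).
    apply: (eq_right_limit (X := P) sP); last by apply: rP; rewrite s0.
    by move=> r /andP[sr rp]; rewrite stop_before// (le_trans s0)//= ltW// (lt_le_trans rp).
  apply: (eq_right_limit (X := fun=> P (ptime P)) st); last exact: cvg_cst.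
  by move=> r /andP[sr rt]; rewrite stop_after// ?(le_trans s0)//= ?(le_trans Ps)// ltW.
move=> s /andP[s0 st]; have [sP|Ps] := leP s (ptime P).
  apply: (eq_left_limit (X := P) s0); last by apply: lP; rewrite s0.
  by move=> r /andP[r0 rs]; rewrite stop_before ?(lt_le_trans rs)// (ltW r0) (le_trans (ltW rs)).
apply: (eq_left_limit (X := fun=> P (ptime P)) Ps); last exact: is_cvg_cst.
by move=> r /andP[pr rs]; rewrite stop_after ?(ltW pr)// (le_trans p0 (ltW pr)) (le_trans (ltW rs)).
Qed.

Lemma is_dxP f g B : is_dx ip f g B <->
  forall eps : R, 0 < eps -> exists2 d : R, 0 < d & forall h : H, h != 0 -> `|h| < d ->
    `|f (bump_path g h) - f g - ip B h| <= eps * `|h|.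
Proof.
rewrite /is_dx; split.
  move=> /cvgrPdist_le h eps eps0; have /nbhs_norm0P[d /= d0 hd] := h eps eps0.
  exists d => // x x0 xd; have := hd x xd x0.
  by rewrite sub0r normrN ger0_norm ?divr_ge0// ler_pdivrMr ?normr_gt0.
move=> h; apply/cvgrPdist_le => eps eps0; have [d d0 hd] := h eps eps0.
apply/nbhs_norm0P; exists d => //= x /= xd x0.
by rewrite sub0r normrN ger0_norm ?divr_ge0// ler_pdivrMr ?normr_gt0//; exact: hd.
Qed.

Lemma is_dx_unique f g B B' : is_dx ip f g B -> is_dx ip f g B' -> B = B'.
Proof.
move=> /is_dxP h /is_dxP h'; apply/eqP; rewrite -subr_eq0 -normr_eq0; apply/eqP.
apply/le_anti; rewrite normr_ge0 andbT; apply/ler_addgt0Pl => eps eps0; rewrite addr0.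
have [->|x0] := eqVneq (B - B') 0; first by rewrite normr0 ltW.
have e2 : 0 < eps / 2 by rewrite divr_gt0.
have [d d0 hd] := h _ e2; have [d' d'0 hd'] := h' _ e2.
have nx : 0 < `|B - B'| by rewrite normr_gt0.
pose c := Num.min d d' / 2 / `|B - B'|.
have m0 : 0 < Num.min d d' by rewrite lt_min d0.
have c0 : 0 < c by rewrite !divr_gt0.
have nc : `|c *: (B - B')| = Num.min d d' / 2.
  by rewrite normrZ gtr0_norm// /c divfK// gt_eqF.
have cx0 : c *: (B - B') != 0 by rewrite scaler_eq0 negb_or gt_eqF.
have := hd _ cx0; have := hd' _ cx0; rewrite nc.
have md : Num.min d d' <= d by rewrite ge_min lexx.
have md' : Num.min d d' <= d' by rewrite ge_min lexx orbT.
move=> k'; have {}k' := k' (lt_le_trans _ md').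
move=> k; have {}k := k (lt_le_trans _ md).
have mh : Num.min d d' / 2 < Num.min d d' by lra.
have {}k := k mh; have {}k' := k' mh.
have E : `|ip (B - B') (c *: (B - B'))| <= eps * (Num.min d d' / 2).
  rewrite ipBl; move: k k'; rewrite !ler_norml => /andP[? ?] /andP[? ?].
  by apply/andP; split; lra.
move: E; rewrite ipZr Hip normrM gtr0_norm// ger0_norm ?sqr_ge0// -nc normrZ gtr0_norm//.
move=> E; have cx : 0 < c * `|B - B'| by rewrite mulr_gt0.
rewrite -(ler_pM2r cx); apply: le_trans E.
by rewrite expr2 mulrCA.
Qed.

Lemma dx_eq f g B : is_dx ip f g B -> dx ip f g = B.
Proof.
move=> h; apply: (is_dx_unique (f := f) (g := g)) => //.
by rewrite /dx; case: xgetP => [//|/(_ B)/=]; case.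
Qed.

(** Dini's inequality is applied to [c |-> f (bump_path P (c *: v))], whose
    derivative is given by [dx f]. *)
Lemma vertical_mean_value f P v p eps : 0 <= eps ->
  (forall g, hatLambda T 0 g -> is_dx ip f g (dx ip f g)) ->
  hatLambda T 0 P ->
  (forall c, 0 <= c <= 1 -> `|dx ip f (bump_path P (c *: v)) - p| <= eps) ->
  `|f (bump_path P v) - f P - ip p v| <= eps * `|v|.
Proof.
move=> eps0 hf hP hp; have [/andP[p0 _] nP _] := hP.
have [->|v0] := eqVneq v 0.
  by rewrite bump0// ip0r subrr subr0 !normr0 mulr0.
have nv : 0 < `|v| by rewrite normr_gt0.
pose psi c := f (bump_path P (c *: v)) - c * ip p v.
have step (c h : R) : psi (c + h) - psi c =
    (f (bump_path (bump_path P (c *: v)) (h *: v)) - f (bump_path P (c *: v))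
     - ip (dx ip f (bump_path P (c *: v))) (h *: v))
    + h * ip (dx ip f (bump_path P (c *: v)) - p) v.
  by rewrite /psi bump_bump// -scalerDl ipZr ipBl; ring.
have : `|psi 1 - psi 0| <= eps * `|v| * (1 - 0); last first.
  rewrite /psi scale1r scale0r bump0// mul1r mul0r !subr0 mulr1.
  by rewrite addrAC.
have est c (e' : R) : 0 < e' -> exists2 d : R, 0 < d & forall h : R, h != 0 -> `|h| < d ->
   `|psi (c + h) - psi c - h * ip (dx ip f (bump_path P (c *: v)) - p) v| <= e' * `|h|.
  move=> e'0; have /is_dxP/(_ (e' / `|v|)) := hf _ (hat_bump (c *: v) hP).
  rewrite divr_gt0// => /(_ isT)[d d0 hd]; exists (d / `|v|); first by rewrite divr_gt0.
  move=> h h0; rewrite ltr_pdivlMr// => hv; rewrite step addrK.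
  have hv0 : h *: v != 0 by rewrite scaler_eq0 negb_or h0.
  have := hd _ hv0; rewrite normrZ => /(_ hv).
  by rewrite mulrCA -mulrA mulVf ?mulr1 ?gt_eqF// mulrC.
apply: dini_norm_le => //.
  move=> c c01 e' e'0; have [d d0 hd] := est c 1 ltr01.
  pose N := 1 + `|ip (dx ip f (bump_path P (c *: v)) - p) v|.
  have N0 : 0 < N by rewrite ltr_pwDl.
  exists (Num.min d (e' / N)); first by rewrite lt_min d0 divr_gt0.
  move=> y /andP[y0 yc]; rewrite lt_min => /andP[h1]; rewrite ltr_pdivlMr// => h2.
  have [->|yc'] := eqVneq y c; first by rewrite subrr normr0.
  have {}yc' : y - c != 0 by rewrite subr_eq0.
  have cy : `|y - c| = c - y by rewrite distrC ger0_norm// subr_ge0.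
  have := hd _ yc'; rewrite cy subrKC => /(_ h1); rewrite mul1r.
  move=> h3; apply: le_lt_trans h2.
  rewrite -(subrK ((y - c) * ip (dx ip f (bump_path P (c *: v)) - p) v) (psi y - psi c)).
  by rewrite (le_trans (ler_normD _ _))// normrM cy /N mulrDr mulr1 lerD.
move=> c /andP[c0 c1] e' e'0; have [d d0 hd] := est c e' e'0.
exists d => // h h0 hd' _; have := hd h; rewrite gt_eqF// gtr0_norm// => /(_ isT hd') h3.
rewrite -(subrK (h * ip (dx ip f (bump_path P (c *: v)) - p) v) (psi (c + h) - psi c)).
rewrite (le_trans (ler_normD _ _))// normrM gtr0_norm//.
have h4 : `|ip (dx ip f (bump_path P (c *: v)) - p) v| <= eps * `|v|.
  by rewrite (le_trans (norm_ip_le Hip _ _))// ler_wpM2r// hp// c0 ltW.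
have := ler_wpM2l (ltW h0) h4; lra.
Qed.

(** Here only a right derivative exists, that of [c |-> f (stop_path P (ptime P
    + c))], which is why the mean value inequality is needed in Dini's form. *)
Lemma horizontal_mean_value f P D tau eps : 0 <= eps -> 0 <= D -> ptime P + D < T ->
  pcont T e (hatLambda T 0) f ->
  (forall g, (hatLambda T 0 `&` [set g | ptime g < T]) g ->
     cvg (dt_quotient f g l @[l --> 0^'+])) ->
  hatLambda T 0 P ->
  (forall c, 0 <= c <= D -> `|dt f (stop_path P (ptime P + c)) - tau| <= eps) ->
  `|f (stop_path P (ptime P + D)) - f P - D * tau| <= eps * D.
Proof.
move=> eps0 D0 pDT cf hf hP hp; have [/andP[p0 _] nP _] := hP.
pose psi c := f (stop_path P (ptime P + c)) - c * tau.
have inT c : 0 <= c <= D -> ptime P <= ptime P + c <= T.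
  by move=> /andP[c0 cD]; rewrite lerDl c0/=; lra.
have : `|psi D - psi 0| <= eps * (D - 0); last first.
  by rewrite /psi addr0 stop_id// mul0r !subr0 addrAC.
apply: dini_norm_le => //.
  move=> c /[dup] c0D /andP[c0 cD] e' e'0; have e2 : 0 < e' / 2 by rewrite divr_gt0.
  have [rho rho0 hrho] := cf _ (hat_stop hP (inT c c0D)) _ e2.
  have r2 : 0 < rho / 2 by rewrite divr_gt0.
  have [d d0 hd] := e_near0 He (P (ptime P)) r2.
  pose N := `|tau| + 1.
  have N0 : 0 < N by rewrite ltr_wpDl.
  exists (Num.min (Num.min d (rho / 2)) (e' / 2 / N)); first by rewrite !lt_min d0 r2 divr_gt0.
  move=> y /andP[y0 yc]; rewrite !lt_min => /andP[/andP[h1 h1'] h2].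
  have y0D : 0 <= y <= D by rewrite y0 (le_trans yc).
  have h3 : `|f (stop_path P (ptime P + c)) - f (stop_path P (ptime P + y))| < e' / 2.
    apply: hrho; first exact/hat_stop/inT.
    rewrite dinfC; apply: (@le_lt_trans _ _ (ptime P + c - (ptime P + y) + rho / 2)); last lra.
    apply: (dinf_le He Hc) => /=.
    - by rewrite addr_ge0.
    - by rewrite lerD2l yc; case/andP: (inT c c0D).
    - move=> s /andP[s0 sy]; rewrite ![if _ then _ else _]/(pfun (stop_path P _) s).
      have E : stop_path P (ptime P + y) s = stop_path P (ptime P + c) s.
        have sc : 0 <= s <= ptime P + c by rewrite s0 (le_trans (ltW sy))// lerD2l.
        have sy' : 0 <= s <= ptime P + y by rewrite s0 ltW.
        have [sp|ps] := ltP s (ptime P); first by rewrite !stop_before.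
        by rewrite !stop_after.
      change (`|stop_path P (ptime P + y) s - stop_path P (ptime P + c) s| <= rho / 2).
      by rewrite E subrr normr0 ltW.
    move=> s /andP[ys sc].
    change (`|e (s - (ptime P + y)) (stop_path P (ptime P + y) (ptime P + y)) -
              stop_path P (ptime P + c) s| <= rho / 2).
    have py : ptime P <= ptime P + y by rewrite lerDl.
    rewrite !stop_after ?lexx ?addr_ge0// ?(le_trans py)//; last first.
      by rewrite sc andbT (le_trans p0)// (le_trans py).
    by apply/ltW/hd; rewrite subr_ge0 ys/=; lra.
  have h4 : `|(c - y) * tau| <= e' / 2.
    rewrite normrM ger0_norm ?subr_ge0//.
    move: h2; rewrite ltr_pdivlMr// /N => h2.
    have : (c - y) * `|tau| <= (c - y) * (`|tau| + 1) by rewrite ler_wpM2l ?subr_ge0// lerDl.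
    lra.
  have -> : psi y - psi c = - (f (stop_path P (ptime P + c)) - f (stop_path P (ptime P + y)))
     + (c - y) * tau by rewrite /psi; ring.
  by rewrite (le_lt_trans (ler_normD _ _))// normrN; lra.
move=> c /andP[c0 cD] e' e'0; have c0D : 0 <= c <= D by rewrite c0 ltW.
pose g := stop_path P (ptime P + c).
have hg : hatLambda T 0 g by exact/hat_stop/inT.
have gT : ptime g < T by rewrite /=; lra.
have /cvg_right_epsP := hf g (conj hg gT); rewrite -/(dt f g) => /(_ _ e'0)[d d0 hd].
exists d => // h h0 hd' chD.
have h3 : `|h^-1 * (f (stop_path P (ptime P + (c + h))) - f g) - dt f g| < e'.
  have := hd h h0; rewrite add0r => /(_ hd'); rewrite /dt_quotient.
  have -> : stop_path g (ptime g + h) = stop_path P (ptime P + (c + h)); last by [].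
  rewrite /g stop_stop// ?lerDl ?(ltW h0)//.
  by congr stop_path; rewrite [LHS]/(ptime P + c + h) addrA.
have h4 := hp c c0D; rewrite -/g in h4.
have -> : psi (c + h) - psi c = h * (h^-1 * (f (stop_path P (ptime P + (c + h))) - f g) - dt f g)
   + h * (dt f g - tau).
  by rewrite /psi -/g mulrBr mulrA divff ?gt_eqF//; ring.
rewrite (le_trans (ler_normD _ _))// !normrM gtr0_norm//.
have := ler_wpM2l (ltW h0) (ltW h3); have := ler_wpM2l (ltW h0) h4; lra.
Qed.

End VerticalHorizontal.

(** * Functional derivative along a Lipschitz curve *)

Section Increment.
Context (R : realType) (H : completeNormedModType R) (ip : {dot H for idfun}).
Context (T : R) (A : operator H) (e : R -> {linear H -> H}).
Hypothesis Hip : inner_product_of_norm ip.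
Hypothesis Hsep : separable_space H.
Hypothesis He : C0_semigroup e.
Hypothesis HA : generates A e.
Hypothesis Hc : contraction_semigroup e.
Implicit Types (P g k : hpath H) (X Y Z : R -> H) (f : hpath H -> R) (a b r s t h eps d c : R).

Local Notation contT X := {within `[0, T], continuous X}.

Lemma C1_is_dx f g : C1 ip T e f -> hatLambda T 0 g -> is_dx ip f g (dx ip f g).
Proof. by move=> [_ h _ _ _] /h[B hB]; rewrite (dx_eq Hip hB). Qed.

Lemma restrict_time X s : ptime (restrict_path s X) = s. Proof. by []. Qed.

(** The form in which closeness to a path prolonged beyond [s] is checked: the
    prolongation stays near [Y s], and so does the orbit of [Y s]. *)
Lemma dinf_near Y s k c c' : 0 <= s -> s <= ptime k <= T ->
  (forall r, 0 <= r < s -> k r = Y r) ->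
  (forall r, s <= r <= ptime k -> `|k r - Y s| <= c) ->
  (forall a, 0 <= a <= ptime k - s -> `|e a (Y s) - Y s| <= c') -> 0 <= c + c' ->
  dinf T e (restrict_path s Y) k <= (ptime k - s) + (c + c').
Proof.
move=> s0 skT h1 h2 h3 cc; apply: (dinf_le He Hc) => //.
  move=> r /andP[r0 rs]; have rs' : r < s := rs.
  by rewrite restrictE ?r0 ?(ltW rs')// h1 ?r0// subrr normr0.
move=> r /andP[sr rk]; have sr' : s <= r := sr.
rewrite restrict_time restrictE ?s0 ?lexx//.
have -> : e (r - s) (Y s) - k r = (e (r - s) (Y s) - Y s) - (k r - Y s).
  by rewrite opprB addrA subrK.
rewrite (le_trans (ler_normB _ _))// addrC lerD// ?h2 ?h3 ?sr'//.
by rewrite subr_ge0 sr'/= lerB.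
Qed.

Lemma lipschitz_within_continuous Y a b c : 0 <= c ->
  (forall r r', a <= r -> r <= r' -> r' <= b -> `|Y r' - Y r| <= c * (r' - r)) ->
  {within `[a, b], continuous Y}.
Proof.
move=> c0 hY; apply/within_continuousP => x /andP[ax xb] eps eps0.
have c1 : 0 < c + 1 by rewrite ltr_wpDl.
exists (eps / (c + 1)); first by rewrite divr_gt0.
move=> y /andP[ay yb]; rewrite ltr_pdivlMr// => h.
have : `|Y x - Y y| <= c * `|x - y|.
  have [xy|/ltW yx] := leP x y.
    by rewrite distrC (distrC x) [`|y - x|]ger0_norm ?subr_ge0//; exact: hY.
  by rewrite [`|x - y|]ger0_norm ?subr_ge0//; exact: hY.
have := normr_ge0 (x - y); lra.
Qed.

Section LocalDerivative.
Context (f : hpath H -> R) (Y : R -> H) (s eta Lp : R).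
Hypothesis fC1 : C1 ip T e f.
Hypothesis cY : contT Y.
Hypothesis s0 : 0 <= s.
Hypothesis eta0 : 0 < eta.
Hypothesis sT : s + eta < T.
Hypothesis Lp0 : 0 <= Lp.
Hypothesis lipY : forall r r', s <= r -> r <= r' -> r' <= s + eta ->
  `|Y r' - Y r| <= Lp * (r' - r).

Let g := restrict_path s Y.
Let p := dx ip f g.
Let tau := dt f g.

(** The paths met by the Euler scheme on [[s, s + h]]: they agree with [Y] before
    [s] and then stay within [Lp * h] of [Y s]. *)
Let near h k := [/\ hatLambda T 0 k, s <= ptime k <= s + h,
  forall r, 0 <= r < s -> k r = Y r & forall r, s <= r <= ptime k -> `|k r - Y s| <= Lp * h].

Let near_derivatives eps : 0 < eps -> exists2 d : R, 0 < d & forall h k,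
  0 < h -> h < d -> h <= eta -> near h k -> `|dx ip f k - p| <= eps /\ `|dt f k - tau| <= eps.
Proof.
have ? := sT; have ? := eta0; have ? := s0.
move=> eps0; have Lg : Lambda T 0 g.
  by apply: Lambda_restrict => //; rewrite s0/=; lra.
have hg := Lambda_hat Lg; have gT : ptime g < T by rewrite restrict_time; lra.
case: fC1 => _ _ _ cdx cdt.
have [d1 d10 h1] := cdx g hg eps eps0.
have [d2 d20 h2] := cdt g (conj hg gT) eps eps0.
pose rho := Num.min d1 d2.
have rho0 : 0 < rho by rewrite lt_min d10.
have [d3 d30 h3] := e_near0 He (Y s) (divr_gt0 rho0 (ltr0Sn _ 3)).
pose d := Num.min d3 (Num.min (rho / 4) (rho / 4 / (Lp + 1))).
have Lp1 : 0 < Lp + 1 by rewrite ltr_wpDl.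
have r4 : 0 < rho / 4 by rewrite divr_gt0.
exists d; first by rewrite !lt_min d30 r4 divr_gt0.
move=> h k hpos; rewrite !lt_min => /and3P[hd3 hr]; rewrite ltr_pdivlMr// => hL heta.
move=> [hk /[dup] sk /andP[sk1 sk2] k1 k2].
have kT : ptime k < T by lra.
have : dinf T e g k < rho.
  apply: (@le_lt_trans _ _ ((ptime k - s) + (Lp * h + rho / 4))).
    apply: dinf_near => //; first by rewrite sk1 ltW.
      by move=> a /andP[a0 ak]; apply/ltW/h3; rewrite a0/=; lra.
    by apply: addr_ge0; [apply: mulr_ge0 => //; exact: ltW|exact: ltW].
  have hE : h * (Lp + 1) = Lp * h + h by ring.
  by rewrite hE in hL; lra.
rewrite lt_min => /andP[kd1 kd2].
by split; rewrite distrC ltW//; [apply: h1|apply: h2].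
Qed.

Let near_stop h k b : near h k -> ptime k <= b <= s + h -> h <= eta -> near h (stop_path k b).
Proof.
have ? := sT; have ? := eta0; have ? := s0.
move=> [hk /andP[sk ksh] k1 k2] /andP[kb bsh] heta.
have k0 : 0 <= ptime k by exact: le_trans sk.
split.
- by apply: hat_stop => //; rewrite kb/=; lra.
- by rewrite /= bsh (le_trans sk).
- move=> r /andP[r0 rs]; rewrite stop_before ?(lt_le_trans rs)//.
    by apply: k1; rewrite r0.
  by rewrite r0/= (le_trans (ltW rs))// (le_trans sk).
- move=> r /andP[sr rb]; have rb' : r <= b := rb.
  have rb0 : 0 <= r <= b by rewrite (le_trans s0).
  have [rk|kr] := ltP r (ptime k); first by rewrite stop_before// k2// sr ltW.
  by rewrite stop_after// k2// sk lexx.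
Qed.

(** One step of the scheme: the path is stopped until time [b], then jumps back
    onto [Y]. *)
Let euler_step eps d h k b : 0 <= eps -> (forall h k,
    0 < h -> h < d -> h <= eta -> near h k -> `|dx ip f k - p| <= eps /\ `|dt f k - tau| <= eps) ->
  0 < h -> h < d -> h <= eta -> near h k -> k (ptime k) = Y (ptime k) -> ptime k <= b <= s + h ->
  let k' := bump_path (stop_path k b) (Y b - Y (ptime k)) in
  near h k' /\
  `|f k' - f k - (b - ptime k) * tau - ip p (Y b - Y (ptime k))| <= eps * (1 + Lp) * (b - ptime k).
Proof.
have ? := sT; have ? := eta0; have ? := s0.
move=> eps0 hd h0 hhd heta nk kY /[dup] kbh /andP[kb bh] k'.
have [hk /[dup] skh /andP[sk ksh] k1 k2] := nk.
have k0 : 0 <= ptime k by exact: le_trans sk.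
have b0 := le_trans k0 kb.
have bT : b < T by lra.
have seta : b <= s + eta by lra.
have inS c : 0 <= c <= b - ptime k -> ptime k <= ptime k + c <= s + h.
  by move=> /andP[c0 cb]; apply/andP; split; lra.
have nS := near_stop nk kbh heta.
have SY : stop_path k b b = Y (ptime k) by rewrite stop_after ?b0 ?lexx.
set v := Y b - Y (ptime k).
have nB c : 0 <= c <= 1 -> near h (bump_path (stop_path k b) (c *: v)).
  move=> /andP[c0 c1]; have [hS Sh S1 S2] := nS; split.
  - exact: hat_bump.
  - exact: Sh.
  - by move=> r /andP[r0 rs]; rewrite bumpE ?S1 ?r0//= (lt_le_trans rs)// (le_trans sk).
  - move=> r /andP[sr rb0]; have : r <= b := rb0.
    rewrite le_eqVlt => /predU1P[->|rb]; last first.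
      by rewrite bumpE ?(le_trans s0)// S2// sr ltW.
    rewrite (@bump_last _ _ (stop_path k b))// SY.
    have -> : Y (ptime k) + c *: v - Y s = (1 - c) *: (Y (ptime k) - Y s) + c *: (Y b - Y s).
      by rewrite [LHS]addrAC scalerBl scale1r -[RHS]addrA [- _ + _]addrC -scalerBr opprB addrA subrK.
    rewrite (le_trans (ler_normD _ _))// !normrZ ger0_norm ?subr_ge0// ger0_norm//.
    have l1 : `|Y (ptime k) - Y s| <= Lp * h.
      apply: (le_trans (lipY (lexx s) sk (le_trans kb seta))).
      by rewrite ler_wpM2l// lerBlDl.
    have l2 : `|Y b - Y s| <= Lp * h.
      apply: (le_trans (lipY (lexx s) (le_trans sk kb) seta)).
      by rewrite ler_wpM2l// lerBlDl.
    have := ler_wpM2l c0 l2; have c1' : 0 <= 1 - c by lra.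
    have := ler_wpM2l c1' l1; lra.
split; first by rewrite /k' -/v -[v]scale1r; apply: nB; rewrite ler01 lexx.
have [cf _ cvdt _ _] := fC1.
have V := vertical_mean_value Hip eps0 (T := T) (fun g hg => C1_is_dx fC1 hg) (P := stop_path k b) (v := v) (p := p).
have {}V : `|f k' - f (stop_path k b) - ip p v| <= eps * `|v|.
  apply: V; first by case: nS.
  by move=> c c01; have [] := hd h _ h0 hhd heta (nB c c01).
have Q := horizontal_mean_value He Hc eps0 (T := T) (f := f) (D := b - ptime k) (P := k) (tau := tau).
have {}Q : `|f (stop_path k b) - f k - (b - ptime k) * tau| <= eps * (b - ptime k).
  move: Q; rewrite subrKC; apply => //.
  - by rewrite subr_ge0.
  move=> c cD; have [] := hd h (stop_path k (ptime k + c)) h0 hhd heta => //.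
  by apply: near_stop => //; exact: inS.
have lv : `|v| <= Lp * (b - ptime k) by exact: lipY.
have := ler_wpM2l eps0 lv; move: V Q.
move: (f k') (f (stop_path k b)) (f k) (ip p v) (`|v|) => f1 f2 f3 x nv.
rewrite !ler_norml => /andP[l1 r1] /andP[l2 r2] l3.
by apply/andP; split; lra.
Qed.

(** The path is replaced by an Euler scheme, which on each mesh interval is
    stopped and then jumps back onto [Y].  Stopping is measured by [dt f],
    jumping by [dx f], and both are close to their values at [g] by continuity.
    The jumps add up to [Y (s + h) - Y s], and the total error is a multiple of
    [h] independent of the mesh. *)
Lemma lipschitz_derivative eps : 0 < eps -> exists2 d : R, 0 < d & forall h,
  0 < h -> h < d -> h <= eta ->
  `|f (restrict_path (s + h) Y) - f g - h * tau - ip p (Y (s + h) - Y s)| <= eps * h.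
Proof.
have ? := sT; have ? := eta0; have ? := s0.
move=> eps0; have Lp1 : 0 < 1 + Lp by rewrite ltr_pwDl.
pose eps1 := eps / (1 + Lp); have eps10 : 0 < eps1 by rewrite divr_gt0.
have [d d0 hd] := near_derivatives eps10; exists d => // h h0 hhd heta.
have T0 : 0 <= T by lra.
have shT : 0 <= s + h <= T by apply/andP; split; lra.
pose mesh n i : R := s + i%:R * (h / n.+1%:R).
have grid n i : (i <= n.+1)%N -> exists k, [/\ near h k, ptime k = mesh n i,
    k (ptime k) = Y (ptime k),
    forall r, s <= r <= mesh n i -> `|k r - Y r| <= Lp * (h / n.+1%:R) &
    `|f k - f g - (mesh n i - s) * tau - ip p (Y (mesh n i) - Y s)| <= eps * (mesh n i - s)].
  have n0 : 0 < n.+1%:R :> R by [].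
  have hn0 : 0 < h / n.+1%:R by rewrite divr_gt0.
  elim: i => [|i IH] ilen.
    exists g; rewrite /mesh mul0r addr0; split.
    - split => //.
      + by apply/Lambda_hat/Lambda_restrict => //; rewrite s0/=; lra.
      + by rewrite restrict_time; apply/andP; split; lra.
      + by move=> r /andP[r0 rs]; rewrite restrictE// r0 ltW.
      + move=> r; rewrite restrict_time => /le_anti <-.
        by rewrite restrictE ?s0 ?lexx// subrr normr0 mulr_ge0// ltW.
    - by [].
    - by rewrite restrict_time restrictE ?s0 ?lexx.
    - move=> r /le_anti <-; rewrite restrictE ?s0 ?lexx// subrr normr0 mulr_ge0// ltW//.
    - by rewrite !subrr ip0r mul0r !subr0 normr0 mulr0.
  have [k [nk kt kY kr kf]] := IH (ltnW ilen).
  have E : mesh n i.+1 = mesh n i + h / n.+1%:R by rewrite /mesh -natr1 mulrDl mul1r addrA.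
  have bh : ptime k <= mesh n i.+1 <= s + h.
    rewrite kt E lerDl ltW//= -E /mesh lerD2l mulrCA.
    rewrite -[X in _ <= X]mulr1 ler_pM2l// ler_pdivrMr// mul1r ler_nat//.
  have [nk' hk'] := euler_step (ltW eps10) hd h0 hhd heta nk kY bh.
  have m0 : 0 <= mesh n i.+1.
    by case/andP: bh => bh _; apply: le_trans bh; case: nk => _ /andP[]; move=> *; lra.
  have sm : s <= mesh n i by rewrite /mesh lerDl mulr_ge0// ltW.
  exists (bump_path (stop_path k (mesh n i.+1)) (Y (mesh n i.+1) - Y (ptime k))).
  have last_ : stop_path k (mesh n i.+1) (mesh n i.+1) = Y (ptime k).
    by rewrite stop_after ?m0 ?lexx//; case/andP: bh.
  have bl : bump_path (stop_path k (mesh n i.+1)) (Y (mesh n i.+1) - Y (ptime k)) (mesh n i.+1)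
       = Y (mesh n i.+1).
    by rewrite (@bump_last _ _ (stop_path k (mesh n i.+1)))// last_ subrKC.
  split => //.
  - move=> r /andP[sr]; rewrite le_eqVlt => /predU1P[->|rm].
      by rewrite bl subrr normr0 mulr_ge0// ltW.
    have r0 := le_trans s0 sr.
    rewrite bumpE//; have rm' : 0 <= r <= mesh n i.+1 by rewrite r0 ltW.
    have [rk|kr'] := ltP r (ptime k).
      by rewrite stop_before// kr// sr -kt ltW.
    rewrite stop_after// kY distrC (le_trans (lipY _ _ _))//.
    + by rewrite kt.
    + by rewrite (le_trans (ltW rm))// (le_trans (proj2 (andP bh)))//; lra.
    + by rewrite ler_wpM2l// kt lerBlDl -E ltW.
  - rewrite kt in hk'; rewrite E in hk' *.
    have e1 : eps1 * (1 + Lp) = eps by rewrite /eps1 divfK// gt_eqF.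
    rewrite e1 -E in hk'; rewrite -E.
    have -> : ip p (Y (mesh n i.+1) - Y s) = ip p (Y (mesh n i.+1) - Y (mesh n i)) + ip p (Y (mesh n i) - Y s).
      by rewrite -ipDr addrA subrK.
    rewrite kt; move: kf hk'; rewrite !ler_norml => /andP[l1 r1] /andP[l2 r2].
    by apply/andP; split; lra.
have [cf _ _ _ _] := fC1.
have hY : hatLambda T 0 (restrict_path (s + h) Y) by apply/Lambda_hat/Lambda_restrict => //; case/andP: shT.
apply/ler_addgt0Pl => e' e'0.
have [rho rho0 hrho] := cf _ hY e' e'0.
have [N hN] : exists N, Lp * (h / N.+1%:R) < rho.
  exists (Num.truncn (Lp * h / rho)).
  rewrite mulrA ltr_pdivrMr// [X in _ < X]mulrC -ltr_pdivrMr//; exact: truncnS_gt.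
have [k [nk kt kY kr kf]] := grid N N.+1 (leqnn _).
have mE : mesh N N.+1 = s + h by rewrite /mesh mulrCA divff ?mulr1.
rewrite mE in kt kr kf.
have kh : hatLambda T 0 k by case: nk.
have : `|f (restrict_path (s + h) Y) - f k| < e'.
  apply: hrho => //; apply: (@le_lt_trans _ _ (ptime k - (s + h) + Lp * (h / N.+1%:R))); last first.
    by rewrite kt subrr add0r.
  have sh0 : 0 <= s + h by case/andP: shT.
  have c0 : 0 <= Lp * (h / N.+1%:R) by rewrite mulr_ge0// divr_ge0// ltW.
  apply: (dinf_le He Hc) => //; first by rewrite restrict_time kt lexx; case/andP: shT.
    move=> r /andP[r0 rs]; have rs' : r < s + h := rs.
    rewrite restrictE ?r0 ?(ltW rs')//; have [rs1|sr] := ltP r s.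
      by case: nk => _ _ k1 _; rewrite k1 ?r0// subrr normr0.
    by rewrite distrC kr// sr ltW.
  move=> r; rewrite kt restrict_time => /le_anti <-.
  rewrite subrr (e0 He) restrictE ?sh0 ?lexx// distrC kr//.
  by rewrite lexx lerDl ltW.
move: kf; rewrite [s + h - s]addrC addKr ltr_norml ler_norml => /andP[l1 r1] /andP[l2 r2].
by rewrite ler_norml; apply/andP; split; lra.
Qed.

End LocalDerivative.

End Increment.

(** * Chords of a driven curve *)

(** Keeps of a controlled trajectory only what the expansions use.  No control
    appears, and the bound [C] on the velocity is fixed beforehand, so that
    estimates over this class are uniform over the controls. *)
Record flow_driven (R : realType) (H : completeNormedModType R) (T : R)
    (e : R -> {linear H -> H}) (t C : R) (X G : R -> H) : Prop := FlowDriven {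
  fd_cont : {within `[0, T], continuous X};
  fd_meas : vmeas t T G;
  fd_bound : forall r, t <= r <= T -> `|G r| <= C;
  fd_emeas : forall b, t <= b <= T -> vmeas t b (fun r => e (b - r) (G r));
  fd_eq : forall a b, t <= a -> a <= b -> b <= T ->
    X b = e (b - a) (X a) + vint a b (fun r => e (b - r) (G r)) }.

Section Polygon.
Context (R : realType) (H : completeNormedModType R) (ip : {dot H for idfun}).
Context (T : R) (A : operator H) (e : R -> {linear H -> H}).
Hypothesis Hip : inner_product_of_norm ip.
Hypothesis Hsep : separable_space H.
Hypothesis He : C0_semigroup e.
Hypothesis HA : generates A e.
Hypothesis Hc : contraction_semigroup e.
Implicit Types (P g k : hpath H) (X Y Z G : R -> H) (f : hpath H -> R).
Implicit Types (a b r s t h eps d c C kappa : R).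

Local Notation contT X := {within `[0, T], continuous X}.

Lemma driven_increment t C X G a b : 0 <= C -> flow_driven T e t C X G ->
  t <= a -> a <= b -> b <= T -> `|vint a b (fun r => e (b - r) (G r))| <= C * (b - a).
Proof.
move=> C0 dX ta ab bT; have tb : t <= b <= T by rewrite (le_trans ta).
apply: (norm_vint_le Hip Hsep) => //.
  exact: vmeas_sub (fd_emeas dX tb).
move=> r /andP[ar rb]; rewrite (le_trans (Hc _ _)) ?subr_ge0// (fd_bound dX)//.
by rewrite (le_trans ta)// (le_trans rb).
Qed.

Lemma driven_near t C X G b : 0 <= C -> flow_driven T e t C X G -> t <= b <= T ->
  `|X b - X t| <= C * (b - t) + `|e (b - t) (X t) - X t|.
Proof.
move=> C0 dX /andP[tb bT]; rewrite (fd_eq dX (lexx t) tb bT) addrAC addrC.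
by rewrite (le_trans (ler_normD _ _))// lerD2r (driven_increment C0 dX).
Qed.

(** Since [p] lies in the domain of the adjoint, the unbounded part of a chord
    can be tested against it. *)
Lemma adjoint_chord p a D x y kappa : 0 <= a -> 0 < D -> odom (adjoint ip A) p -> 0 <= kappa ->
  (forall r, 0 <= r <= D -> `|e r x - y| <= kappa) ->
  `|ip p (e D x - x) - D * ip (oval (adjoint ip A) p) y| <= `|oval (adjoint ip A) p| * (kappa * D).
Proof.
move=> a0 D0 hp k0 hk; rewrite (adjoint_orbit Hip Hsep He HA Hc x (ltW D0) hp) -ipZr -ipBr.
rewrite (le_trans (norm_ip_le Hip _ _))// ler_wpM2l//.
have := vint_near Hip Hsep (f := fun r => e r x) (v := y) (ltW D0) k0; rewrite subr0; apply => //.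
exact/vmeas_continuous/e_continuous.
Qed.

(** Polygons are built one edge at a time: [Z] is followed until time [a], then
    the segment to [y] reached at time [b]. *)
Definition chord Z a b (y : H) : R -> H := fun r =>
  if r <= a then Z r else if r <= b then Z a + ((r - a) / (b - a)) *: (y - Z a) else y.

Lemma chord_before Z a b y r : r <= a -> chord Z a b y r = Z r.
Proof. by rewrite /chord => ->. Qed.

Lemma chordE Z a b y r : a < b -> a <= r <= b ->
  chord Z a b y r = Z a + ((r - a) / (b - a)) *: (y - Z a).
Proof.
move=> ab /andP[]; rewrite le_eqVlt => /predU1P[<- _|ar rb].
  by rewrite /chord lexx subrr mul0r scale0r addr0.
by rewrite /chord leNgt ar/= rb.
Qed.

Lemma chord_end Z a b y : a < b -> chord Z a b y b = y.
Proof.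
move=> ab; rewrite chordE// ?lexx ?ltW// divff ?subr_eq0 ?gt_eqF//.
by rewrite scale1r subrKC.
Qed.

Lemma chord_after Z a b y r : a < b -> b <= r -> chord Z a b y r = y.
Proof.
move=> ab; rewrite le_eqVlt => /predU1P[<-|br]; first exact: chord_end.
by rewrite /chord !leNgt br (lt_trans ab br).
Qed.

Lemma chordB Z a b y r s : a < b -> a <= r <= b -> a <= s <= b ->
  chord Z a b y s - chord Z a b y r = ((s - r) / (b - a)) *: (y - Z a).
Proof.
move=> ab rab sab; rewrite !chordE// opprD addrACA subrr add0r -scalerBl -mulrBl.
by congr ((_ / _) *: _); ring.
Qed.

Lemma chord_continuous Z a b y : 0 <= a -> a < b -> b <= T -> contT Z -> contT (chord Z a b y).
Proof.
move=> a0 ab bT cZ; have aT := le_trans (ltW ab) bT.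
apply: (@within_continuousU _ _ _ _ a); rewrite ?a0//.
  apply: (eq_within_continuous (X := Z)); last exact: within_continuousS cZ.
  by move=> r /andP[_ ra]; rewrite chord_before.
apply: (@within_continuousU _ _ _ _ b); rewrite ?(ltW ab)//.
  apply: (@lipschitz_within_continuous _ _ _ _ _ (`|y - Z a| / (b - a))).
    by rewrite divr_ge0// subr_ge0 ltW.
  move=> r s ar rs sb; rewrite chordB ?ar ?(le_trans rs)//= ?(le_trans ar)//.
  rewrite normrZ ger0_norm; last by rewrite divr_ge0 ?subr_ge0// ltW.
  by rewrite mulrC mulrA mulrAC.
apply: (eq_within_continuous (X := fun=> y)).
  by move=> r /andP[br _]; rewrite chord_after.
by apply: continuous_subspaceT => r; exact: cvg_cst.
Qed.

Lemma chord_near Z a b y (z : H) c r : a < b -> a <= r <= b ->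
  `|Z a - z| <= c -> `|y - z| <= c -> `|chord Z a b y r - z| <= c.
Proof.
move=> ab rab h1 h2; rewrite chordE//; have /andP[ar rb] := rab.
set q := (r - a) / (b - a).
have q0 : 0 <= q by rewrite divr_ge0 ?subr_ge0// ltW.
have q1 : q <= 1 by rewrite ler_pdivrMr ?subr_gt0// mul1r lerD2r.
clearbody q.
have -> : Z a + q *: (y - Z a) - z = (1 - q) *: (Z a - z) + q *: (y - z).
  by rewrite [LHS]addrAC scalerBl scale1r -[RHS]addrA [- _ + _]addrC -scalerBr opprB addrA subrK.
rewrite (le_trans (ler_normD _ _))// !normrZ ger0_norm ?subr_ge0// ger0_norm//.
have q1' : 0 <= 1 - q by rewrite subr_ge0.
have := ler_wpM2l q0 h2; have := ler_wpM2l q1' h1. lra.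
Qed.

Lemma dinf_restrict_left f X s eps : contT X -> 0 <= s <= T -> 0 < eps ->
  pcont T e (hatLambda T 0) f ->
  exists2 d : R, 0 < d & forall c, 0 <= c <= s -> s - c < d ->
    `|f (restrict_path c X) - f (restrict_path s X)| < eps.
Proof.
move=> cX /[dup] sT' /andP[s0 sT] eps0 cf.
have hs : hatLambda T 0 (restrict_path s X).
  by apply: Lambda_hat; apply: Lambda_restrict.
have [rho rho0 hrho] := cf _ hs eps eps0.
have [d d0 hd] := dinf_restrict_near He Hc cX sT' rho0.
exists d => // c /andP[c0 cs] sc; rewrite distrC; apply: hrho.
  by apply: Lambda_hat; apply: Lambda_restrict => //; rewrite c0 (le_trans cs).
by rewrite dinfC; apply: hd => //; rewrite c0.
Qed.

(** The derivative of [f] along the segment is [dt f + (dx f, X b - X a) / (b -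
    a)], at the current path.  The numerator is split into an increment of an
    orbit, to which [adjoint_chord] applies, and an integral in which the
    semigroup is removed by weak uniform continuity.  Dini's inequality then
    integrates the resulting bound. *)
Lemma segment_increment f k X G C Z a b kappa eps :
  let t := ptime k in let p := dx ip f k in let pA := oval (adjoint ip A) p in
  Phi ip A T e f -> 0 <= t -> 0 <= C -> 0 <= kappa -> 0 <= eps ->
  flow_driven T e t C X G -> contT Z -> t <= a -> a < b -> b < T ->
  Z a = X a ->
  (forall r, 0 <= r <= b - a -> `|e r (X a) - k t| <= kappa) ->
  (forall r v, 0 <= r <= b - a -> `|ip p (e r v - v)| <= eps * `|v|) ->
  (forall s, a <= s <= b -> let g := restrict_path s (chord Z a b (X b)) in
     [/\ `|dx ip f g - p| <= eps, `|dt f g - dt f k| <= eps &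
         `|oval (adjoint ip A) (dx ip f g) - pA| <= eps]) ->
  `|f (restrict_path b (chord Z a b (X b))) - f (restrict_path a Z)
     - (b - a) * (dt f k + ip pA (k t)) - rint a b (fun r => ip p (G r))|
  <= (eps + (eps * (`|k t| + kappa) + `|pA| * kappa) + 2 * eps * C) * (b - a).
Proof.
move=> t p pA [fC1 fdom fcA] t0 C0 kappa0 eps0 dX cZ ta ab bT ZX hflow hweak hnear.
have a0 := le_trans t0 ta; have ba0 : 0 < b - a by rewrite subr_gt0.
have ba : b - a != 0 by rewrite gt_eqF.
set Y := chord Z a b (X b).
have cY : contT Y by apply: chord_continuous => //; exact: ltW.
set D := b - a in ba ba0 hflow hweak *.
pose I := rint a b (fun r => ip p (G r)).
pose v := X b - X a.
pose w := vint a b (fun r => e (b - r) (G r)).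
have vE : v = (e D (X a) - X a) + w.
  by rewrite /v (fd_eq dX ta (ltW ab) (ltW bT)) addrAC.
have mG : vmeas a b G by apply: vmeas_sub (fd_meas dX) => //; exact: ltW.
have mE : vmeas a b (fun r => e (b - r) (G r)).
  by apply: vmeas_sub (fd_emeas dX (b := b) _) => //; rewrite (le_trans ta (ltW ab)) ltW.
have inT r : a <= r <= b -> t <= r <= T.
  by move=> /andP[ar rb]; rewrite (le_trans ta ar) (le_trans rb (ltW bT)).
have nw : `|w| <= C * D by apply: (driven_increment C0 dX) => //; exact: ltW.
have wI : `|ip p w - I| <= eps * C * D.
  rewrite /w ipC (ip_vint Hip Hsep)// /I -rintB; last 2 first.
  - exact: bmeas_ip.
  - by apply: eq_bmeas (bmeas_ip Hip p mG) => r _; rewrite ipC.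
  apply: norm_rint_le; first exact: ltW.
    by apply: bmeasB; [exact: bmeas_ip|apply: eq_bmeas (bmeas_ip Hip p mG) => r _; rewrite ipC].
  move=> r /[dup] rab /andP[ar rb]; rewrite ipC -ipBr (le_trans (hweak _ _ _))//.
    by rewrite subr_ge0 rb/= /D; lra.
  by rewrite ler_wpM2l// (fd_bound dX) ?inT.
pose rate := dt f k + ip pA (k t) + I / D.
have rateD : D * rate = D * (dt f k + ip pA (k t)) + I.
  by rewrite /rate mulrDr mulrCA divff ?mulr1.
pose E := eps + (eps * (`|k t| + kappa) + `|pA| * kappa) + 2 * eps * C.
suff : `|(f (restrict_path b Y) - b * rate) - (f (restrict_path a Y) - a * rate)| <= E * (b - a).
  have -> : restrict_path a Y = restrict_path a Z.
    apply: hpath_eq => // r; have [/andP[r0 ra]|ra] := boolP (0 <= r <= a); last by rewrite !restrict_out.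
    by rewrite !restrictE ?r0// /Y chord_before.
  move: (f (restrict_path b Y)) (f (restrict_path a Z)) => f1 f2.
  rewrite -/D -/E -/I; congr (`|_| <= _).
  rewrite -[D * (_ + _)](addrK I) -rateD /D; ring.
apply: (dini_norm_le (psi := fun s => f (restrict_path s Y) - s * rate)); first exact: ltW.
  move=> s /[dup] sab /andP[as_ sb] e' e'0; have e2 : 0 < e' / 2 by rewrite divr_gt0.
  have sT : 0 <= s <= T by have /andP[h ->] := inT s sab; rewrite (le_trans t0 h).
  have [cf _ _ _ _] := fC1.
  have [d d0 hd] := dinf_restrict_left cY sT e2 cf.
  pose N := `|rate| + 1; have N0 : 0 < N by rewrite ltr_wpDl.
  exists (Num.min d (e' / 2 / N)); first by rewrite lt_min d0 divr_gt0.
  move=> y /andP[ay ys]; rewrite lt_min => /andP[h1]; rewrite ltr_pdivlMr// => h2.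
  have := hd y; rewrite (le_trans a0 ay) ys => /(_ isT h1).
  have h3 : `|(s - y) * rate| <= e' / 2.
    rewrite normrM ger0_norm ?subr_ge0//.
    have : (s - y) * `|rate| <= (s - y) * N by rewrite ler_wpM2l ?subr_ge0// /N lerDl.
    lra.
  move: (f (restrict_path y Y)) (f (restrict_path s Y)) => f1 f2 h4.
  have -> : f1 - y * rate - (f2 - s * rate) = (f1 - f2) + (s - y) * rate by ring.
  by rewrite (le_lt_trans (ler_normD _ _))//; lra.
move=> s /[dup] sab' /andP[as_ sb] e' e'0.
have sab : a <= s <= b by rewrite as_ ltW.
have s0 := le_trans a0 as_.
have [n1 n2 n3] := hnear s sab; rewrite -/Y in n1 n2 n3.
set g := restrict_path s Y in n1 n2 n3.
have Lg : Lambda T 0 g.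
  by apply: Lambda_restrict => //; rewrite s0; case/andP: (inT s sab).
pose ps := dx ip f g; rewrite -/ps in n1 n3.
have YB r r' : a <= r -> r <= r' -> r' <= b -> Y r' - Y r = ((r' - r) / D) *: v.
  move=> ar rr' r'b; rewrite /Y chordB ?ar ?(le_trans rr' r'b) ?r'b ?(le_trans ar rr')//.
  by rewrite ZX.
have eta0 : 0 < b - s by rewrite subr_gt0.
have sbT : s + (b - s) < T by rewrite subrKC.
have Lp0 : 0 <= `|v| / D by rewrite divr_ge0// ltW.
have lipY r r' : s <= r -> r <= r' -> r' <= s + (b - s) -> `|Y r' - Y r| <= `|v| / D * (r' - r).
  move=> sr rr'; rewrite subrKC => r'b; rewrite YB// ?(le_trans as_)//.
  rewrite normrZ ger0_norm; last by rewrite divr_ge0 ?subr_ge0// ltW.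
  by rewrite mulrC mulrA mulrAC.
have [d d0 hd] := lipschitz_derivative Hip He Hc fC1 cY s0 eta0 sbT Lp0 lipY e'0.
have key : `|D * dt f g + ip ps v - D * rate| <= E * D.
  rewrite rateD vE ipDr.
  have k1 : `|ip ps (e D (X a) - X a) - D * ip (oval (adjoint ip A) ps) (k t)| <=
      `|oval (adjoint ip A) ps| * (kappa * D) by apply: (@adjoint_chord _ a) => //; exact: fdom.
  have nps : `|oval (adjoint ip A) ps| <= `|pA| + eps.
    rewrite -(subrK pA (oval (adjoint ip A) ps)) addrC (le_trans (ler_normD _ _))//.
    by rewrite lerD2l.
  have k2 : `|ip (oval (adjoint ip A) ps) (k t) - ip pA (k t)| <= eps * `|k t|.
    by rewrite -ipBl (le_trans (norm_ip_le Hip _ _))// ler_wpM2r.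
  have k3 : `|ip ps w - ip p w| <= eps * (C * D).
    by rewrite -ipBl (le_trans (norm_ip_le Hip _ _))// ler_pM.
  have kD0 : 0 <= kappa * D by rewrite mulr_ge0// ltW.
  have k4 := le_trans k1 (ler_wpM2r kD0 nps).
  have k5 := ler_wpM2l (ltW ba0) k2.
  have k6 : `|D * (ip (oval (adjoint ip A) ps) (k t) - ip pA (k t))| <= D * (eps * `|k t|).
    by rewrite normrM gtr0_norm// ler_pM2l.
  have k7 : `|D * (dt f g - dt f k)| <= D * eps by rewrite normrM gtr0_norm// ler_pM2l.
  move: k4 k6 k7 k3 wI; rewrite /E.
  move: (ip ps _) (ip ps w) (ip p w) (ip (oval _ ps) _) (ip pA _) (dt f g) (dt f k) => x1 x2 x3 x4 x5 x6 x7.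
  rewrite !ler_norml => /andP[l1 r1] /andP[l2 r2] /andP[l3 r3] /andP[l4 r4] /andP[l5 r5].
  by clear - l1 r1 l2 r2 l3 r3 l4 r4 l5 r5; apply/andP; split; lra.
exists d => // h h0 hd' shb; have := hd h h0 hd'; rewrite -(lerD2l s h) subrKC => /(_ shb).
have sh : s + h - s = h by rewrite addrAC subrr add0r.
rewrite -/g -/ps YB ?lerDl ?(ltW h0)// sh ipZr.
have key' : `|h / D * (D * dt f g + ip ps v - D * rate)| <= E * h.
  rewrite normrM gtr0_norm ?divr_gt0//.
  have hD : 0 <= h / D by rewrite divr_ge0// ltW.
  by apply: (le_trans (ler_wpM2l hD key)); rewrite mulrCA divfK.
move: key'; have -> : h / D * (D * dt f g + ip ps v - D * rate) =
    h * dt f g + h / D * ip ps v - h * rate.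
  by rewrite !mulrBr mulrDr !mulrA divfK.
move: (f (restrict_path (s + h) Y)) (f g) (h / D * ip ps v) => f1 f2 x.
rewrite !ler_norml => /andP[l1 r1] /andP[l2 r2].
have -> : (E + e') * h = E * h + e' * h by ring.
by clear - l1 r1 l2 r2; apply/andP; split; lra.
Qed.

End Polygon.

(** * Increment of a test functional along a driven curve *)

Section TestIncrement.
Context (R : realType) (H : completeNormedModType R) (ip : {dot H for idfun}).
Context (T : R) (A : operator H) (e : R -> {linear H -> H}).
Hypothesis Hip : inner_product_of_norm ip.
Hypothesis Hsep : separable_space H.
Hypothesis He : C0_semigroup e.
Hypothesis HA : generates A e.
Hypothesis Hc : contraction_semigroup e.
Implicit Types (P g k : hpath H) (X Y Z G : R -> H) (f : hpath H -> R).
Implicit Types (a b r s t h eps d c C kappa omega : R).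

Local Notation contT X := {within `[0, T], continuous X}.

(** Induction on the number of edges.  The hypothesis on [f] is only required of
    paths near [k], among which are all the polygons, and the conclusion carries
    this closeness along with the estimate. *)
Lemma polygon_increment f k X G C d kappa eps E n omega :
  let t := ptime k in let x := k t in let p := dx ip f k in
  let pA := oval (adjoint ip A) p in let mesh i := t + i%:R * (d / n.+1%:R) in
  Phi ip A T e f -> 0 <= t -> 0 <= C -> 0 <= kappa -> 0 <= eps -> 0 < d -> t + d < T ->
  flow_driven T e t C X G -> restrict_path t X = k ->
  (forall r, 0 <= r <= d -> `|e r x - x| <= kappa) -> C * d <= kappa ->
  (forall r v, 0 <= r <= d -> `|ip p (e r v - v)| <= eps * `|v|) ->
  (forall g, Lambda T 0 g -> t <= ptime g <= t + d -> (forall r, 0 <= r < t -> g r = X r) ->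
     (forall r, t <= r <= ptime g -> `|g r - x| <= 2 * kappa) ->
     [/\ `|dx ip f g - p| <= eps, `|dt f g - dt f k| <= eps &
         `|oval (adjoint ip A) (dx ip f g) - pA| <= eps]) ->
  (forall r r', t <= r <= t + d -> t <= r' <= t + d -> `|r - r'| <= d / n.+1%:R ->
     `|X r - X r'| <= omega) -> 0 <= omega ->
  eps + (eps * (`|x| + 3 * kappa) + `|pA| * (3 * kappa)) + 2 * eps * C <= E ->
  forall i, (i <= n.+1)%N -> exists Z, [/\ contT Z, forall r, 0 <= r < t -> Z r = X r,
    forall r, t <= r <= mesh i -> `|Z r - x| <= 2 * kappa /\ `|Z r - X r| <= omega,
    Z (mesh i) = X (mesh i) &
    `|f (restrict_path (mesh i) Z) - f k - (mesh i - t) * (dt f k + ip pA x)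
      - rint t (mesh i) (fun r => ip p (G r))| <= E * (mesh i - t)].
Proof.
move=> t x p pA mesh hf t0 C0 kappa0 eps0 d0 tdT dX Xk hflow Cd hweak hnear hom om0 hE.
have n0 : 0 < n.+1%:R :> R by [].
have dn0 : 0 < d / n.+1%:R by rewrite divr_gt0.
have Xt : X t = x by rewrite /x -Xk restrictE ?t0 ?lexx.
have meshS i : mesh i.+1 = mesh i + d / n.+1%:R by rewrite /mesh -natr1 mulrDl mul1r addrA.
have tmesh i : t <= mesh i by rewrite /mesh lerDl mulr_ge0// ltW.
have meshd i : (i <= n.+1)%N -> mesh i <= t + d.
  move=> iN; rewrite /mesh lerD2l mulrCA -[X in _ <= X]mulr1 ler_pM2l//.
  by rewrite ler_pdivrMr// mul1r ler_nat.
have tT : t <= T by rewrite (le_trans _ (ltW tdT))// lerDl ltW.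
have Xnear r : t <= r <= t + d -> `|X r - x| <= 2 * kappa.
  move=> /andP[tr rd]; rewrite -Xt.
  apply: (le_trans (driven_near Hip Hsep Hc C0 dX _)); first by rewrite tr (le_trans rd)// ltW.
  have h1 : C * (r - t) <= C * d by rewrite ler_wpM2l// lerBlDl.
  have h2 : `|e (r - t) x - x| <= kappa by apply: hflow; rewrite subr_ge0 tr lerBlDl.
  by rewrite Xt; lra.
elim=> [|i IH] iN.
  have m0 : mesh 0%N = t by rewrite /mesh mul0r addr0.
  exists X; rewrite m0; split => //; first exact: (fd_cont dX).
    move=> r /le_anti <-; rewrite subrr normr0 om0; split => //.
    by rewrite Xt subrr normr0 mulr_ge0.
  by rewrite Xk !subrr mul0r rintaa !subrr normr0 mulr0.
have [Z [cZ ZX Znear Zi hZ]] := IH (ltnW iN).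
set a := mesh i in Znear Zi hZ; set b := mesh i.+1.
have ab : a < b by rewrite /b meshS ltrDl.
have ta : t <= a by exact: tmesh.
have bd : b <= t + d by exact: meshd.
have ad : a <= t + d by rewrite (le_trans (ltW ab)).
have bT : b < T by exact: le_lt_trans bd tdT.
have baE : b - a = d / n.+1%:R by rewrite /b meshS addrAC subrr add0r.
have dnd : d / n.+1%:R <= d by rewrite ler_pdivrMr// ler_peMr ?(ltW d0)// ler1n.
have bad r : 0 <= r <= b - a -> 0 <= r <= d.
  by move=> /andP[-> /le_trans]; apply; rewrite baE.
have aX : `|X a - x| <= 2 * kappa by apply: Xnear; rewrite ta.
have bX : `|X b - x| <= 2 * kappa by apply: Xnear; rewrite bd (le_trans ta (ltW ab)).
set Y := chord Z a b (X b).
have Ybefore r : 0 <= r < t -> Y r = X r.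
  move=> /andP[r0 rt]; rewrite /Y chord_before; first by rewrite ZX// r0.
  by rewrite (le_trans (ltW rt)).
have Ynear r : t <= r <= b -> `|Y r - x| <= 2 * kappa /\ `|Y r - X r| <= omega.
  move=> /andP[tr rb]; have [ra|/ltW ar] := leP r a.
    by rewrite /Y chord_before//; apply: Znear; rewrite tr.
  have rab : a <= r <= b by rewrite ar.
  have rtd : t <= r <= t + d by rewrite tr (le_trans rb bd).
  split; first by apply: chord_near => //; rewrite Zi.
  apply: chord_near => //.
    by rewrite Zi; apply: hom; rewrite ?ta ?ad// distrC ger0_norm ?subr_ge0// -baE lerD2r.
  apply: hom => //; first by rewrite bd andbT (le_trans ta (ltW ab)).
  by rewrite ger0_norm ?subr_ge0// -baE lerD2l lerN2.
have cY : contT Y.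
  by apply: chord_continuous => //; [exact: le_trans ta|exact: ltW].
exists Y; split => //.
  by rewrite /Y chord_end.
have seg := @segment_increment R H ip T A e Hip Hsep He HA Hc f k X G C Z a b (3 * kappa) eps hf t0 C0.
have k30 : 0 <= 3 * kappa by rewrite mulr_ge0.
have {seg} := seg k30 eps0 dX cZ ta ab bT Zi.
rewrite -/t -/x -/p -/pA -/Y => seg.
have {}seg := seg _ (fun r v hr => hweak r v (bad r hr)) _.
have h1 : forall r, 0 <= r <= b - a -> `|e r (X a) - x| <= 3 * kappa.
  move=> r /bad /[dup] rd /andP[r0 _].
  have -> : e r (X a) - x = e r (X a - x) + (e r x - x) by rewrite linearB/= addrA subrK.
  rewrite (le_trans (ler_normD _ _))//.
  by have := Hc (X a - x) r0; have := hflow r rd; lra.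
have h2 : forall s, a <= s <= b -> let g := restrict_path s Y in
     [/\ `|dx ip f g - p| <= eps, `|dt f g - dt f k| <= eps &
         `|oval (adjoint ip A) (dx ip f g) - pA| <= eps].
  move=> s /andP[as_ sb]; apply: hnear.
  - apply: Lambda_restrict => //; first by rewrite (le_trans t0)// (le_trans ta).
    by rewrite (le_trans t0 (le_trans ta as_))/= (le_trans sb (ltW bT)).
  - by rewrite restrict_time (le_trans ta as_) (le_trans sb bd).
  - move=> r /andP[r0 rt]; rewrite restrictE; first by rewrite Ybefore// r0.
    by rewrite r0 (le_trans (ltW rt))// (le_trans ta).
  - move=> r /andP[tr rs0]; have rs : r <= s := rs0.
    rewrite restrictE; last by rewrite (le_trans t0 tr).
    by have [] := Ynear r; rewrite ?tr ?(le_trans rs sb).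
have {}seg := seg h1 h2.
have mG : bmeas t T (fun r => ip p (G r)).
  by apply: eq_bmeas (bmeas_ip Hip p (fd_meas dX)) => r _; rewrite ipC.
have -> : rint t b (fun r => ip p (G r)) = rint t a (fun r => ip p (G r)) + rint a b (fun r => ip p (G r)).
  apply: rint_split; first by rewrite ta ltW.
  by apply: bmeas_sub mG => //; exact: ltW.
have ba0 : 0 <= b - a by rewrite subr_ge0 ltW.
have {}seg := le_trans seg (ler_wpM2r ba0 hE).
move: seg hZ.
move: (f (restrict_path b Y)) (f (restrict_path a Z)) (f k) (rint t a _) (rint a b _) (dt f k + _)
  => f1 f2 f3 i1 i2 c.
rewrite !ler_norml => /andP[l1 r1] /andP[l2 r2].
have -> : (b - t) * c = (b - a) * c + (a - t) * c by ring.
have -> : E * (b - t) = E * (b - a) + E * (a - t) by ring.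
by clear - l1 r1 l2 r2; apply/andP; split; lra.
Qed.

(** [polygon_increment] holds with the same constants for every mesh, and the
    polygons converge uniformly to [X].  The choice of [d0] involves [k] and the
    bound [C] only. *)
Lemma test_functional_increment f k C eps :
  Phi ip A T e f -> Lambda T 0 k -> ptime k < T -> 0 <= C -> 0 < eps ->
  exists2 d0 : R, 0 < d0 & forall X G d, 0 < d -> d < d0 ->
    flow_driven T e (ptime k) C X G -> restrict_path (ptime k) X = k ->
    `|f (restrict_path (ptime k + d) X) - f k
      - d * (dt f k + ip (oval (adjoint ip A) (dx ip f k)) (k (ptime k)))
      - rint (ptime k) (ptime k + d) (fun r => ip (dx ip f k) (G r))| <= eps * d.
Proof.
move=> hf Lk kT C0 eps0; have [fC1 fdom fcA] := hf.
have [cf _ _ cdx cdt] := fC1.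
set t := ptime k in kT *; set x := k t; set p := dx ip f k; set pA := oval _ p.
have t0 : 0 <= t by case: Lk => /andP[].
(* [eps1 * K] bounds the terms of [hE] that are proportional to [eps1]. *)
pose K := 4 + `|x| + 2 * C.
have x0 : 0 <= `|x| by [].
have K0 : 0 < K by rewrite /K; lra.
pose eps1 := eps / 2 / K; have eps10 : 0 < eps1 by rewrite !divr_gt0.
have hk := Lambda_hat Lk.
have [d1 d10 h1] := cdx k hk eps1 eps10.
have [d2 d20 h2] := cdt k (conj hk kT) eps1 eps10.
have [d3 d30 h3] := fcA k Lk eps1 eps10.
pose rho := Num.min d1 (Num.min d2 d3).
have rho0 : 0 < rho by rewrite !lt_min d10 d20.
have rhoP z : z < rho -> [/\ z < d1, z < d2 & z < d3].
  by rewrite !lt_min => /and3P.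
clearbody rho.
have pA1 : 0 < `|pA| + 1 by rewrite ltr_wpDl.
pose kap := Num.min 1 (Num.min rho (eps / 2 / (`|pA| + 1))).
have kap0 : 0 < kap by rewrite !lt_min ltr01 rho0 !divr_gt0.
have kap1 : kap <= 1 by rewrite ge_min lexx.
have kaprho : kap <= rho by rewrite !ge_min lexx !orbT.
have kapA : kap * (`|pA| + 1) <= eps / 2 by rewrite -ler_pdivlMr// !ge_min lexx !orbT.
clearbody kap.
pose kappa := kap / 5.
have kappa0 : 0 < kappa by rewrite divr_gt0.
have [d4 d40 h4] := e_near0 He x kappa0.
have [d5 d50 h5] := semigroup_weak_uniform Hip He Hc p eps10.
have C1 : 0 < C + 1 by rewrite ltr_wpDl.
exists (Num.min (Num.min (T - t) d4) (Num.min d5 (kappa / (C + 1)))).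
  by rewrite !lt_min subr_gt0 kT d40 d50 divr_gt0.
move=> X G d d0; rewrite !lt_min ltr_pdivlMr// => /andP[/andP[hT hd4] /andP[hd5 hdC]] dX Xk.
have tdT : t + d < T by lra.
have Cd : C * d <= kappa by have : d * (C + 1) = C * d + d; [ring|move=> E; rewrite E in hdC; lra].
have dkap : d <= kappa.
  have Cd0 : 0 <= C * d by rewrite mulr_ge0// ltW.
  by have : d * (C + 1) = C * d + d; [ring|move=> E; rewrite E in hdC; lra].
have hflow r : 0 <= r <= d -> `|e r x - x| <= kappa.
  by move=> /andP[r0 rd]; apply/ltW/h4; rewrite r0 (le_lt_trans rd).
have hweak r v : 0 <= r <= d -> `|ip p (e r v - v)| <= eps1 * `|v|.
  by move=> /andP[r0 rd]; apply: h5; rewrite r0 (le_lt_trans rd).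
have cX := fd_cont dX.
have Xt : X t = x by rewrite /x -Xk restrictE ?t0 ?lexx.
have tT := ltW kT.
have near g : Lambda T 0 g -> t <= ptime g <= t + d -> (forall r, 0 <= r < t -> g r = X r) ->
     (forall r, t <= r <= ptime g -> `|g r - x| <= 2 * kappa) ->
     [/\ `|dx ip f g - p| <= eps1, `|dt f g - dt f k| <= eps1 &
         `|oval (adjoint ip A) (dx ip f g) - pA| <= eps1].
  move=> Lg /andP[tg gd] g1 g2.
  have : dinf T e k g < rho.
    rewrite -Xk; apply: (@le_lt_trans _ _ (ptime g - t + (2 * kappa + kappa))).
      apply: (dinf_near He Hc) => //.
      - by rewrite tg/=; lra.
      - by rewrite Xt.
      - by rewrite Xt => a /andP[a0 ag]; apply: hflow; rewrite a0/=; lra.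
      - by lra.
    by rewrite /kappa in dkap *; lra.
  move=> /rhoP[r1 r2 r3].
  have hg := Lambda_hat Lg; have gT : ptime g < T by lra.
  by split; rewrite distrC ltW//; [exact: h1|exact: h2|exact: h3].
have hE : eps1 + (eps1 * (`|x| + 3 * kappa) + `|pA| * (3 * kappa)) + 2 * eps1 * C <= eps.
  have E1 : eps1 * K = eps / 2 by rewrite /eps1 divfK// gt_eqF.
  have E2 : eps1 * kappa <= eps1 * 1 by rewrite ler_pM2l//; rewrite /kappa; lra.
  have E3 : `|pA| * (3 * kappa) <= kap * (`|pA| + 1).
    rewrite /kappa; have pA0 : 0 <= `|pA| by [].
    by have h := mulr_ge0 pA0 (ltW kap0); clear - h kap0; lra.
  have E4 : eps1 * K = 4 * eps1 + eps1 * `|x| + 2 * eps1 * C by rewrite /K; ring.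
  by clear - E1 E2 E3 E4 kapA eps10; lra.
(* The mesh alone depends on [X]; it is chosen once [d] is given. *)
apply/ler_addgt0Pl => e' e'0.
have [cf' _ _ _ _] := fC1.
have tdT' : 0 <= t + d <= T by rewrite (ltW tdT) andbT addr_ge0// ltW.
have hX : hatLambda T 0 (restrict_path (t + d) X).
  by apply: Lambda_hat; apply: Lambda_restrict => //; case/andP: tdT'.
have [r r0 hr] := cf' _ hX e' e'0.
have r2 : 0 < r / 2 by rewrite divr_gt0.
have [d6 d60 h6] := uniformly_continuous_segment cX r2.
pose n := Num.truncn (d / d6).
have dn : d / n.+1%:R < d6.
  by rewrite ltr_pdivrMr// [X in _ < X]mulrC -ltr_pdivrMr//; exact: truncnS_gt.
have [|Z [cZ ZX Znear Zd hZ]] := @polygon_increment f k X G C d kappa eps1 eps n (r / 2) hf t0 C0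
  (ltW kappa0) (ltW eps10) d0 tdT dX Xk hflow Cd hweak near _ (ltW r2) hE n.+1 (leqnn _).
  move=> a b /andP[ta ad] /andP[tb bd] hab; apply/ltW/h6.
  - by rewrite (le_trans t0 ta) (le_trans ad (ltW tdT)).
  - by rewrite (le_trans t0 tb) (le_trans bd (ltW tdT)).
  - exact: le_lt_trans dn.
have mE : ptime k + n.+1%:R * (d / n.+1%:R) = t + d by rewrite mulrCA divff ?mulr1.
rewrite mE -/t -/x -/p -/pA in Znear Zd hZ.
have hfZ : `|f (restrict_path (t + d) X) - f (restrict_path (t + d) Z)| < e'.
  apply: hr; first by apply: Lambda_hat; apply: Lambda_restrict => //; case/andP: tdT'.
  apply: (@le_lt_trans _ _ (r / 2)); last by rewrite ltr_pdivrMr// ltr_pMr// ltr1n.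
  apply: (dinf_restrict_le He Hc) => // s /andP[s0 sd].
  have [st|ts] := ltP s t; first by rewrite ZX ?s0// subrr normr0 ltW.
  by rewrite distrC; have [] := Znear s; rewrite ?ts.
move: hZ hfZ; rewrite [t + d - t]addrC addKr.
move: (f (restrict_path _ X)) (f (restrict_path _ Z)) (f k) (rint _ _ _) (d * _) => f1 f2 f3 i1 c.
rewrite ltr_norml !ler_norml => /andP[l1 u1] /andP[l2 u2].
by clear - l1 u1 l2 u2; apply/andP; split; lra.
Qed.

End TestIncrement.

(** * The gauge functional *)

Section Profile.
Context (R : realType).
Implicit Types (m a b d kappa beta eps : R).

(** [Upsilon^2] as a function of the squared supremum norm and the squared norm
    of the last value. *)
Definition profile m a : R := m + a ^+ 2 / m.

Lemma profile_diag m : profile m m = 2 * m.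
Proof.
rewrite /profile; have [->|m0] := eqVneq m 0; first by rewrite expr0n/= mul0r addr0 mulr0.
by rewrite expr2 mulfK// mulr2n mulrDl mul1r.
Qed.

Lemma profile_le_diag m a : 0 <= a <= m -> profile m a <= 2 * m.
Proof.
move=> /andP[a0 am]; rewrite -profile_diag /profile lerD2l.
by rewrite ler_wpM2r ?invr_ge0 ?(le_trans a0)// ler_sqr// nnegrE// (le_trans a0).
Qed.

(** Two regimes.  If [a < m], the interval is so short that the supremum is not
    affected and only [a] varies, with derivative [2 a / m].  If [a = m], both
    may increase; then [m' + a'^2 / m'] exceeds [2 a'] by a term of second
    order, and [2 a / m] is equal to [2]. *)
Lemma profile_increment m a m' a' beta eps kappa :
  0 < m -> 0 <= a <= m -> m <= m' -> 0 <= a' <= m' -> m' <= Num.max m (a + kappa) ->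
  a' <= a + beta + eps -> `|beta| <= kappa -> 0 <= eps -> (a < m -> kappa <= m - a) ->
  profile m' a' <= profile m a + 2 * a / m * beta + 2 * eps + (2 * kappa + eps) ^+ 2 / m.
Proof.
move=> m0 /andP[a0 am] mm' /andP[a'0 a'm'] m'max a'le bk eps0 hk.
have k0 : 0 <= kappa by exact: le_trans bk.
have /andP[bk1 bk2] : - kappa <= beta <= kappa by rewrite -ler_norml.
have i0 : 0 < m^-1 by rewrite invr_gt0.
have m'0 : 0 < m' by exact: lt_le_trans mm'.
have sqle x y : 0 <= x -> x <= y -> x ^+ 2 <= y ^+ 2.
  by move=> x0 xy; rewrite ler_sqr// nnegrE// (le_trans x0).
have [am'|ma] := ltP a m.
  have m'm : m' = m.
    apply/le_anti; rewrite mm' andbT; apply: (le_trans m'max); rewrite ge_max lexx/=.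
    by have := hk am'; lra.
  rewrite m'm /profile -!addrA lerD2l.
  have h1 : a' ^+ 2 / m <= (a + beta + eps) ^+ 2 / m by rewrite ler_pM2r// sqle.
  apply: (le_trans h1).
  have -> : (a + beta + eps) ^+ 2 / m = a ^+ 2 / m + 2 * a / m * beta + 2 * (a / m) * eps
     + (beta + eps) ^+ 2 / m by field; rewrite gt_eqF.
  have h2 : (a / m) * eps <= 1 * eps by rewrite ler_wpM2r// ler_pdivrMr// mul1r.
  have h3 : (beta + eps) ^+ 2 / m <= (2 * kappa + eps) ^+ 2 / m.
    rewrite ler_pM2r// -[X in X <= _]real_normK ?num_real// sqle//.
    by rewrite ler_norml; apply/andP; split; lra.
  lra.
have {am ma} am : a = m by apply/le_anti; rewrite am ma.
have e1 : profile m a = 2 * a by rewrite am profile_diag.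
have e2 : 2 * a / m * beta = 2 * beta by rewrite am mulfK// gt_eqF.
rewrite e1 e2.
have sq0 : 0 <= (2 * kappa + eps) ^+ 2 / m by rewrite divr_ge0 ?sqr_ge0// ltW.
have [h|h] := leP (a + beta + eps) m'; last first.
  have := @profile_le_diag m' a'; rewrite a'0 a'm' => /(_ isT); lra.
have m'k : m' <= a + kappa.
  by apply: (le_trans m'max); rewrite ge_max lexx andbT -am lerDl.
have h1 : a' ^+ 2 / m' <= (a + beta + eps) ^+ 2 / m' by rewrite ler_wpM2r ?invr_ge0 ?(ltW m'0)// sqle.
have h2 : (m' - (a + beta + eps)) ^+ 2 / m' <= (2 * kappa + eps) ^+ 2 / m.
  apply: ler_pM; rewrite ?sqr_ge0 ?invr_ge0 ?(ltW m'0)//.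
    by apply: sqle; lra.
  by rewrite lef_pV2 ?posrE.
have h3 : m' + (a + beta + eps) ^+ 2 / m' = 2 * (a + beta + eps) + (m' - (a + beta + eps)) ^+ 2 / m'.
  by field; rewrite gt_eqF.
rewrite /profile; lra.
Qed.

Lemma profile_lipschitz m a m' a' kappa : 0 <= a <= m -> m <= m' -> 0 <= a' <= m' ->
  m' <= Num.max m (a + kappa) -> a' <= a + kappa -> 0 <= kappa ->
  profile m' a' <= profile m a + 3 * kappa.
Proof.
move=> /andP[a0 am] mm' /andP[a'0 a'm'] m'max a'le k0.
have m'k : m' <= m + kappa.
  by apply: (le_trans m'max); rewrite ge_max lerDl k0 lerD2r.
have m0 : 0 <= m by exact: le_trans am.
have [mz|mnz] := eqVneq m 0.
  have az : a = 0 by apply/le_anti; rewrite a0 -mz am.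
  have := @profile_le_diag m' a'; rewrite a'0 a'm' => /(_ isT) h.
  have -> : profile m a = 0 by rewrite /profile mz az expr0n/= mul0r addr0.
  by lra.
have {mnz}m0' : 0 < m by rewrite lt_def mnz.
have m'0 : 0 < m' by exact: lt_le_trans mm'.
have i1 : m'^-1 <= m^-1 by rewrite lef_pV2 ?posrE.
have i0 : 0 <= m'^-1 by rewrite invr_ge0 ltW.
have ha : a ^+ 2 / m' <= a ^+ 2 / m by rewrite ler_wpM2l ?sqr_ge0.
have [h|h] := leP a' a.
  have h1 : a' ^+ 2 / m' <= a ^+ 2 / m' by rewrite ler_wpM2r// ler_sqr ?nnegrE.
  rewrite /profile; lra.
have E : a' ^+ 2 / m' = a ^+ 2 / m' + (a' - a) * ((a' + a) / m') by ring.
have h1 : (a' + a) / m' <= 2 by rewrite ler_pdivrMr//; lra.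
have h2 : (a' - a) * ((a' + a) / m') <= kappa * 2.
  apply: ler_pM => //; first by rewrite subr_ge0 ltW.
    by rewrite mulr_ge0// addr_ge0.
  by lra.
rewrite /profile E; lra.
Qed.

(** The same two regimes for a jump of the last value; the difference between
    [profile (max m b) b] and [profile m b] is [(b - m)^2 / m] or [0]. *)
Lemma profile_quadratic m a b (c n : R) : 0 < m -> 0 <= a <= m -> 0 <= b ->
  b - a = 2 * c + n -> 0 <= n ->
  `|profile (Num.max m b) b - profile m a - 4 * a / m * c| <= (2 * (b - a) ^+ 2 + 2 * a * n) / m.
Proof.
move=> m0 /andP[a0 am] b0 bac n0; have i0 : 0 < m^-1 by rewrite invr_gt0.
have mn : m != 0 by rewrite gt_eqF.
have E : profile m b - profile m a - 4 * a / m * c = ((b - a) ^+ 2 + 2 * a * n) / m.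
  have -> : n = b - a - 2 * c by rewrite bac; ring.
  by rewrite /profile; field.
have p1 : 0 <= (b - a) ^+ 2 / m by rewrite divr_ge0 ?sqr_ge0// ltW.
have p2 : 0 <= 2 * a * n / m by rewrite divr_ge0 ?mulr_ge0// ltW.
have E2 : (2 * (b - a) ^+ 2 + 2 * a * n) / m = 2 * ((b - a) ^+ 2 / m) + 2 * a * n / m by field.
have E3 : ((b - a) ^+ 2 + 2 * a * n) / m = (b - a) ^+ 2 / m + 2 * a * n / m by field.
rewrite E2; have [bm|mb] := leP b m; first by rewrite E E3 ler_norml; apply/andP; split; lra.
have F : profile b b = profile m b - (b - m) ^+ 2 / m.
  by rewrite profile_diag /profile; field.
have h : (b - m) ^+ 2 / m <= (b - a) ^+ 2 / m.
  by rewrite ler_pM2r// ler_sqr ?nnegrE; lra.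
have h0 : 0 <= (b - m) ^+ 2 / m by rewrite divr_ge0 ?sqr_ge0// ltW.
have -> : profile b b - profile m a - 4 * a / m * c = (profile m b - profile m a - 4 * a / m * c)
  - (b - m) ^+ 2 / m by rewrite F; ring.
by rewrite E E3 ler_norml; apply/andP; split; lra.
Qed.

End Profile.

Section Upsilon.
Context (R : realType) (H : completeNormedModType R) (ip : {dot H for idfun}).
Context (T : R) (e : R -> {linear H -> H}).
Hypothesis Hip : inner_product_of_norm ip.
Hypothesis Hsep : separable_space H.
Hypothesis He : C0_semigroup e.
Hypothesis Hc : contraction_semigroup e.
Implicit Types (P g k : hpath H) (X Y Z G : R -> H).
Implicit Types (a b r s t eps d c C N omega : R).

Lemma Upsilon2E g : `|g (ptime g)| <= pnorm g ->
  Upsilon2 g = profile (pnorm g ^+ 2) (`|g (ptime g)| ^+ 2).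
Proof.
move=> h; rewrite /Upsilon2 /Sfun /profile; case: eqVneq => [m0|m0] /=.
  have -> : `|g (ptime g)| = 0 by apply/le_anti; rewrite normr_ge0 andbT -m0.
  by rewrite m0 !expr0n/= mul0r mulr0.
by field.
Qed.

Lemma Lambda_last T' t g : 0 <= t -> Lambda T' t g -> `|g (ptime g)| <= pnorm g.
Proof.
move=> t0 Lg; apply: (Lambda_bounded Lg); rewrite lexx andbT.
by case: Lg => /andP[/(le_trans t0)].
Qed.

(** By continuity at the final time, the supremum over the earlier times is
    still the norm of the path. *)
Lemma pnorm_bump g h : Lambda T 0 g -> 0 < ptime g ->
  pnorm (bump_path g h) = Num.max (pnorm g) `|g (ptime g) + h|.
Proof.
move=> Lg p0; set y := g (ptime g).
have bb s : 0 <= s <= ptime (bump_path g h) -> `|bump_path g h s| <= Num.max (pnorm g) `|y + h|.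
  move=> /andP[s0]; rewrite [ptime _]/(ptime g) le_eqVlt => /predU1P[->|sp].
    by rewrite bump_last ?(ltW p0)// le_max lexx orbT.
  rewrite bumpE// le_max; apply/orP; left; apply: (Lambda_bounded Lg).
  by rewrite s0 ltW.
have lb := le_pnorm bb.
apply/le_anti/andP; split; first by apply: pnorm_le => //; exact: ltW.
rewrite ge_max; apply/andP; split; last first.
  have -> : y + h = bump_path g h (ptime g) by rewrite bump_last ?(ltW p0).
  by apply: lb; apply/andP; split => //; exact: ltW.
apply: pnorm_le; first exact: ltW.
move=> s /andP[s0]; rewrite le_eqVlt => /predU1P[->|sp]; last first.
  by rewrite -(bumpE h s0 sp); apply: lb; rewrite s0 ltW.
apply/ler_addgt0Pl => eps eps0; case: Lg => _ _ /within_continuousP cg.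
have [|d d0 hd] := cg (ptime g) _ eps eps0; first by rewrite lexx ltW.
pose r := ptime g - Num.min (d / 2) (ptime g / 2).
have mn0 : 0 < Num.min (d / 2) (ptime g / 2) by rewrite lt_min !divr_gt0.
have md : Num.min (d / 2) (ptime g / 2) <= d / 2 by rewrite ge_min lexx.
have mp : Num.min (d / 2) (ptime g / 2) <= ptime g / 2 by rewrite ge_min lexx orbT.
have r0 : 0 <= r by rewrite /r; lra.
have rp : r < ptime g by rewrite /r; lra.
have h1 : `|g (ptime g) - g r| < eps.
  apply: hd; first by rewrite r0 ltW.
  by rewrite gtr0_norm ?subr_gt0//; rewrite /r; lra.
have h2 : `|g r| <= pnorm (bump_path g h).
  by rewrite -(bumpE h r0 rp); apply: lb; rewrite r0 ltW.
rewrite -(subrK (g r) (g (ptime g))) (le_trans (ler_normD _ _))// addrC [X in _ <= X]addrC.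
by rewrite lerD// ltW.
Qed.

Lemma sqr_max (x y : R) : 0 <= x -> 0 <= y -> Num.max x y ^+ 2 = Num.max (x ^+ 2) (y ^+ 2).
Proof.
move=> x0 y0; have [xy|yx] := leP x y.
  by rewrite max_r// ler_sqr.
by rewrite max_l// ler_sqr// ltW.
Qed.

(** Twice the derivative [2 a / m] of the profile, times the last value; at the
    zero path the convention for division by zero gives the right value [0]. *)
Definition dUpsilon2 g : H := (4 * `|g (ptime g)| ^+ 2 / pnorm g ^+ 2) *: g (ptime g).

Lemma is_dx_quadratic (f : hpath H -> R) g B c :
  (forall h : H, `|h| <= 1 -> `|f (bump_path g h) - f g - ip B h| <= c * `|h| ^+ 2) ->
  is_dx ip f g B.
Proof.
move=> hf; apply/is_dxP => eps eps0.
have c1 : 0 < `|c| + 1 by rewrite ltr_wpDl.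
exists (Num.min 1 (eps / (`|c| + 1))); first by rewrite lt_min ltr01 divr_gt0.
move=> h _; rewrite lt_min => /andP[h1]; rewrite ltr_pdivlMr// => h2.
apply: (le_trans (hf h (ltW h1))); rewrite expr2 mulrA ler_wpM2r//.
have := ler_norm c; have := normr_ge0 h => k1 k2.
have : c * `|h| <= `|c| * `|h| by rewrite ler_wpM2r.
lra.
Qed.

(** The path of final time [0] and the zero path are treated separately, since
    in both cases the last value carries the whole norm after the jump. *)
Lemma is_dx_Upsilon2 g : Lambda T 0 g -> is_dx ip (@Upsilon2 R H) g (dUpsilon2 g).
Proof.
move=> Lg; have lg := Lambda_last (lexx 0) Lg; have M0 := pnorm_ge0 (lexx 0) Lg.
have p0 : 0 <= ptime g by case: Lg => /andP[].
rewrite /dUpsilon2; set y := g (ptime g) in lg *; set a := `|y| ^+ 2; set m := pnorm g ^+ 2.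
have a0 : 0 <= a by rewrite sqr_ge0.
have am : a <= m by rewrite /a /m ler_sqr // nnegrE.
have nyh (h : H) : `|y + h| ^+ 2 - a = 2 * ip y h + `|h| ^+ 2 by rewrite (normD2 Hip) -/a; ring.
have Ug : Upsilon2 g = profile m a by exact: Upsilon2E.
have h2 (h : H) : 0 <= `|h| ^+ 2 by rewrite sqr_ge0.
have lE (h : H) : bump_path g h (ptime g) = y + h by rewrite bump_last.
move: p0; rewrite le_eqVlt => /predU1P[p0|p0].
  have pn (h : H) : pnorm (bump_path g h) = `|y + h|.
    have b1 s : 0 <= s <= ptime (bump_path g h) -> `|bump_path g h s| <= `|y + h|.
      move=> /andP[s0 sg]; have -> : s = ptime g by apply/le_anti; rewrite sg -p0.
      by rewrite lE.
    have gg : 0 <= ptime g <= ptime g by rewrite -p0 lexx.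
    apply/le_anti/andP; split; last by rewrite -lE; exact: (le_pnorm b1).
    by apply: pnorm_le b1; case/andP: gg.
  have Mg : pnorm g = `|y| by rewrite -[y]addr0 -pn bump0// -?p0//; case: Lg.
  have mE : m = a by rewrite /m Mg.
  apply: (@is_dx_quadratic _ _ _ 2) => h _.
  rewrite Ug Upsilon2E; last by rewrite pn lE.
  rewrite pn lE profile_diag mE profile_diag ipZl.
  have -> : 4 * a / a * ip y h = 4 * ip y h.
    have [a_0|a_n0] := eqVneq a 0; last by rewrite mulfK.
    have y_0 : y = 0 by apply/eqP; rewrite -normr_eq0 -sqrf_eq0 -/a a_0.
    by rewrite y_0 ip0l !mulr0.
  have -> : 2 * `|y + h| ^+ 2 - 2 * a - 4 * ip y h = 2 * `|h| ^+ 2.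
    by have := nyh h; lra.
  by rewrite ger0_norm// mulr_ge0.
have pn (h : H) : pnorm (bump_path g h) ^+ 2 = Num.max m (`|y + h| ^+ 2).
  by rewrite pnorm_bump// sqr_max.
have lh (h : H) : `|bump_path g h (ptime (bump_path g h))| <= pnorm (bump_path g h).
  by rewrite lE pnorm_bump// le_max lexx orbT.
have [m_0|m_n0] := eqVneq m 0.
  have y_0 : y = 0.
    by apply/eqP; rewrite -normr_eq0 -sqrf_eq0; apply/eqP/le_anti; rewrite -{1}m_0 am sqr_ge0.
  apply: (@is_dx_quadratic _ _ _ 2) => h _.
  rewrite Ug Upsilon2E// pn lE y_0 add0r m_0 max_r//.
  rewrite profile_diag scaler0 ip0l subr0 /a y_0 normr0 /profile !expr0n/= mul0r addr0 subr0.
  by rewrite ger0_norm// mulr_ge0.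
have m0 : 0 < m by rewrite lt_def m_n0 sqr_ge0.
apply: (@is_dx_quadratic _ _ _ ((2 * (2 * `|y| + 1) ^+ 2 + 2 * a) / m)) => h h1.
rewrite Ug Upsilon2E// pn lE ipZl.
have am' : 0 <= a <= m by rewrite a0.
apply: (le_trans (profile_quadratic m0 am' (sqr_ge0 _) (nyh h) (h2 h))).
rewrite [X in _ <= X]mulrAC ler_pM2r ?invr_gt0// [X in _ <= X](mulrDl (2 * _)) lerD// -mulrA.
rewrite ler_pM2l// -exprMn -[X in X <= _]real_normK ?num_real// ler_sqr ?nnegrE// ?mulr_ge0 ?addr_ge0 ?mulr_ge0//.
rewrite nyh (le_trans (ler_normD _ _))// [`|_ ^+ 2|]ger0_norm// normrM ger0_norm//.
have k1 := norm_ip_le Hip y h.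
have k2 : `|h| ^+ 2 <= `|h| by rewrite expr2 -{3}[`|h|]mulr1 ler_wpM2l.
lra.
Qed.

Lemma dx_Upsilon2 g : Lambda T 0 g -> dx ip (@Upsilon2 R H) g = dUpsilon2 g.
Proof. by move=> Lg; apply: (dx_eq Hip); exact: is_dx_Upsilon2. Qed.

Lemma norm_dUpsilon2 g : Lambda T 0 g -> `|dUpsilon2 g| <= 4 * `|g (ptime g)|.
Proof.
move=> Lg; have lg := Lambda_last (lexx 0) Lg.
rewrite /dUpsilon2 normrZ ger0_norm; last by rewrite divr_ge0 ?sqr_ge0// mulr_ge0// sqr_ge0.
rewrite ler_wpM2r// -mulrA -[X in _ <= X]mulr1 ler_pM2l//.
have [->|m0] := eqVneq (pnorm g ^+ 2) 0; first by rewrite invr0 mulr0.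
have {}m0 : 0 < pnorm g ^+ 2 by rewrite lt_def m0 sqr_ge0.
by rewrite ler_pdivrMr// mul1r ler_sqr ?nnegrE// (le_trans _ lg).
Qed.

Lemma driven_norm_le t C Z G b : 0 <= C -> flow_driven T e t C Z G -> t <= b <= T ->
  `|Z b| <= `|Z t| + C * (b - t).
Proof.
move=> C0 dZ /andP[tb bT]; rewrite (fd_eq dZ (lexx t) tb bT) (le_trans (ler_normD _ _))//.
rewrite lerD//; first by apply: Hc; rewrite subr_ge0.
exact: (driven_increment Hip Hsep Hc C0 dZ).
Qed.

(** By contractivity [|e d y| <= |y|], so the unbounded part of the dynamics has
    the right sign for an upper bound.  The two assumptions quantify the
    replacement of the semigroup by the identity. *)
Lemma driven_norm_sqr t C Z G d omega : 0 <= C -> 0 <= omega -> flow_driven T e t C Z G ->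
  0 <= d -> t + d <= T ->
  (forall r, 0 <= r <= d -> `|e r (Z t) - Z t| <= omega) ->
  (forall r v, 0 <= r <= d -> `|ip (Z t) (e r v - v)| <= omega * `|v|) ->
  `|Z (t + d)| ^+ 2 <= `|Z t| ^+ 2 + 2 * rint t (t + d) (fun r => ip (Z t) (G r))
     + (4 * omega * C + C ^+ 2 * d) * d.
Proof.
move=> C0 om0 dZ d0 tdT h1 h2; have ttd : t <= t + d by rewrite lerDl.
have Eq := fd_eq dZ (lexx t) ttd tdT; rewrite addrAC subrr add0r in Eq.
set y := Z t in Eq h1 h2 *.
have tdT' : t <= t + d <= T by rewrite ttd.
have mE := fd_emeas dZ tdT'.
have mG : vmeas t (t + d) G by apply: vmeas_sub (fd_meas dZ).
have nw := driven_increment Hip Hsep Hc C0 dZ (lexx t) ttd tdT.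
rewrite [t + d - t]addrAC subrr add0r in nw.
have mI : bmeas t (t + d) (fun r => ip y (G r)).
  by apply: eq_bmeas (bmeas_ip Hip y mG) => r _; rewrite ipC.
have dd : 0 <= d <= d by rewrite d0 lexx.
have key : ip (e d y) (vint t (t + d) (fun r => e (t + d - r) (G r))) -
    rint t (t + d) (fun r => ip y (G r)) <= 2 * omega * C * d.
  rewrite ipC (ip_vint Hip Hsep)// -rintB; [|exact: bmeas_ip|exact: mI].
  rewrite [X in _ <= _ * X](_ : d = t + d - t); last by rewrite addrAC subrr add0r.
  apply: rint_le => //; first by apply: bmeasB => //; exact: bmeas_ip.
  move=> r /andP[tr rtd].
  have rs : 0 <= t + d - r <= d by apply/andP; split; lra.
  have GC : `|G r| <= C by apply: (fd_bound dZ); rewrite tr (le_trans rtd).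
  (* The semigroup acting on [y] is removed by strong continuity, the other one
     by weak continuity, which is uniform in [G r]. *)
  have -> : ip (e (t + d - r) (G r)) (e d y) - ip y (G r) =
     ip (e (t + d - r) (G r)) (e d y - y) + ip y (e (t + d - r) (G r) - G r).
    by rewrite !ipBr (ipC ip y (e _ _)); ring.
  have k1 : ip (e (t + d - r) (G r)) (e d y - y) <= C * omega.
    rewrite (le_trans (ip_le Hip _ _))// ler_pM ?h1//.
    by rewrite (le_trans (Hc _ _))//; case/andP: rs.
  have k2 : ip y (e (t + d - r) (G r) - G r) <= omega * C.
    by rewrite (le_trans (ler_norm _))// (le_trans (h2 _ _ rs))// ler_wpM2l.
  lra.
rewrite Eq (normD2 Hip).
have k1 : `|e d y| ^+ 2 <= `|y| ^+ 2 by rewrite ler_sqr ?nnegrE//; exact: Hc.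
have k2 : `|vint t (t + d) (fun r => e (t + d - r) (G r))| ^+ 2 <= (C * d) ^+ 2.
  by rewrite ler_sqr ?nnegrE ?mulr_ge0.
rewrite exprMn in k2.
have E : (4 * omega * C + C ^+ 2 * d) * d = 2 * (2 * omega * C * d) + C ^+ 2 * d ^+ 2 by ring.
rewrite E; lra.
Qed.

Lemma driven_pnorm_sqr t C Z G d : 0 <= t -> 0 <= C -> flow_driven T e t C Z G ->
  0 <= d -> t + d <= T -> let M := pnorm (restrict_path t Z) in
  let kappa := 2 * `|Z t| * C * d + C ^+ 2 * d ^+ 2 in
  M ^+ 2 <= pnorm (restrict_path (t + d) Z) ^+ 2 <= Num.max (M ^+ 2) (`|Z t| ^+ 2 + kappa)
  /\ `|Z (t + d)| ^+ 2 <= `|Z t| ^+ 2 + kappa.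
Proof.
move=> t0 C0 dZ d0 tdT M kappa.
have ttd : t <= t + d by rewrite lerDl.
have td0 : 0 <= t + d by rewrite addr_ge0.
have tT : t <= T by exact: le_trans tdT.
have cZ := fd_cont dZ.
have L1 : Lambda T 0 (restrict_path t Z) by apply: Lambda_restrict => //; rewrite t0.
have L2 : Lambda T 0 (restrict_path (t + d) Z) by apply: Lambda_restrict => //; rewrite td0.
have M0 : 0 <= M by exact: pnorm_ge0 L1.
have M0' := pnorm_ge0 (lexx 0) L2.
have Zd r : t <= r <= t + d -> `|Z r| <= `|Z t| + C * d.
  move=> /andP[tr rd]; rewrite (le_trans (driven_norm_le C0 dZ _))//.
    by rewrite tr (le_trans rd).
  by rewrite lerD2l ler_wpM2l// lerBlDl.
have kE : `|Z t| ^+ 2 + kappa = (`|Z t| + C * d) ^+ 2 by rewrite /kappa; ring.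
have c0 : 0 <= `|Z t| + C * d by rewrite addr_ge0// mulr_ge0.
have zt : t <= t + d <= t + d by rewrite ttd lexx.
split; last by rewrite kE ler_sqr ?nnegrE// Zd.
rewrite kE -sqr_max//.
have mx0 : 0 <= Num.max M (`|Z t| + C * d) by rewrite le_max M0.
apply/andP; split; rewrite ler_sqr ?nnegrE//.
  apply: pnorm_restrict => // s /andP[s0 st].
  have := Lambda_bounded L2 (s := s); rewrite restrictE ?s0 ?(le_trans st)//; exact.
apply: pnorm_restrict => // s /andP[s0 std]; rewrite le_max.
have [st|/ltW ts] := leP s t; last by rewrite Zd ?ts// orbT.
by have := Lambda_bounded L1 (s := s); rewrite restrictE ?s0 ?st// => ->.
Qed.

Lemma Upsilon2_restrict Z s : {within `[0, T], continuous Z} -> 0 <= s <= T ->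
  Upsilon2 (restrict_path s Z) = profile (pnorm (restrict_path s Z) ^+ 2) (`|Z s| ^+ 2) /\
  `|Z s| ^+ 2 <= pnorm (restrict_path s Z) ^+ 2.
Proof.
move=> cZ /[dup] sT /andP[s0 _].
have L1 : Lambda T 0 (restrict_path s Z) by apply: Lambda_restrict.
have h := Lambda_last (lexx 0) L1; have E : restrict_path s Z (ptime (restrict_path s Z)) = Z s.
  by rewrite restrict_time restrictE// s0 lexx.
rewrite Upsilon2E// E; split=> //; rewrite E in h.
by rewrite ler_sqr ?nnegrE// (le_trans _ h).
Qed.

(** Without any smallness condition on [d] that depends on the path: this is
    what controls infinitely many terms of a series at once. *)
Lemma Upsilon2_lipschitz t C Z G d N : 0 <= t -> 0 <= C -> flow_driven T e t C Z G ->
  0 <= d -> d <= 1 -> t + d <= T -> `|Z t| <= N ->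
  Upsilon2 (restrict_path (t + d) Z) - Upsilon2 (restrict_path t Z) <= 3 * (2 * N * C + C ^+ 2) * d.
Proof.
move=> t0 C0 dZ d0 d1 tdT ZN; have tT : 0 <= t <= T by rewrite t0 (le_trans _ tdT)// lerDl.
have tdT' : 0 <= t + d <= T by rewrite addr_ge0.
have [E1 l1] := Upsilon2_restrict (fd_cont dZ) tT.
have [E2 l2] := Upsilon2_restrict (fd_cont dZ) tdT'.
have [/andP[k1 k2] k3] := driven_pnorm_sqr t0 C0 dZ d0 tdT.
set kappa := 2 * `|Z t| * C * d + C ^+ 2 * d ^+ 2 in k2 k3.
have kap0 : 0 <= kappa by rewrite addr_ge0 ?mulr_ge0 ?sqr_ge0.
have kapN : kappa <= (2 * N * C + C ^+ 2) * d.
  have Cd : 0 <= C * d by rewrite mulr_ge0.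
  have := ler_wpM2r Cd ZN; have dd : d ^+ 2 <= d by rewrite expr2 -{3}[d]mulr1 ler_wpM2l.
  have := ler_wpM2l (sqr_ge0 C) dd; rewrite /kappa; lra.
have := @profile_lipschitz R _ _ _ _ kappa (introT andP (conj (sqr_ge0 _) l1)) k1
  (introT andP (conj (sqr_ge0 _) l2)) k2 k3 kap0.
by rewrite -E1 -E2; lra.
Qed.

(** The zero path is apart: there [Upsilon^2] is of order [d^2].  Otherwise [d0]
    is chosen so that the supremum is not reached on the new interval, unless
    the last value already has maximal norm. *)
Lemma Upsilon2_increment k C eps : Lambda T 0 k -> ptime k < T -> 0 <= C -> 0 < eps ->
  exists2 d0 : R, 0 < d0 & forall Z G d, 0 < d -> d < d0 ->
    flow_driven T e (ptime k) C Z G -> restrict_path (ptime k) Z = k ->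
    Upsilon2 (restrict_path (ptime k + d) Z) - Upsilon2 k
      <= rint (ptime k) (ptime k + d) (fun r => ip (dUpsilon2 k) (G r)) + eps * d.
Proof.
move=> Lk kT C0 eps0; have t0 : 0 <= ptime k by case: Lk => /andP[].
set t := ptime k in kT t0 *; pose y := k t; pose m := pnorm k ^+ 2; pose a := `|y| ^+ 2.
have lk := Lambda_last (lexx 0) Lk; rewrite -/t -/y in lk.
have am : 0 <= a <= m by rewrite /a /m sqr_ge0 ler_sqr ?nnegrE// (le_trans _ lk).
have C2 : 0 <= C ^+ 2 by rewrite sqr_ge0.
have m0 : 0 <= m by rewrite sqr_ge0.
have [m_0|m_n0] := eqVneq m 0.
  have y_0 : y = 0.
    by apply/eqP; rewrite -normr_eq0 -sqrf_eq0; apply/eqP/le_anti; rewrite sqr_ge0 andbT -m_0; case/andP: am.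
  have k_0 : Upsilon2 k = 0 by rewrite Upsilon2E// -/t -/y -/m m_0 y_0 normr0 /profile !expr0n/= mul0r addr0.
  have D0 : dUpsilon2 k = 0 by rewrite /dUpsilon2 -/t -/y y_0 scaler0.
  exists (Num.min (T - t) (eps / (2 * C ^+ 2 + 1))).
    by rewrite lt_min subr_gt0 kT divr_gt0// ltr_wpDl// mulr_ge0.
  move=> Z G d d0; rewrite lt_min ltrBrDl ltr_pdivlMr ?ltr_wpDl ?mulr_ge0// => /andP[/ltW tdT dC] dZ Zk.
  have Zt : Z t = 0 by rewrite -[RHS]y_0 /y -Zk restrictE// t0 lexx.
  have tdT' : 0 <= t + d <= T by rewrite addr_ge0// ltW.
  have [E2 l2] := Upsilon2_restrict (fd_cont dZ) tdT'.
  have [/andP[_ k2] _] := driven_pnorm_sqr t0 C0 dZ (ltW d0) tdT.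
  rewrite Zk -/m m_0 Zt normr0 mulr0 !mul0r expr0n/= !add0r max_r ?mulr_ge0 ?sqr_ge0 ?(ltW d0)// in k2.
  have := @profile_le_diag R (pnorm (restrict_path (t + d) Z) ^+ 2) (`|Z (t + d)| ^+ 2).
  rewrite sqr_ge0 l2 -E2 => /(_ isT) h.
  rewrite k_0 subr0 D0 (_ : rint _ _ _ = 0); last first.
    rewrite (@eq_rint _ _ _ _ (fun=> 0)); first by rewrite rint_cst ?mul0r// lerDl ltW.
    by move=> r _; rewrite ip0l.
  rewrite add0r (le_trans h)//.
  have : d * (d * (2 * C ^+ 2 + 1)) <= d * eps by rewrite ler_pM2l// ltW.
  have := sqr_ge0 d; lra.
have {m_n0} m_gt0 : 0 < m by rewrite lt_def m_n0.
pose B := 2 * `|y| * C + C ^+ 2.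
have y0 : 0 <= `|y| by [].
have B0 : 0 <= B by rewrite addr_ge0// !mulr_ge0.
pose eps1 := eps / 4; have eps10 : 0 < eps1 by rewrite divr_gt0.
pose omega := eps1 / (2 * (4 * C + 1)).
have C41 : 0 < 2 * (4 * C + 1) by rewrite mulr_gt0// ltr_wpDl// mulr_ge0.
have om0 : 0 < omega by rewrite divr_gt0.
have omC : 4 * omega * C <= eps1 / 2.
  have : omega * (2 * (4 * C + 1)) = eps1 by rewrite /omega divfK// gt_eqF.
  by have := om0; lra.
clearbody omega.
have eps1E : 4 * eps1 = eps by rewrite /eps1; field.
clearbody eps1.
have [d1 d10 h1] := e_near0 He y om0.
have [d2 d20 h2] := semigroup_weak_uniform Hip He Hc y om0.
(* Before [gap], a last value below the supremum norm stays below it. *)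
pose gap := if a < m then (m - a) / (B + 1) else 1.
have B1 : 0 < B + 1 by rewrite ltr_wpDl.
have gap0 : 0 < gap by rewrite /gap; case: (ltP a m) => // h; rewrite ?divr_gt0// subr_gt0.
pose q := (2 * B + eps1) ^+ 2 / m.
have q0 : 0 <= q by rewrite divr_ge0 ?sqr_ge0.
have q1 : 0 < q + 1 by rewrite ltr_wpDl.
have C21 : 0 < C ^+ 2 + 1 by rewrite ltr_wpDl.
exists (Num.min (Num.min (Num.min 1 (T - t)) (Num.min d1 d2))
  (Num.min gap (Num.min (eps / 2 / (q + 1)) (eps1 / 2 / (C ^+ 2 + 1))))).
  by rewrite !lt_min ltr01 subr_gt0 kT d10 d20 gap0 !divr_gt0.
move=> Z G d d0; rewrite !lt_min !ltr_pdivlMr// => /andP[/andP[/andP[dle1 dT] /andP[hd1 hd2]]].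
move=> /and3P[dgap dq dC] dZ Zk.
have tdT : t + d <= T by lra.
have Zt : Z t = y by rewrite /y -Zk restrictE// t0 lexx.
have tdT' : 0 <= t + d <= T by rewrite addr_ge0// ltW.
have [E2 l2] := Upsilon2_restrict (fd_cont dZ) tdT'.
have [/andP[k1 k2] k3] := driven_pnorm_sqr t0 C0 dZ (ltW d0) tdT.
rewrite Zk Zt -/m -/a in k1 k2 k3.
set kappa := 2 * `|y| * C * d + C ^+ 2 * d ^+ 2 in k2 k3.
have dd : d ^+ 2 <= d by rewrite expr2 -{3}[d]mulr1 ler_wpM2l// ltW.
have kB : kappa <= B * d.
  by have h := ler_wpM2l C2 dd; rewrite /kappa /B; clear - h; lra.
have Cd2 : 0 <= C ^+ 2 * d ^+ 2 by rewrite mulr_ge0 ?sqr_ge0.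
pose I := rint t (t + d) (fun r => ip y (G r)).
have hI : `|2 * I| <= kappa.
  have ttd : t <= t + d by rewrite lerDl ltW.
  have : `|I| <= `|y| * C * (t + d - t).
    apply: norm_rint_le => //.
      apply: eq_bmeas (bmeas_ip Hip y (vmeas_sub (lexx t) tdT (fd_meas dZ))) => r _.
      by rewrite ipC.
    move=> r /andP[tr rd]; rewrite (le_trans (norm_ip_le Hip _ _))// ler_wpM2l//.
    by apply: (fd_bound dZ); rewrite tr (le_trans rd).
  rewrite [t + d - t]addrAC subrr add0r normrM ger0_norm// /kappa => h.
  by clear - h Cd2; lra.
have hs : `|Z (t + d)| ^+ 2 <= a + 2 * I + eps1 * d.
  have := @driven_norm_sqr t C Z G d omega C0 (ltW om0) dZ (ltW d0) tdT.
  rewrite Zt -/a -/I => h.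
  apply: (le_trans (h _ _)).
  - by move=> r /andP[r0 rd]; apply/ltW/h1; rewrite r0 (le_lt_trans rd).
  - by move=> r v /andP[r0 rd]; apply: h2; rewrite r0 (le_lt_trans rd).
  rewrite lerD2l ler_wpM2r ?(ltW d0)// [X in _ <= X]splitr lerD//.
  by rewrite ler_pdivlMr// (le_trans _ (ltW dC))// ler_pM2r// mulrC ler_wpM2l ?(ltW d0)// lerDl.
have gapk : a < m -> kappa <= m - a.
  move=> h; move: dgap; rewrite /gap h ltr_pdivlMr// => hg.
  by apply: (le_trans kB); have d0' := ltW d0; clear - hg d0'; lra.
have e1d : 0 <= eps1 * d by rewrite mulr_ge0 ?ltW.
have := @profile_increment R m a _ _ (2 * I) (eps1 * d) kappa m_gt0 am k1
  (introT andP (conj (sqr_ge0 _) l2)) k2 hs hI e1d gapk.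
rewrite -E2 -[profile m a]Upsilon2E// -/t => h.
have -> : rint t (t + d) (fun r => ip (dUpsilon2 k) (G r)) = 2 * a / m * (2 * I).
  rewrite (@eq_rint _ _ _ _ (fun r => (4 * a / m) * ip y (G r))); last first.
    by move=> r _; rewrite /dUpsilon2 -/t -/y -/a -/m ipZl.
  rewrite rintZ; first by rewrite -/I; ring.
  apply: eq_bmeas (bmeas_ip Hip y (vmeas_sub (lexx t) tdT (fd_meas dZ))) => r _.
  by rewrite ipC.
have sq : (2 * kappa + eps1 * d) ^+ 2 / m <= q * d ^+ 2.
  have k0 : 0 <= kappa by exact: le_trans hI.
  have -> : q * d ^+ 2 = ((2 * B + eps1) * d) ^+ 2 / m by rewrite /q; ring.
  rewrite ler_pM2r ?invr_gt0// ler_sqr ?nnegrE; last 2 first.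
  - by rewrite addr_ge0// mulr_ge0.
  - by rewrite mulr_ge0 ?(ltW d0)// addr_ge0 ?mulr_ge0// ltW.
  by clear - kB; lra.
have dq' : d * (d * (q + 1) * 2) <= d * eps by rewrite ler_pM2l// ltW.
have e4 : 4 * (eps1 * d) = eps * d by rewrite mulrA eps1E.
have dsq := sqr_ge0 d; clear - h sq dq' dsq e4; lra.
Qed.

End Upsilon.

(** * Functions of class C^1 on a strip, weighted series *)

Section Strip.
Context (R : realType) (T : R) (h : R -> R -> R).
Hypothesis hC1 : C1_strip T h.
Implicit Types (s t x y d eps B J : R).

Lemma mean_value (f : R -> R) x y : (forall z : R, derivable f z 1) ->
  exists2 xi, `|xi - x| <= `|y - x| & f y - f x = f^`()%classic xi * (y - x).
Proof.
move=> df; have cf : continuous f by move=> z; apply/differentiable_continuous/derivable1_diffP.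
have isd (z : R) : is_derive z 1 f (f^`()%classic z) by rewrite derive1E; split.
have [xy|yx] := leP x y.
  have [|xi] := MVT_segment xy (fun z _ => isd z); first exact: continuous_subspaceT.
  rewrite in_itv/= => /andP[h1 h2] E; exists xi => //.
  by rewrite !ger0_norm ?subr_ge0// lerD2r.
have [|xi] := MVT_segment (ltW yx) (fun z _ => isd z); first exact: continuous_subspaceT.
rewrite in_itv/= => /andP[h1 h2] E; exists xi.
  by rewrite !ler0_norm ?subr_le0 ?(ltW yx)// lerN2 lerD2r.
by rewrite -[RHS]opprK -mulrN opprB -E opprB.
Qed.

Lemma strip_continuous (f : R -> R -> R) t x :
  {within [set p : R * R | 0 <= p.1 <= T], continuous (fun p : R * R => f p.1 p.2)} ->
  0 <= t <= T -> forall eps, 0 < eps -> exists2 d : R, 0 < d & forall s y,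
    0 <= s <= T -> `|s - t| < d -> `|y - x| < d -> `|f s y - f t x| < eps.
Proof.
move=> /subspace_continuousP/(_ (t, x)) cf tT eps eps0.
have /cvgrPdist_lt/(_ eps eps0)/nbhs_ballP[d /= d0 hd] := cf tT.
exists d => // s y sT st yx; rewrite distrC; apply: (hd (s, y)) => //.
by split; rewrite /= -ball_normE /= distrC.
Qed.

(** Monotonicity in the second variable turns an upper bound of [y - x] into one
    of the increment; the differentiability in each variable suffices because
    the partial derivative in [x] is jointly continuous. *)
Lemma strip_increment t x B eps : 0 <= t -> t < T -> 0 <= B -> 0 < eps ->
  (forall s z, 0 <= s <= T -> 0 <= partial2 h s z) ->
  exists2 d0 : R, 0 < d0 & forall d y J, 0 < d -> d < d0 -> `|J| <= B * d -> y - x <= J ->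
    h (t + d) y - h t x <= d * partial1 T h t x + partial2 h t x * J + eps * d.
Proof.
move=> t0 tT B0 eps0 mono; have [_ cv1 dv2 _ c2] := hC1.
have tT' : 0 <= t <= T by rewrite t0 ltW.
have B1 : 0 < B + 1 by rewrite ltr_wpDl.
have e2 : 0 < eps / 2 / (B + 1) by rewrite !divr_gt0.
have [d1 d10 hd1] := strip_continuous x c2 tT' e2.
have /cvgrPdist_lt/(_ (eps / 2))[|d2 /= d20 hd2] := cv1 t x tT'; first by rewrite divr_gt0.
exists (Num.min (Num.min (T - t) (d1 / (B + 1))) (Num.min d1 d2)).
  by rewrite !lt_min subr_gt0 tT d10 d20 divr_gt0.
move=> d y J d0; rewrite !lt_min ltr_pdivlMr// => /andP[/andP[dT dB] /andP[dd1 dd2]] JB yJ.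
have tdT : 0 <= t + d <= T.
  by rewrite addr_ge0 ?(ltW d0)//= -lerBrDl ltW.
have step1 : h (t + d) y <= h (t + d) (x + J).
  rewrite -subr_ge0; have [xi _ ->] := mean_value y (x + J) (dv2 _ ^~ tdT).
  by rewrite mulr_ge0 ?mono// subr_ge0 -lerBlDl.
have [xi xiJ step2] := mean_value x (x + J) (dv2 _ ^~ tdT).
rewrite (addrAC x) subrr add0r in step2 xiJ.
have Bd : B * d <= d * (B + 1) by rewrite mulrDr mulr1 mulrC lerDl ltW.
have xd1 : `|xi - x| < d1 by rewrite (le_lt_trans xiJ)// (le_lt_trans JB)// (le_lt_trans Bd).
have step3 : `|partial2 h (t + d) xi - partial2 h t x| * `|J| <= eps / 2 * d.
  rewrite [X in _ <= X](_ : _ = eps / 2 / (B + 1) * (d * (B + 1))); last first.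
    by field; rewrite gt_eqF.
  apply: ler_pM => //; last exact: le_trans JB Bd.
  by apply/ltW/hd1 => //; rewrite addrAC subrr add0r gtr0_norm.
have step4 : `|h (t + d) x - h t x - d * partial1 T h t x| <= eps / 2 * d.
  have := hd2 (t + d); rewrite /= opprD addNKr normrN gtr0_norm// in_itv/= tdT.
  move=> /(_ dd2 _ isT); rewrite -subr_eq0 addrAC subrr add0r gt_eqF// => /(_ isT).
  rewrite /partial1_quotient addrAC subrr add0r => /ltW q.
  rewrite (_ : _ - _ - _ = - ((partial1 T h t x - (h (t + d) x - h t x) / d) * d)); last first.
    by field; rewrite gt_eqF.
  by rewrite normrN normrM (gtr0_norm d0) ler_wpM2r// ltW.
have /ler_normlP[_ s4] := step4.
have : (partial2 h (t + d) xi - partial2 h t x) * J <= eps / 2 * d.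
  by rewrite (le_trans (ler_norm _))// normrM.
have : h (t + d) (x + J) - h (t + d) x = partial2 h (t + d) xi * J by [].
move: step1 s4; move: (h _ y) (h _ (x + J)) (h (t + d) x) (h t x) (partial2 _ _ xi) (partial2 _ t x) (partial1 _ _ _ _).
by move=> *; lra.
Qed.

End Strip.

Section WeightedSeries.
Context (R : realType) (delta : nat -> R) (N : R).
Hypothesis delta_gt0 : forall i, 0 < delta i.
Hypothesis delta_sum : (\sum_(0 <= i <oo) (delta i)%:E <= N%:E)%E.
Implicit Types (a b : nat -> R) (eps K : R) (n m : nat).

Lemma series_weights_le n : series delta n <= N.
Proof.
rewrite -lee_fin; apply: le_trans delta_sum; rewrite /series/= -sumEFin.
by apply: nneseries_lim_ge => i _ _; rewrite lee_fin ltW.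
Qed.

Lemma weights_cvg : cvgn (series delta).
Proof.
apply: nondecreasing_is_cvgn; last first.
  by exists N => _ [n _ <-]; exact: series_weights_le.
by apply/nondecreasing_seqP => n; rewrite -subr_ge0 seriesSB ltW.
Qed.

Lemma dominated_series_cvg (V : completeNormedModType R) (v : nat -> V) K :
  (forall i, `|v i| <= K * delta i) -> series v n @[n --> \oo] --> limn (series v).
Proof.
move=> vK; apply: normed_cvg.
apply: (@series_le_cvg _ _ (fun i => K * delta i)) => //.
- by move=> i; rewrite /= normr_ge0.
- by move=> i; rewrite (le_trans _ (vK i)).
exact: is_cvg_seriesZ weights_cvg.
Qed.

(** Finitely many terms are compared sharply, and the tail crudely.  The index
    [n] does not depend on the series, so that conditions on the first [n] terms
    can be imposed beforehand. *)
Lemma series_comparison eps K : 0 <= K -> 0 < eps -> exists n, forall a b la lb,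
  series a m @[m --> \oo] --> la -> series b m @[m --> \oo] --> lb ->
  (forall i, (i < n)%N -> a i - b i <= eps * delta i) ->
  (forall i, a i - b i <= K * delta i) -> la - lb <= eps * (N + 1).
Proof.
move=> K0 eps0; have K1 : 0 < K + 1 by rewrite ltr_wpDl.
pose q := eps / 2 / (K + 1); have q0 : 0 < q by rewrite !divr_gt0.
have qE : eps / (K + 1) = 2 * q by rewrite /q; field; rewrite gt_eqF.
clearbody q; have [n hn] := cvgn_eps weights_cvg q0.
exists n => a b la lb ha hb h1 h2.
have hab : series a m - series b m @[m --> \oo] --> la - lb by exact: cvgB.
apply: (@ler_cvg_to _ _ _ _ _ _ _ _ hab (cvg_cst _)).
exists n => // m /= nm.
have E (f : nat -> R) : series f m = \sum_(0 <= i < n) f i + \sum_(n <= i < m) f i.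
  by rewrite /series/= -big_cat_nat.
have tail : \sum_(n <= i < m) delta i <= eps / (K + 1).
  have := E delta; rewrite {1}/series/=.
  have := hn n (leqnn n); have := hn m nm.
  rewrite !ltr_norml => /andP[p1 p2] /andP[p3 p4] p5.
  by rewrite qE; move: (limn _) p1 p2 p3 p4 p5 => l *; lra.
have t0 : 0 <= \sum_(n <= i < m) delta i by apply: sumr_ge0 => i _; exact: ltW.
have tl : \sum_(n <= i < m) (a i - b i) <= eps.
  apply: (@le_trans _ _ (\sum_(n <= i < m) K * delta i)); first by apply: ler_sum.
  rewrite -mulr_sumr (le_trans (ler_wpM2l K0 tail))// mulrCA -[X in _ <= X]mulr1.
  by rewrite ler_pM2l// ler_pdivrMr// mul1r lerDl.
have hd : \sum_(0 <= i < n) (a i - b i) <= eps * N.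
  apply: (@le_trans _ _ (\sum_(0 <= i < n) eps * delta i)).
    by rewrite big_nat [X in _ <= X]big_nat; apply: ler_sum => i /andP[_]; exact: h1.
  by rewrite -mulr_sumr ler_pM2l//; exact: series_weights_le.
rewrite !E mulrDr mulr1 (le_trans _ (lerD hd tl))// !sumrB; lra.
Qed.

End WeightedSeries.

(** * Increment of a gauge along a driven curve *)

Section Gauge.
Context (R : realType) (H : completeNormedModType R) (ip : {dot H for idfun}).
Context (T : R) (e : R -> {linear H -> H}).
Hypothesis Hip : inner_product_of_norm ip.
Hypothesis Hsep : separable_space H.
Hypothesis He : C0_semigroup e.
Hypothesis Hc : contraction_semigroup e.
Implicit Types (P g k : hpath H) (X Y Z G : R -> H) (r : Grep H).
Implicit Types (a b s t eps d c C N : R).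

Lemma gshiftE r k i x :
  gshift e r k i x = k x - flow_path e (gpath r i) (ptime k) x.
Proof. by []. Qed.

Lemma gshift_restrict r i X s : 0 <= s -> s <= T ->
  gshift e r (restrict_path s X) i =
  restrict_path s (fun x => X x - flow_path e (gpath r i) T x).
Proof.
move=> s0 sT; apply: hpath_eq => // x.
rewrite gshiftE restrict_time.
have [xs|xs] := boolP (0 <= x <= s); last first.
  by rewrite /flow_path !restrict_out// subrr.
rewrite /flow_path !restrictE//.
by case/andP: xs => -> /le_trans; apply.
Qed.

(** The subtracted orbit solves the equation without velocity. *)
Lemma driven_shift t C X G P : Lambda T 0 P -> ptime P <= t -> flow_driven T e t C X G ->
  flow_driven T e t C (fun x => X x - flow_path e P T x) G.
Proof.
move=> LP Pt [cX mG bG eG Eq]; have P0 : 0 <= ptime P by case: LP => /andP[].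
have PT : ptime P <= T by case: LP => /andP[].
split=> //.
  have cF := flow_continuous He Hc LP PT.
  by move=> x; apply: cvgB; [exact: cX|exact: cF].
move=> a b ta ab bT; rewrite (Eq a b)// [e _ (_ - _)]linearB -!addrA; congr (_ + _).
rewrite addrC; congr (- _ + _); have Pa := le_trans Pt ta; have a0 := le_trans P0 Pa.
have aT := le_trans ab bT; have b0 := le_trans a0 ab; have Pb := le_trans Pa ab.
rewrite !flow_after ?a0 ?b0//.
by rewrite -(eD He) ?subr_ge0//; congr (e _ _); ring.
Qed.

Lemma Lambda_gshift r i k : Lambda T 0 k -> Lambda T 0 (gpath r i) ->
  ptime (gpath r i) <= ptime k -> Lambda T 0 (gshift e r k i).
Proof.
move=> [kT nk ck] LP Pk; split => //.
  move=> s sk; rewrite gshiftE.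
  by rewrite nk// /flow_path restrict_out// subrr.
have cF := flow_continuous He Hc LP Pk.
by move=> x; apply: cvgB; [exact: ck|exact: cF].
Qed.

Lemma gshift_last r i k N : Lambda T 0 (gpath r i) -> pnorm (gpath r i) <= N ->
  `|gshift e r k i (ptime k)| <= `|k (ptime k)| + N.
Proof.
move=> LP PN; rewrite gshiftE.
by rewrite (le_trans (ler_normB _ _))// lerD2l (le_trans (flow_norm_le Hc _ LP _)).
Qed.


(** [Upsilon2_increment] is used for the terms before some index and
    [Upsilon2_lipschitz] for all of them; the smallness of [d] depends on
    finitely many paths only. *)
Lemma gauge_series_increment r k N C eps : Lambda T 0 k -> ptime k < T ->
  (forall i, 0 < gdelta r i) ->
  (forall i, Lambda T 0 (gpath r i) /\ ptime (gpath r i) <= ptime k) ->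
  (forall i, pnorm (gpath r i) <= N) ->
  (\sum_(0 <= i <oo) (gdelta r i)%:E <= N%:E)%E -> 0 <= C -> 0 < eps ->
  let term k' i := gdelta r i * (Upsilon2 (gshift e r k' i) + `|ptime k' - ptime (gpath r i)| ^+ 2) in
  let D i := gdelta r i *: dUpsilon2 (gshift e r k i) in
  let tau i := gdelta r i * (ptime k - ptime (gpath r i)) in
  exists2 d0 : R, 0 < d0 & forall X G d (la lk : R), 0 < d -> d < d0 ->
    flow_driven T e (ptime k) C X G -> restrict_path (ptime k) X = k ->
    series (term (restrict_path (ptime k + d) X)) n @[n --> \oo] --> la ->
    series (term k) n @[n --> \oo] --> lk ->
    la - lk <= d * (2 * limn (series tau))
      + rint (ptime k) (ptime k + d) (fun x => ip (limn (series D)) (G x)) + eps * d.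
Proof.
move=> Lk kT de0 LP PN deN C0 eps0 term D tau.
set t := ptime k in kT LP tau term *.
have t0 : 0 <= t by case: Lk => /andP[].
have N0 : 0 <= N.
  by apply: le_trans (PN 0%N); have [LP0 _] := LP 0%N; exact: pnorm_ge0 LP0.
have LS i : Lambda T 0 (gshift e r k i) by have [? ?] := LP i; exact: Lambda_gshift.
pose N1 := `|k t| + N; have N10 : 0 <= N1 by rewrite addr_ge0.
have last i : `|gshift e r k i t| <= N1 by have [? _] := LP i; exact: gshift_last.
have Dle i : `|D i| <= 4 * N1 * gdelta r i.
  rewrite normrZ gtr0_norm// mulrC ler_pM2r// (le_trans (norm_dUpsilon2 (LS i)))//.
  by rewrite ler_pM2l.
have ti i : 0 <= t - ptime (gpath r i) <= T.
  by have [[/andP[h _] _ _] h'] := LP i; rewrite subr_ge0 h'/=; lra.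
have taule i : `|tau i| <= T * gdelta r i.
  rewrite normrM (gtr0_norm (de0 i)) mulrC ler_pM2r//.
  by have /andP[h h'] := ti i; rewrite ger0_norm.
have cD := dominated_series_cvg de0 deN Dle.
have ctau := dominated_series_cvg de0 deN taule.
(* Lipschitz constants for [Upsilon^2], for [|s - t_i|^2], and for the expected
   increment. *)
pose M := 3 * (2 * N1 * C + C ^+ 2) + (2 * T + 1) + (2 * T + 4 * N1 * C).
have T0 : 0 <= T by rewrite (le_trans t0)// ltW.
have M0 : 0 <= M by rewrite !addr_ge0// !mulr_ge0// addr_ge0// ?sqr_ge0// !mulr_ge0.
pose eta := eps / (N + 1).
have N11 : 0 < N + 1 by rewrite ltr_wpDl.
have eta0 : 0 < eta by rewrite divr_gt0.
have [n hn] := series_comparison de0 deN M0 eta0.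
have head : forall m, exists2 d0 : R, 0 < d0 & forall i, (i < m)%N -> forall Z G d, 0 < d -> d < d0 ->
    flow_driven T e t C Z G -> restrict_path t Z = gshift e r k i ->
    Upsilon2 (restrict_path (t + d) Z) - Upsilon2 (gshift e r k i)
      <= rint t (t + d) (fun x => ip (dUpsilon2 (gshift e r k i)) (G x)) + eta / 2 * d.
  elim=> [|m [d0 d00 IH]]; first by exists 1.
  have e20 : 0 < eta / 2 by rewrite divr_gt0.
  have [d1 d10 h1] := Upsilon2_increment Hip Hsep He Hc (LS m) kT C0 e20.
  exists (Num.min d0 d1); first by rewrite lt_min d00.
  move=> i; rewrite ltnS leq_eqVlt => /predU1P[->|im] Z G d dp; rewrite lt_min => /andP[dd0 dd1].
    exact: h1.
  exact: IH.
have [d1 d10 hd1] := head n.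
exists (Num.min (Num.min 1 (T - t)) (Num.min d1 (eta / 2))).
  by rewrite !lt_min ltr01 subr_gt0 kT d10 divr_gt0.
move=> X G d la lk d0; rewrite !lt_min => /andP[/andP[d_1 dT] /andP[dd1 deta]] dX Xk cla clk.
have tdT : t + d <= T by lra.
have ttd : t <= t + d by rewrite lerDl ltW.
have td0 : 0 <= t + d by rewrite (le_trans t0).
pose I v := rint t (t + d) (fun x => ip v (G x)).
have mI v : bmeas t (t + d) (fun x => ip v (G x)).
  apply: eq_bmeas (bmeas_ip Hip v (vmeas_sub (lexx t) tdT (fd_meas dX))) => x _.
  by rewrite ipC.
have IZ c v : I (c *: v) = c * I v.
  by rewrite /I -rintZ//; apply: eq_rint => x _; rewrite ipZl.
have IB v w : I (v - w) = I v - I w.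
  by rewrite /I -rintB//; apply: eq_rint => x _; rewrite ipBl.
have ID v w : I (v + w) = I v + I w.
  by rewrite /I -rintD//; apply: eq_rint => x _; rewrite ipDl.
have I0 : I 0 = 0 by rewrite -(scale0r 0) IZ mul0r.
have Ile v : `|I v| <= `|v| * C * d.
  rewrite (le_trans (norm_rint_le (C := `|v| * C) ttd (mI v) _))//.
    move=> x /andP[tx xd]; rewrite (le_trans (norm_ip_le Hip _ _))// ler_wpM2l//.
    by apply: (fd_bound dX); rewrite tx (le_trans xd).
  by rewrite (addrAC t) subrr add0r.
pose b i := d * (2 * tau i) + I (D i).
have bE m : series b m = d * (2 * series tau m) + I (series D m).
  rewrite /series/=; elim: m => [|m IH]; first by rewrite !big_nil I0 !mulr0 addr0.
  by rewrite !big_nat_recr//= IH ID /b; ring.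
have cb : series b m @[m --> \oo] --> d * (2 * limn (series tau)) + I (limn (series D)).
  under eq_fun do rewrite bE.
  apply: cvgD; first by apply: cvgMr; apply: cvgMr.
  apply/cvgrPdist_le => eps' eps'0.
  have C1 : 0 < C * d + 1 by rewrite ltr_wpDl// mulr_ge0// ltW.
  have /cvgrPdist_le/(_ _ (divr_gt0 eps'0 C1)) := cD; apply: filterS => m hm.
  rewrite -IB (le_trans (Ile _))// -mulrA.
  have Cd0 : 0 <= C * d by rewrite mulr_ge0// ltW.
  rewrite (le_trans (ler_wpM2r Cd0 hm))// mulrAC ler_pdivrMr// ler_pM2l//.
  by rewrite lerDl.
pose a i := term (restrict_path (t + d) X) i - term k i.
have ca : series a m @[m --> \oo] --> la - lk.
  have -> : series a = (fun m => series (term (restrict_path (t + d) X)) m - series (term k) m).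
    by apply/funext => m; rewrite /series/= -sumrB.
  exact: cvgB.
have tE i : `|t + d - ptime (gpath r i)| ^+ 2 - `|t - ptime (gpath r i)| ^+ 2 =
    2 * d * (t - ptime (gpath r i)) + d ^+ 2.
  by rewrite !real_normK ?num_real//; ring.
pose Z i := fun x => X x - flow_path e (gpath r i) T x.
have ZE s i : 0 <= s -> s <= T -> gshift e r (restrict_path s X) i = restrict_path s (Z i).
  exact: gshift_restrict.
have dZ i : flow_driven T e t C (Z i) G by have [? ?] := LP i; exact: driven_shift.
have Zt i : restrict_path t (Z i) = gshift e r k i by rewrite -ZE ?Xk// ltW.
have ZN i : `|Z i t| <= N1.
  by rewrite -[Z i t](@restrictE _ _ t) ?t0 ?lexx// Zt.
have aE i : a i = gdelta r i * (Upsilon2 (restrict_path (t + d) (Z i)) - Upsilon2 (gshift e r k i)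
    + (2 * d * (t - ptime (gpath r i)) + d ^+ 2)).
  by rewrite -tE /a /term -/t restrict_time ZE//; ring.
have bE' i : b i = gdelta r i * (2 * d * (t - ptime (gpath r i)) + I (dUpsilon2 (gshift e r k i))).
  by rewrite /b IZ /tau; ring.
have dd : d ^+ 2 <= d by rewrite expr2 -{3}[d]mulr1 ler_wpM2l// ltW.
have comp := hn (fun i => a i / d) (fun i => b i / d) ((la - lk) / d)
  ((d * (2 * limn (series tau)) + I (limn (series D))) / d).
have cdiv (u : nat -> R) (l : R) : series u m @[m --> \oo] --> l -> series (fun i => u i / d) m @[m --> \oo] --> l / d.
  move=> cu; have -> : series (fun i => u i / d) = (fun m => series u m / d).
    by apply/funext => m; rewrite /series/= mulr_suml.
  exact: cvgMl.
have {comp} : (la - lk) / d - (d * (2 * limn (series tau)) + I (limn (series D))) / d <= eta * (N + 1).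
  apply: comp; [exact: cdiv|exact: cdiv| |].
  - move=> i hi; rewrite -mulrBl ler_pdivrMr// aE bE' -mulrBr (mulrC eta) -[X in _ <= X]mulrA ler_pM2l//.
    have := hd1 i hi (Z i) G d d0 dd1 (dZ i) (Zt i); rewrite -/(I _).
    have : d * d <= d * (eta / 2) by rewrite ler_pM2l// ltW.
    move: (Upsilon2 _) (Upsilon2 _) (I _) => u v w p1 p2; rewrite expr2.
    have -> : eta * d = 2 * (d * (eta / 2)) by field.
    move: p1 p2; rewrite (mulrC (eta / 2)); move: (d * d) (d * (eta / 2)) (2 * d * _) => *; lra.
  - move=> i; rewrite -mulrBl ler_pdivrMr// aE bE' -mulrBr (mulrC M) -[X in _ <= X]mulrA ler_pM2l//.
    have := Upsilon2_lipschitz Hip Hsep Hc t0 C0 (dZ i) (ltW d0) (ltW d_1) tdT (ZN i).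
    rewrite Zt; have /ler_normlP[h1 _] := Ile (dUpsilon2 (gshift e r k i)).
    have h2 : `|dUpsilon2 (gshift e r k i)| * C * d <= 4 * N1 * C * d.
      rewrite ler_wpM2r ?(ltW d0)// ler_wpM2r// (le_trans (norm_dUpsilon2 (LS i)))//.
      by rewrite ler_pM2l.
    have h3 : 0 <= T * d by rewrite mulr_ge0// ltW.
    move: h1 h2 h3; move: (Upsilon2 _) (Upsilon2 _) (I _) (`|dUpsilon2 _| * C * d) (2 * d * _).
    move=> u v w z y h1 h2 h3 h4; rewrite /M; clear - h1 h2 h3 h4 dd; lra.
rewrite -mulrBl ler_pdivrMr// /eta divfK ?gt_eqF// /I.
move: (rint _ _ _) (limn (series tau)) => ? ? ?; lra.
Qed.

(** The increment of [Upsilon2] enters [gh r] through [strip_increment]. *)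
Lemma gauge_increment (g : hpath H -> R) r k C eps : in_G T e (ptime k) g r -> Lambda T 0 k -> ptime k < T ->
  0 <= C -> 0 < eps ->
  exists2 d0 : R, 0 < d0 & forall X G d, 0 < d -> d < d0 ->
    flow_driven T e (ptime k) C X G -> restrict_path (ptime k) X = k ->
    g (restrict_path (ptime k + d) X) - g k <= d * dtG T r k
      + rint (ptime k) (ptime k + d) (fun x => ip (dxG ip e r k) (G x)) + eps * d.
Proof.
set t := ptime k; move=> [_ hC1 mono [N N0 [de0 LP PN deN]] cg] Lk kT C0 eps0.
have t0 : 0 <= t by case: Lk => /andP[].
have LP' i := (LP i).1; have LPt i := (LP i).2.
have e2 : 0 < eps / 2 by rewrite divr_gt0.
have [d1 d10 h1] := gauge_series_increment Lk kT de0 LP PN deN C0 e2.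
pose p2 := partial2 (gh r) t (Upsilon2 k).
have p20 : 0 <= p2 by apply: mono; rewrite t0 ltW.
have p21 : 0 < p2 + 1 by rewrite ltr_wpDl.
pose e1 := Num.min 1 (eps / 4 / (p2 + 1)).
have e10 : 0 < e1 by rewrite lt_min ltr01 !divr_gt0.
have p2e : p2 * e1 <= eps / 4.
  apply: (@le_trans _ _ ((p2 + 1) * (eps / 4 / (p2 + 1)))); last by rewrite mulrC divfK ?gt_eqF.
  by apply: ler_pM; rewrite ?(ltW e10)// ?lerDl// ge_min lexx orbT.
have e1_1 : e1 <= 1 by rewrite ge_min lexx.
clearbody e1.
pose B := `|dUpsilon2 k| * C + 1.
have B0 : 0 <= B by rewrite addr_ge0// mulr_ge0.
have e4 : 0 < eps / 4 by rewrite divr_gt0.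
have [d2 d20 h2] := Upsilon2_increment Hip Hsep He Hc Lk kT C0 e10.
have [d3 d30 h3] := strip_increment hC1 (Upsilon2 k) t0 kT B0 e4 mono.
exists (Num.min (Num.min d1 d2) (Num.min d3 (T - t))).
  by rewrite !lt_min d10 d20 d30 subr_gt0.
move=> X G d d0; rewrite !lt_min => /andP[/andP[dd1 dd2] /andP[dd3 dT]] dX Xk.
rewrite -/t in h1 h2 dX Xk dT.
have tdT : t + d <= T by rewrite -lerBrDl ltW.
have ttd : t <= t + d by rewrite lerDl ltW.
have td0 : 0 <= t + d by rewrite (le_trans t0).
have LX : Lambda T t (restrict_path (t + d) X).
  by apply: Lambda_restrict => //; [rewrite ttd|exact: fd_cont dX].
have Lk' : Lambda T t k by case: Lk => ? ? ?; split => //; rewrite lexx ltW.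
have hs := h1 X G d _ _ d0 dd1 dX Xk (cg _ LX) (cg _ Lk').
have hU := h2 X G d d0 dd2 dX Xk.
pose I v := rint t (t + d) (fun x => ip v (G x)).
have mI v : bmeas t (t + d) (fun x => ip v (G x)).
  apply: eq_bmeas (bmeas_ip Hip v (vmeas_sub (lexx t) tdT (fd_meas dX))) => x _.
  by rewrite ipC.
have Ile v : `|I v| <= `|v| * C * d.
  rewrite (le_trans (norm_rint_le (C := `|v| * C) ttd (mI v) _))//.
    move=> x /andP[tx xd]; rewrite (le_trans (norm_ip_le Hip _ _))// ler_wpM2l//.
    by apply: (fd_bound dX); rewrite tx (le_trans xd).
  by rewrite (addrAC t) subrr add0r.
have JB : `|I (dUpsilon2 k) + e1 * d| <= B * d.
  rewrite (le_trans (ler_normD _ _))// /B mulrDl lerD//.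
  by rewrite ger0_norm ?mulr_ge0 ?(ltW e10) ?(ltW d0)// ler_pM2r.
have := h3 d _ _ d0 dd3 JB hU; rewrite -/p2 => hh.
have LS i : Lambda T 0 (gshift e r k i) by exact: Lambda_gshift.
have ser : series (fun i => gdelta r i *: dx ip (@Upsilon2 R H) (gshift e r k i)) =
    series (fun i => gdelta r i *: dUpsilon2 (gshift e r k i)).
  by congr series; apply/funext => i; rewrite (dx_Upsilon2 Hip (LS i)).
have IE : rint t (t + d) (fun x => ip (dxG ip e r k) (G x)) =
    p2 * I (dUpsilon2 k) + I (limn (series (fun i => gdelta r i *: dUpsilon2 (gshift e r k i)))).
  rewrite /I -rintZ// -rintD//; last exact: bmeasZ.
  apply: eq_rint => x _; rewrite /dxG ser (dx_Upsilon2 Hip Lk) -/t -/p2.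
  by rewrite ipDl ipZl.
rewrite IE /dtG -/t; rewrite restrict_time -/(I _) in hs.
move: hs hh.
move: (g _) (g k) (gh r _ _) (gh r t _) (partial1 _ _ _ _) (I (dUpsilon2 k)) (I _) (limn _).
move=> u v w y z j1 j2 l hs hh.
have : p2 * e1 * d <= eps / 4 * d by rewrite ler_pM2r.
clear - hs hh; lra.
Qed.

End Gauge.

(** * The value is a viscosity solution *)

Section Viscosity.
Context (R : realType) (H : completeNormedModType R) (ip : {dot H for idfun})
    (T : R) (A : operator H) (e : R -> {linear H -> H}) (U : metricType R)
    (F : hpath H -> U -> H) (q : hpath H -> U -> R) (phi : hpath H -> R) (L : R).
Hypothesis S : standing ip T A e F q phi L.
Hypothesis U0 : [set: U] !=set0.
Implicit Types (k : hpath H) (X : R -> H) (u : R -> U) (w : U) (a b d eps : R) (p : H).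

Let Hip := st_ip S.
Let Hsep := st_sep S.
Let T0 : 0 <= T := ltW (st_T S).
Let He := st_e S.
Let Hc := st_contr S.
Let L0 : 0 <= L := ltW (st_L S).

Local Notation ctl t := (@controls R T U t).
Local Notation mld k u := (mild_solution T e F k u).
Local Notation velocity k u := (fun r => F (restrict_path r (mld k u)) (u r)).
Local Notation reward k u := (fun r => q (restrict_path r (mld k u)) (u r)).
Local Notation V := (value T e F q phi).

Lemma vmeas_velocity k u : Lambda T 0 k -> ctl (ptime k) u -> vmeas (ptime k) T (velocity k u).
Proof.
move=> Lk hu; have cX := mild_continuous S Lk hu; set X := mild_solution _ _ _ _ _ in cX *.
have t0 : 0 <= ptime k by case: Lk => /andP[].
have inT r : ptime k <= r <= T -> 0 <= r <= T by move=> /andP[/(le_trans t0) -> ->].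
apply: (vmeas_diagonal (G := fun c r => F (restrict_path c X) (u r)) (C := Kvel T L (pnorm k))).
- move=> c cT h.
  apply: (@measurable_control _ T _ (fun w => `|F (restrict_path c X) w - h|) u (ptime k)) => //.
  have [cF _] := st_cont S (Lambda_restrictT cX (inT c cT)).
  move=> w; apply/cvgrPdist_lt => eps eps0.
  have /cvgrPdist_lt/(_ eps eps0) := cF w; apply: filterS => w' hw'.
  by rewrite (le_lt_trans (ler_dist_dist _ _))// opprB addrA subrK.
- move=> x xT eps eps0.
  have eps1 : 0 < eps / L by rewrite divr_gt0// (st_L S).
  have [d d0 hd] := dinf_restrict_near He Hc cX (inT x xT) eps1.
  exists d => // c /andP[tc cx] xcd; have c0 := le_trans t0 tc.
  have cT : 0 <= c <= T by rewrite c0 (le_trans cx)//; case/andP: xT.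
  rewrite (le_lt_trans (st_FL S _ (Lambda_restrictT cX cT) (Lambda_restrictT cX (inT x xT))))//.
  by rewrite mulrC -ltr_pdivlMr ?(st_L S)//; apply: hd => //; rewrite c0.
- by move=> x xT; apply: (F_mild_le S) => //; exact: inT.
Qed.

Lemma driven_mild k u : Lambda T 0 k -> ctl (ptime k) u ->
  flow_driven T e (ptime k) (Kvel T L (pnorm k)) (mld k u) (velocity k u).
Proof.
move=> Lk hu; have cX := mild_continuous S Lk hu.
have t0 : 0 <= ptime k by case: Lk => /andP[].
split => //.
- exact: vmeas_velocity.
- by move=> r /andP[tr rT]; apply: (F_mild_le S) => //; rewrite (le_trans t0 tr).
- by move=> b /andP[tb bT]; apply: (vmeas_drv S Lk hu cX).
- by move=> a b ta ab bT; apply: (mild_after S) => //; rewrite ta.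
Qed.

(** Uniform in the control, as the driving velocity is bounded by [Kvel]. *)
Lemma dinf_mild_near k eps : Lambda T 0 k -> ptime k < T -> 0 < eps ->
  exists2 d0 : R, 0 < d0 & forall u r, ctl (ptime k) u -> ptime k <= r -> r < ptime k + d0 ->
    r <= T -> dinf T e k (restrict_path r (mld k u)) < eps.
Proof.
move=> Lk kT eps0; have p0 := pnorm_ge0 (lexx 0) Lk; set t := ptime k in kT *.
have t0 : 0 <= t by case: Lk => /andP[].
pose C := Kvel T L (pnorm k); have C0 : 0 <= C by apply: (Kvel_ge0 S).
have C1 : 0 < 1 + C by rewrite ltr_pwDl.
exists (eps / (1 + C)); first by rewrite divr_gt0.
move=> u r hu tr; rewrite -ltrBlDl ltr_pdivlMr// => rd rT.
have dX := driven_mild Lk hu; have r0 := le_trans t0 tr.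
apply: le_lt_trans rd; rewrite mulrDr mulr1 mulrC.
rewrite [leRHS](_ : _ = r - t + C * (r - t)); last by ring.
have dl := @dinf_le _ _ e T He Hc k (restrict_path r (mld k u)) (C * (r - t)) t0; apply: dl; first by rewrite restrict_time -/t tr.
- move=> s /andP[s0 st]; rewrite restrictE ?s0 ?(le_trans (ltW st))//.
  by rewrite (mild_before S) ?s0// subrr normr0 mulr_ge0// subr_ge0.
- move=> s /andP[ts sr]; rewrite restrictE ?(le_trans t0 ts)// distrC.
  rewrite (fd_eq dX (lexx _) ts (le_trans sr rT)) (mild_start S)// addrAC subrr add0r.
  rewrite (le_trans (driven_increment Hip Hsep Hc C0 dX (lexx _) ts (le_trans sr rT)))//.
  by rewrite ler_wpM2l// lerD2r.
Qed.

Lemma integrand_near k p eps : Lambda T 0 k -> ptime k < T -> 0 < eps ->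
  exists2 d0 : R, 0 < d0 & forall u r, ctl (ptime k) u -> ptime k <= r -> r < ptime k + d0 ->
    r <= T -> `|ip p (velocity k u r) + reward k u r - (ip p (F k (u r)) + q k (u r))| <= eps.
Proof.
move=> Lk kT eps0; have t0 : 0 <= ptime k by case: Lk => /andP[].
have K0 : 0 < L * (1 + `|p|) by rewrite mulr_gt0 ?(st_L S)// ltr_pwDl.
have [d0 d00 hd] := dinf_mild_near Lk kT (divr_gt0 eps0 K0).
exists d0 => // u r hu tr rd rT; have {hd} := hd u r hu tr rd rT.
have rT' : 0 <= r <= T by rewrite (le_trans t0 tr).
have LX := Lambda_restrictT (mild_continuous S Lk hu) rT'.
set Q := restrict_path r _ in LX *; rewrite dinfC ltr_pdivlMr// => /ltW hd.
have hq := st_qL S (u r) LX Lk; have hF := st_FL S (u r) LX Lk.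
have hp := le_trans (norm_ip_le Hip p _) (ler_wpM2l (normr_ge0 p) hF).
rewrite opprD addrACA -ipBr (le_trans (ler_normD _ _))// (le_trans _ hd)//.
by rewrite (le_trans (lerD hp hq))//; lra.
Qed.

Lemma test_pair_increment (f g : hpath H -> R) r k eps : Phi ip A T e f -> Lambda T 0 k ->
  ptime k < T -> in_G T e (ptime k) g r -> 0 < eps ->
  exists2 d0 : R, 0 < d0 & forall u d, ctl (ptime k) u -> 0 < d -> d < d0 ->
    (f (restrict_path (ptime k + d) (mld k u)) + g (restrict_path (ptime k + d) (mld k u)))
      - (f k + g k)
    <= d * (dt f k + dtG T r k + ip (oval (adjoint ip A) (dx ip f k)) (k (ptime k)))
     + rint (ptime k) (ptime k + d) (fun s => ip (dx ip f k + dxG ip e r k) (velocity k u s))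
     + eps * d.
Proof.
move=> hf Lk kT hg eps0; have C0 := Kvel_ge0 S (pnorm_ge0 (lexx 0) Lk).
have e2 : 0 < eps / 2 by rewrite divr_gt0.
have [d1 d10 h1] := test_functional_increment Hip Hsep He (st_A S) Hc hf Lk kT C0 e2.
have [d2 d20 h2] := gauge_increment Hip Hsep He Hc hg Lk kT C0 e2.
exists (Num.min (T - ptime k) (Num.min d1 d2)); first by rewrite !lt_min subr_gt0 kT d10.
move=> u d hu d0; rewrite !lt_min => /and3P[dT dd1 dd2].
have dX := driven_mild Lk hu; have Xk := restrict_mild S Lk hu.
have /ler_normlP[_] := h1 _ _ d d0 dd1 dX Xk; have := h2 _ _ d d0 dd2 dX Xk.
have tdT : ptime k + d <= T by rewrite -lerBrDl ltW.
have mI v : bmeas (ptime k) (ptime k + d) (fun x => ip v (velocity k u x)).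
  apply: eq_bmeas (bmeas_ip Hip v (vmeas_sub (lexx _) tdT (fd_meas dX))) => x _.
  by rewrite ipC.
have -> : rint (ptime k) (ptime k + d) (fun s => ip (dx ip f k + dxG ip e r k) (velocity k u s)) =
  rint (ptime k) (ptime k + d) (fun s => ip (dx ip f k) (velocity k u s)) +
  rint (ptime k) (ptime k + d) (fun s => ip (dxG ip e r k) (velocity k u s)).
  by rewrite -rintD//; apply: eq_rint => s _; rewrite ipDl.
move: (rint _ _ _) (rint _ _ _) (f k) (g k) (dt f k) (dtG T r k) (ip (oval _ _) _).
by move: (f _) (g _) => *; lra.
Qed.

Lemma bmeas_integrand k u p d : Lambda T 0 k -> ctl (ptime k) u -> ptime k + d <= T ->
  bmeas (ptime k) (ptime k + d) (fun s => ip p (velocity k u s)) /\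
  bmeas (ptime k) (ptime k + d) (reward k u).
Proof.
move=> Lk hu tdT; split; last exact: (bmeas_sub (lexx _) tdT (bmeas_qmild S Lk hu (lexx _))).
apply: eq_bmeas (bmeas_ip Hip p (vmeas_sub (lexx _) tdT (vmeas_velocity Lk hu))) => x _.
by rewrite ipC.
Qed.

Lemma le_Hamiltonian k p c : (forall w, c <= ip p (F k w) + q k w) -> c <= Hamiltonian ip F q k p.
Proof.
move=> h; apply: lb_le_inf; last by move=> _ [w _ <-].
by have [w _] := U0; exists (ip p (F k w) + q k w), w.
Qed.

Lemma Hamiltonian_le k p w : Lambda T 0 k -> Hamiltonian ip F q k p <= ip p (F k w) + q k w.
Proof.
move=> Lk; apply: ge_inf; last by exists w.
exists (- (`|p| * (L * (1 + pnorm k)) + L * (1 + pnorm k))) => _ [v _ <-].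
have h1 := le_trans (norm_ip_le Hip p (F k v)) (ler_wpM2l (normr_ge0 p) (st_F S v Lk)).
have h2 := st_q S v Lk.
move: h1 h2; rewrite !ler_norml => /andP[h1 _] /andP[h2 _]; lra.
Qed.

(** Constant controls suffice, since the inequality is required for each element
    of [U] separately. *)
Lemma value_subsolution : viscosity_subsolution ip T A e F q phi V.
Proof.
split; first exact: (value_continuous S U0).
  by move=> k Lk; rewrite (value_terminal S U0).
move=> f g r k hf Lk kT hg touch supE.
have below k' : Lambda T (ptime k) k' -> V k' <= f k' + g k'.
  move=> Lk'; have : ((V k' - f k' - g k')%:E <= 0)%E.
    by rewrite -supE; apply: ereal_sup_ubound; exists k'.
  by rewrite lee_fin; lra.
have t0 : 0 <= ptime k by case: Lk => /andP[].
set p := dx ip f k + dxG ip e r k; set c := dt f k + dtG T r k + _.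
suff : - c <= Hamiltonian ip F q k p by lra.
apply: le_Hamiltonian => w; apply/ler_addgt0Pr => eps eps0.
have e2 : 0 < eps / 2 by rewrite divr_gt0.
have [d1 d10 h1] := test_pair_increment hf Lk kT hg e2.
have [d2 d20 h2] := integrand_near p Lk kT e2.
pose m := Num.min (T - ptime k) (Num.min d1 d2); pose d := m / 2.
have m0 : 0 < m by rewrite !lt_min subr_gt0 kT d10.
have d0 : 0 < d by rewrite divr_gt0.
have dm : d < m by rewrite /d; lra.
move: dm; rewrite !lt_min => /and3P[dT dd1 dd2]; clearbody d.
rewrite -(@ler_pM2r _ d)// mulrDl.
have hu : ctl (ptime k) (fun=> w) by exact: controls_cst.
have tdT : ptime k <= ptime k + d <= T by rewrite lerDl (ltW d0) -lerBrDl ltW.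
have [ttd td_T] := andP tdT.
have inc := h1 _ d hu d0 dd1; rewrite -/p -/c in inc.
have dp := dpp_le S U0 Lk hu tdT.
have Lx : Lambda T (ptime k) (restrict_path (ptime k + d) (mld k (fun=> w))).
  by apply: Lambda_restrict => //; [rewrite (le_trans t0)|exact: (mild_continuous S Lk hu)].
have := below _ Lx.
have [m1 m2] := bmeas_integrand p Lk hu td_T.
have : rint (ptime k) (ptime k + d) (fun s => ip p (velocity k (fun=> w) s)) +
   rint (ptime k) (ptime k + d) (reward k (fun=> w)) <=
     (ip p (F k w) + q k w + eps / 2) * (ptime k + d - ptime k).
  rewrite -rintD//; apply: rint_le => //; first exact: bmeasD.
  move=> s /andP[ts std]; have := h2 _ s hu ts; rewrite (le_lt_trans std) ?ltrD2l// => /(_ isT).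
  by rewrite (le_trans std)// => /(_ isT) /ler_normlP[_]; rewrite /=; lra.
rewrite (addrAC (ptime k)) subrr add0r.
move: inc dp touch.
move: (rint _ _ _) (rint _ _ _) (f k) (g k) (V k) (ip p _) (q k w) c.
move: (f _) (g _) (V _) => a1 a2 a3 a4 a5 a6 a7 a8 a9 a10 c b1 b2 b3 b4 b5.
by lra.
Qed.

(** The control is only known to be optimal up to [eps * d] and may oscillate;
    the Hamiltonian bounds the integrand from below at each time. *)
Lemma value_supersolution : viscosity_supersolution ip T A e F q phi V.
Proof.
split; first exact: (value_continuous S U0).
  by move=> k Lk; rewrite (value_terminal S U0).
move=> f g r k hf Lk kT hg touch infE.
have above k' : Lambda T (ptime k) k' -> - (f k' + g k') <= V k'.
  move=> Lk'; have : (0 <= (V k' + f k' + g k')%:E)%E.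
    by rewrite -infE; apply: ereal_inf_lbound; exists k'.
  by rewrite lee_fin; lra.
have t0 : 0 <= ptime k by case: Lk => /andP[].
rewrite -(opprD (dx ip f k)); set p := dx ip f k + dxG ip e r k.
pose c := dt f k + dtG T r k + ip (oval (adjoint ip A) (dx ip f k)) (k (ptime k)).
suff : Hamiltonian ip F q k (- p) <= c by rewrite /c; lra.
apply/ler_addgt0Pr => eps eps0.
have e3 : 0 < eps / 3 by rewrite divr_gt0.
have [d1 d10 h1] := test_pair_increment hf Lk kT hg e3.
have [d2 d20 h2] := integrand_near (- p) Lk kT e3.
pose m := Num.min (T - ptime k) (Num.min d1 d2); pose d := m / 2.
have m0 : 0 < m by rewrite !lt_min subr_gt0 kT d10.
have d0 : 0 < d by rewrite divr_gt0.
have dm : d < m by rewrite /d; lra.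
move: dm; rewrite !lt_min => /and3P[dT dd1 dd2]; clearbody d.
rewrite -(@ler_pM2r _ d)// mulrDl.
have tdT : ptime k <= ptime k + d <= T by rewrite lerDl (ltW d0) -lerBrDl ltW.
have [ttd td_T] := andP tdT.
have ed0 : 0 < eps / 3 * d by rewrite mulr_gt0.
have [u hu dp] := dpp_ge S U0 Lk tdT ed0.
have inc := h1 _ d hu d0 dd1; rewrite -/p -/c in inc.
have Lx : Lambda T (ptime k) (restrict_path (ptime k + d) (mld k u)).
  by apply: Lambda_restrict => //; [rewrite (le_trans t0)|exact: (mild_continuous S Lk hu)].
have := above _ Lx.
have [m1 m2] := bmeas_integrand p Lk hu td_T.
have : (Hamiltonian ip F q k (- p) - eps / 3) * (ptime k + d - ptime k) <=
   rint (ptime k) (ptime k + d) (reward k u) -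
   rint (ptime k) (ptime k + d) (fun s => ip p (velocity k u s)).
  rewrite -rintB//; apply: rint_ge => //; first exact: bmeasB.
  move=> s /andP[ts std]; have := h2 _ s hu ts; rewrite (le_lt_trans std) ?ltrD2l// => /(_ isT).
  rewrite (le_trans std)// => /(_ isT) /ler_normlP[+ _].
  have := Hamiltonian_le (- p) (u s) Lk; rewrite (ipNl _ p (F (restrict_path _ _) _)).
  by move: (Hamiltonian _ _ _ _ _) (ip _ _) (ip _ _) (q _ _) (q _ _) => *; lra.
rewrite (addrAC (ptime k)) subrr add0r.
move: inc dp touch.
move: (rint _ _ _) (rint _ _ _) (f k) (g k) (V k) (Hamiltonian _ _ _ _ _) c.
move: (f _) (g _) (V _) => a1 a2 a3 a4 a5 a6 a7 a8 a9 c b1 b2 b3 b4 b5.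
by lra.
Qed.

End Viscosity.

Theorem theorem3p1 (R : realType) (H : completeNormedModType R)
    (ip : {dot H for idfun})
    (H_hilbert : inner_product_of_norm ip) (H_separable : separable_space H)
    (T : R) (T_gt0 : 0 < T)
    (A : operator H) (e : R -> {linear H -> H})
    (e_semigroup : C0_semigroup e) (A_generates : generates A e)
    (U : metricType R) (U_nonempty : [set: U] !=set0)
    (F : hpath H -> U -> H) (q : hpath H -> U -> R) (phi : hpath H -> R)
    (ha : contraction_semigroup e) (hb : hyp_b T F q) (hc : hyp_c T e F q phi) :
  viscosity_solution ip T A e F q phi (value T e F q phi).
Proof.
have [L L0 [hFq hphi]] := hc.
have Ld g k u : Lambda T 0 g -> Lambda T 0 k -> _ := fun Lg Lk => hFq g k u Lg Lk.
have S : standing ip T A e F q phi L.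
  split=> //.
  - move=> g u Lg; have [h _ _ _] := Ld g g u Lg Lg.
    have p0 := pnorm_ge0 (lexx 0) Lg.
    rewrite -ler_sqr ?nnegrE ?mulr_ge0 ?addr_ge0// ?(ltW L0)//.
    rewrite (le_trans h)// exprMn ler_wpM2l ?sqr_ge0//; lra.
  - by move=> g k u Lg Lk; case: (Ld g k u Lg Lk).
  - by move=> g u Lg; case: (Ld g g u Lg Lg).
  - by move=> g k u Lg Lk; case: (Ld g k u Lg Lk).
  - by move=> g Lg; case: (hphi g g Lg Lg).
  - by move=> g k Lg Lk; case: (hphi g k Lg Lk).
by split; [exact: (value_subsolution S U_nonempty)|exact: (value_supersolution S U_nonempty)].
Qed.
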